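(* Let $\omega\in\widehat{\mathcal{D}}$. For every $0<p<\infty$, the union of two $A^p_\omega$-zero sets is an $A^{p/2}_\omega$-zero set. However, for every $0<q<\infty$, there are two $\bigcap_{p<q}A^p_\omega$-zero sets such that their union is not an $A^{q/2}_\omega$-zero set.
   Context: $\mathbb{D}$ is the open unit disc, $dA=\frac{dx\,dy}{\pi}$. A weight is a nonnegative integrable function on $\mathbb{D}$ (not a.e. zero); it is radial if $\omega(z)=\omega(|z|)$. $\widehat{\mathcal{D}}$ is the class of radial weights $\omega$ such that $\widehat{\omega}(r)=\int_r^1\omega(s)\,ds$ satisfies $\widehat{\omega}(r)\le C\,\widehat{\omega}\left(\frac{1+r}{2}\right)$ for all $0\le r<1$ and some $C=C(\omega)\ge1$. $A^p_\omega$ is the space of analytic $f$ in $\mathbb{D}$ with $\int_{\mathbb{D}}|f|^p\omega\,dA<\infty$. For a space $X$ of analytic functions in $\mathbb{D}$, a sequence $\{z_k\}$ is an $X$-zero set if there is $f\in X$ that vanishes precisely on the points $\{z_k\}$ (zeros repeated according to multiplicity) and nowhere else. The intersection $\bigcap_{p<q}$ is over $0<p<q$. Unions are taken as sequences, counting multiplicity. *)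

(* Defs.v *)
From HB Require Import structures.
From mathcomp Require Import all_boot all_order all_algebra.
From mathcomp Require Import all_classical all_reals all_analysis.
From mathcomp Require Import complex.

Set Implicit Arguments.
Unset Strict Implicit.
Unset Printing Implicit Defensive.

Import Order.TTheory GRing.Theory Num.Theory.
Import numFieldNormedType.Exports.
Import Normc.

Local Open Scope classical_set_scope.
Local Open Scope ring_scope.
Local Open Scope complex_scope.

(* [normc] is the modulus as a real number; [`|z|] would be in R[i]. *)
Definition unit_disc (R : realType) : set R[i] := [set z | normc z < 1].
Arguments unit_disc R : clear implicits.

Definition of_plane (R : realType)
    (xy : measurableTypeR R * measurableTypeR R) : R[i] :=
  (xy.1 : R) +i* (xy.2 : R).

Definition plane_disc (R : realType) :
    set (measurableTypeR R * measurableTypeR R) :=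
  @of_plane R @^-1` unit_disc R.
Arguments plane_disc R : clear implicits.

Lemma invr_pi_ge0 (R : realType) : 0 <= (pi : R)^-1.
Proof. by rewrite invr_ge0 pi_ge0. Qed.

(* dA = dx dy / pi *)
Definition area (R : realType) :
    {measure set (measurableTypeR R * measurableTypeR R) -> \bar R} :=
  mscale (NngNum (invr_pi_ge0 R))
    (lebesgue_measure \x lebesgue_measure)%E.

(* The library's [integrable] requires Borel measurability; Lebesgue integrable
   means almost everywhere equal to a Borel integrable function.  The library
   integral of a nonnegative function is the supremum of the integrals of the
   Borel simple functions below it, so it is unaffected by changing the
   integrand on a null set and is the usual integral for Lebesgue measurable
   nonnegative integrands. *)
Definition lebesgue_integrable_disc (R : realType) (w : R[i] -> R) : Prop :=
  exists2 g : measurableTypeR R * measurableTypeR R -> R,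
    (area R).-integrable (plane_disc R) (EFin \o g) &
    {ae area R, forall xy, plane_disc R xy -> w (of_plane xy) = g xy}.

(* Functions on the disc are total functions on R[i]; only their values on the
   disc are ever used. *)
Definition weight (R : realType) (w : R[i] -> R) : Prop :=
  [/\ forall z, unit_disc R z -> 0 <= w z,
      lebesgue_integrable_disc w &
      ~ {ae area R, forall xy, plane_disc R xy -> w (of_plane xy) = 0}].

Definition radial (R : realType) (w : R[i] -> R) : Prop :=
  forall z, unit_disc R z -> w z = w (normc z)%:C.

(* Extended-real valued: a radial weight may have infinite integral near 0
   along the radius, and then the doubling condition at r = 0 fails. *)
Definition hat (R : realType) (w : R[i] -> R) (r : R) : \bar R :=
  (\int[lebesgue_measure]_(s in `[r, 1%R[) (w s%:C)%:E)%E.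

Definition Dhat (R : realType) (w : R[i] -> R) : Prop :=
  [/\ weight w, radial w &
      exists2 C : R, 1 <= C &
        forall r : R, 0 <= r < 1 ->
          (hat w r <= C%:E * hat w ((1 + r) / 2)%R)%E].

(* [R[i]^o] is R[i] as a normed space over the field R[i], so [derivable] is
   complex differentiability. *)
Definition analytic_disc (R : realType) (f : R[i] -> R[i]) : Prop :=
  forall z, unit_disc R z -> derivable (f : R[i]^o -> R[i]^o) z 1.

Definition bergman (R : realType) (w : R[i] -> R) (p : R) :
    set (R[i] -> R[i]) :=
  [set f | analytic_disc f /\
    (\int[area R]_(xy in plane_disc R)
       (normc (f (of_plane xy)) `^ p * w (of_plane xy))%:E < +oo)%E].

(* Order 0 means that [f a != 0]. *)
Definition zero_order (R : realType) (f : R[i] -> R[i]) (a : R[i]) (m : nat) :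
    Prop :=
  exists g : R[i] -> R[i],
    [/\ analytic_disc g, g a != 0 &
        forall z, unit_disc R z -> f z = (z - a) ^+ m * g z].

(* A finite or infinite sequence, with possible repetitions, is a family
   indexed by a countable type.  The order at each point of the disc is the
   number of indices at which the family takes that value; in particular f is
   not identically zero and each value is taken finitely often. *)
Definition zero_set (R : realType) (X : set (R[i] -> R[i])) (I : countType)
    (z : I -> R[i]) : Prop :=
  (forall k, unit_disc R (z k)) /\
  exists2 f, X f &
    forall a, unit_disc R a ->
      exists2 m : nat, zero_order f a m & ([set k | z k = a] #= `I_m)%card.

Definition seq_union (R : realType) (I J : countType)
    (z : I -> R[i]) (w : J -> R[i]) (k : I + J) : R[i] :=
  match k with inl i => z i | inr j => w j end.

(* Main.v *)
Require Import Defs.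
From HB Require Import structures.
From mathcomp Require Import all_boot all_order all_algebra finmap.
From mathcomp Require Import all_classical all_reals all_analysis.
From mathcomp Require Import complex.
From mathcomp Require Import measurable_realfun ring lra.

(** The first half is the inequality |fg|^(p/2) <= |f|^p + |g|^p: the product of
    two functions of the space with exponent p belongs to the space with exponent
    p/2, and the orders of its zeros add up.

    For the second half the two zero sets are equal, to the zero set of a lacunary
    product f(z) = prod_k (1 + a_k z^n_k) with n_k = 2^N_k. Let W_k be the mass
    which the weight gives to the annulus 1 - 1/n_k <= |z| < 1, and let
    a_k = 8 (k + 1) W_k^(-1/q); the N_k are chosen one after the other, each so
    large that W_k is tiny compared with all powers of a_0, ..., a_(k-1) which
    occur ([exists_parameters]).

    The product belongs to the space with exponent p for every p < q
    ([iprod_moment], [summable_terms_parameters]). On the circle |z| = r it is at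
    most 1 + sum_k b_k r^n_k, where b_k = a_k prod_(j < k) (1 + a_j). The doubling
    condition bounds the moment of r^(n_k p) by a multiple of W_k
    ([dyadic_moment]), and b_k^p W_k is essentially a power of the earlier
    coefficients times W_k^(1 - p/q), which is as small as desired because p < q.

    Suppose that g has the doubled zeros. Then g = f^2 h for an analytic function h
    ([analytic_quotient]), and h(0) = g(0) is not zero. Write f = P T, where P
    collects the factors of index at most k. On the annulus above every power
    z^n_j with j <= k has modulus at least 1/4, so |P| >= a_k / 8
    ([normc_pprodC_ge]). As |h T^2|^(q/2) is subharmonic, its integral over the
    annulus is at least |g(0)|^(q/2) W_k ([annulus_mean_ge]). Altogether the
    integral of |g|^(q/2) is at least
    (a_k / 8)^q |g(0)|^(q/2) W_k = (k + 1)^q |g(0)|^(q/2) for every k, so it is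
    infinite ([multiple_moment_ge]).

    The proof of the mean value inequality on annuli rests on the maximum principle
    and on the rotation invariance of the area. The first comes from the theorem of Goursat
    in the coordinate x + iy of z exp(x + iy) ([goursat], [max_modulus]); applied
    to the product of the rotates of a function it gives the mean value inequality
    for the powers of the modulus, for means over roots of unity
    ([rotation_mean_ge]). The second holds because a rotation is a product of
    shears ([lam2_rot]). The product f is analytic
    because the partial products are polynomials with nonnegative coefficients,
    whose Taylor remainders are controlled by their values on the radius
    ([nneg_taylor], [analytic_iprod]).

    The weight is only almost everywhere equal to a Borel function. It is replaced
    by a radial Borel function which agrees with it off a null set and whose masses
    on annuli inherit the doubling condition ([Dhat_profile]). *)

Set Implicit Arguments.
Unset Strict Implicit.
Unset Printing Implicit Defensive.
Import Order.TTheory GRing.Theory Num.Theory.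
Import numFieldNormedType.Exports.
Import Normc.
Local Open Scope classical_set_scope.
Local Open Scope ring_scope.
Local Open Scope complex_scope.

(** * Analytic functions on the disc and their quotients *)

Section ComplexModulus.
Context {R : realType}.
Implicit Types (z x y : R[i]) (f g : R[i] -> R[i]).

Lemma normcE z : `|z| = (normc z)%:C. Proof. by []. Qed.

Lemma normc_ge0 z : 0 <= normc z.
Proof. by case: z => a b; exact: sqrtr_ge0. Qed.

Lemma normcD x y : normc (x + y) <= normc x + normc y.
Proof. exact: (@le_normcD R x y). Qed.

Lemma normcN x : normc (- x) = normc x.
Proof. exact: (@normcN R x). Qed.

Lemma normc_distC x y : normc (x - y) = normc (y - x).
Proof. by rewrite -normcN opprB. Qed.

Lemma normc_lerB x y : normc x - normc y <= normc (x - y).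
Proof. by rewrite lerBlDr -{1}(subrK y x) normcD. Qed.

Lemma normc_lerBD x y : normc x - normc y <= normc (x + y).
Proof. by rewrite -(normcN y) -{2}(opprK y) normc_lerB. Qed.

Lemma normc0 : normc (0 : R[i]) = 0.
Proof. exact: normc0. Qed.

Lemma normc1 : normc (1 : R[i]) = 1.
Proof. exact: normc1. Qed.

Lemma normcX z n : normc (z ^+ n) = normc z ^+ n.
Proof.
elim: n => [|n IH]; first by rewrite !expr0 normc1.
by rewrite !exprS normcM IH.
Qed.

Lemma normcR (x : R) : normc x%:C = `|x|.
Proof. by rewrite /= expr0n/= addr0 sqrtr_sqr. Qed.

Lemma normc_eq0 z : (normc z == 0) = (z == 0).
Proof.
by apply/eqP/eqP => [/eq0_normc//|->]; rewrite normc0.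
Qed.

Lemma normc_gt0 z : (0 < normc z) = (z != 0).
Proof. by rewrite lt_def normc_eq0 normc_ge0 andbT. Qed.

Lemma ler_Re_normc z : `|complex.Re z| <= normc z.
Proof. by rewrite -lecR; exact: normc_ge_Re z. Qed.

Lemma ler_Im_normc z : `|complex.Im z| <= normc z.
Proof.
case: z => a b /=; rewrite -(sqrtr_sqr b) ler_wsqrtr// lerDr sqr_ge0//.
Qed.

Lemma normc_prod (I : Type) (r : seq I) (P : pred I) (F : I -> R[i]) :
  normc (\prod_(i <- r | P i) F i) = \prod_(i <- r | P i) normc (F i).
Proof.
by elim/big_rec2: _ => [|i y1 y2 _ <-]; rewrite ?normc1 ?normcM.
Qed.

Lemma normc_sum (I : Type) (r : seq I) (P : pred I) (F : I -> R[i]) :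
  normc (\sum_(i <- r | P i) F i) <= \sum_(i <- r | P i) normc (F i).
Proof.
elim/big_ind2: _ => [|x a y b xa yb|//]; first by rewrite normc0.
by rewrite (le_trans (normcD _ _))// lerD.
Qed.

Lemma near_normcP z (P : set R[i]) :
  (\forall x \near (z : R[i]^o), P x) <->
  (exists2 r : R, 0 < r & forall x, normc (x - z) < r -> P x).
Proof.
split.
  move=> /nbhs_normP[e /= e0 eP]; exists (complex.Re e).
    by move: e0; rewrite ltcE/= => /andP[].
  move=> x xz; apply: eP; rewrite /= normcE normc_distC.
  by move: e0; rewrite !ltcE /= => /andP[-> _]; rewrite xz.
move=> [r r0 rP]; apply/nbhs_normP; exists r%:C; first by rewrite /= ltcR.
by move=> x /=; rewrite normcE ltcR normc_distC; exact: rP.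
Qed.

(** The norm of R[i] takes its values in R[i]; this is complex differentiability
    in terms of the real-valued modulus. *)
Definition cdiff f z (d : R[i]) := forall e : R, 0 < e ->
  exists2 r : R, 0 < r & forall h, normc h < r ->
    normc (f (z + h) - f z - d * h) <= e * normc h.

Lemma derivable_cdiffP f z :
  derivable (f : R[i]^o -> R[i]^o) z 1 <-> exists d, cdiff f z d.
Proof.
have E h d : h != 0 -> normc (d - h^-1 *: (f (h *: (1:R[i]^o) + z) - f z) : R[i]) * normc h =
   normc (f (z + h) - f z - d * h).
  move=> h0; rewrite -normcM -normcN; congr normc.
  have -> : h *: (1 : R[i]^o) = h by exact: mulr1.
  have -> : h^-1 *: (f (h + z) - f z : R[i]^o) = h^-1 * (f (h + z) - f z) by [].
  by rewrite mulrBl mulrAC mulVf// mul1r opprB (addrC h).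
split.
  move=> /cvg_ex[d fd]; exists d => e e0.
  move: fd => /cvgrPdist_le/(_ e%:C).
  rewrite ltcR => /(_ e0); rewrite ?near_simpl /dnbhs /= => /nbhs_normP[r /= r0 rP].
  exists (complex.Re r) => [|h hr]; first by move: r0; rewrite ltcE/= => /andP[].
  have [->|h0] := eqVneq h 0.
    by rewrite addr0 subrr mulr0 subrr normc0 mulr0.
  rewrite -E// ler_wpM2r ?normc_ge0// -lecR.
  apply: rP => //=; rewrite sub0r normrN normcE.
  by move: r0; rewrite !ltcE /= => /andP[-> _]; rewrite hr.
move=> [d fd]; apply/cvg_ex; exists d; apply/cvgrPdist_le => /= e e0.
have [e1 e1E] : exists e1, e = e1%:C.
  by exists (complex.Re e); rewrite RRe_real// gtr0_real.
rewrite e1E ltcR in e0; have [r r0 rP] := fd e1 e0.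
apply/nbhs_normP; exists r%:C => /=; first by rewrite ltcR.
move=> h /=; rewrite sub0r normrN normcE ltcR => hr h0.
rewrite e1E normcE lecR -(ler_pM2r (_ : 0 < normc h)) ?normc_gt0//.
by rewrite E// rP.
Qed.

Lemma cdiff_near f g z d : (\forall x \near (z : R[i]^o), f x = g x) ->
  cdiff f z d -> cdiff g z d.
Proof.
move=> /near_normcP[r r0 rE] fd e e0; have [s s0 sP] := fd e e0.
exists (Num.min r s) => [|h]; first by rewrite lt_min r0.
rewrite lt_min => /andP[hr hs].
by rewrite -!rE ?subrr ?normc0 ?sP// addrAC subrr add0r.
Qed.

Lemma derivable_near f g z : (\forall x \near (z : R[i]^o), f x = g x) ->
  derivable (f : R[i]^o -> R[i]^o) z 1 -> derivable (g : R[i]^o -> R[i]^o) z 1.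
Proof.
move=> fg /derivable_cdiffP[d fd]; apply/derivable_cdiffP.
by exists d; exact: cdiff_near fd.
Qed.

Lemma cdiff_lipschitz f z d : cdiff f z d ->
  exists2 r : R, 0 < r & forall h, normc h < r ->
    normc (f (z + h) - f z) <= (1 + normc d) * normc h.
Proof.
move=> /(_ 1 ltr01)[r r0 rP]; exists r => // h /rP hP.
rewrite -(subrK (d * h) (f (z + h) - f z)) (le_trans (normcD _ _))//.
by rewrite mulrDl lerD// normcM.
Qed.

Lemma cdiff_cont f z d : cdiff f z d -> forall e : R, 0 < e ->
  \forall x \near (z : R[i]^o), normc (f x - f z) < e.
Proof.
move=> /cdiff_lipschitz[r r0 rP] e e0; apply/near_normcP.
have d1 : 0 < 1 + normc d by rewrite ltr_wpDr ?normc_ge0.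
exists (Num.min r (e / (1 + normc d))) => [|x].
  by rewrite lt_min r0 divr_gt0.
rewrite lt_min => /andP[xr xe]; have := rP _ xr.
rewrite [z + _]addrC subrK => /le_lt_trans; apply.
by rewrite mulrC -ltr_pdivlMr.
Qed.

Lemma unit_disc_near z : unit_disc R z -> \forall x \near (z : R[i]^o), unit_disc R x.
Proof.
move=> z1; apply/near_normcP; exists (1 - normc z); first by rewrite subr_gt0.
move=> x xz; rewrite /unit_disc/= -(subrK z x) (le_lt_trans (normcD _ _))//.
by rewrite -ltrBrDr.
Qed.

Lemma analytic_disc_eq f g : (forall z, unit_disc R z -> f z = g z) ->
  analytic_disc f -> analytic_disc g.
Proof.
move=> fg fa z z1; apply: derivable_near (fa z z1).
by near=> x; apply: fg; near: x; exact: unit_disc_near.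
Unshelve. all: by end_near. Qed.

Lemma analytic_cst (c : R[i]) : analytic_disc (fun=> c).
Proof. by move=> z _; exact: derivable_cst. Qed.

Lemma analytic_id : analytic_disc (fun z : R[i] => z).
Proof. by move=> z _; exact: derivable_id. Qed.

Lemma analyticD f g : analytic_disc f -> analytic_disc g ->
  analytic_disc (fun z => f z + g z).
Proof. by move=> fa ga z z1; apply: derivableD; [exact: fa|exact: ga]. Qed.

Lemma analyticM f g : analytic_disc f -> analytic_disc g ->
  analytic_disc (fun z => f z * g z).
Proof.
move=> fa ga z z1.
exact: (@derivableM _ (R[i]^o) f g z 1 (fa z z1) (ga z z1)).
Qed.

Lemma analyticX f n : analytic_disc f -> analytic_disc (fun z => f z ^+ n).
Proof.
move=> fa; elim: n => [|n IH]; first exact: analytic_cst.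
apply: (@analytic_disc_eq (fun z => f z * f z ^+ n)); last exact: analyticM.
by move=> z _; rewrite exprS.
Qed.

Lemma analytic_prod (I : Type) (r : seq I) (F : I -> R[i] -> R[i]) :
  (forall i, analytic_disc (F i)) ->
  analytic_disc (fun z => \prod_(i <- r) F i z).
Proof.
move=> Fa; elim: r => [|i r IH].
  apply: (@analytic_disc_eq (fun=> 1)); last exact: analytic_cst.
  by move=> z _; rewrite big_nil.
apply: (@analytic_disc_eq (fun z => F i z * \prod_(i <- r) F i z)).
  by move=> z _; rewrite big_cons.
exact: (@analyticM (F i) _ (Fa i) IH).
Qed.

Lemma analytic_cont f z (e : R) : analytic_disc f -> unit_disc R z -> 0 < e ->
  \forall x \near (z : R[i]^o), normc (f x - f z) < e.
Proof. by move=> fa /fa/derivable_cdiffP[d fd] e0; exact: cdiff_cont fd e e0. Qed.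

Lemma analytic_near_neq0 f z : analytic_disc f -> unit_disc R z -> f z != 0 ->
  \forall x \near (z : R[i]^o), f x != 0.
Proof.
move=> fa z1 fz; have := @analytic_cont f z (normc (f z)) fa z1.
rewrite normc_gt0 => /(_ fz); apply: filterS => x.
by apply: contraTneq => ->; rewrite sub0r normcN ltxx.
Qed.

Lemma analytic_scale f (u : R[i]) : normc u <= 1 -> analytic_disc f ->
  analytic_disc (fun z => f (u * z)).
Proof.
move=> u1 fa z z1.
have uz1 : unit_disc R (u * z).
  by rewrite /unit_disc/= normcM (le_lt_trans _ z1)// ler_piMl// normc_ge0.
have /derivable_cdiffP[d fd] := fa _ uz1.
apply/derivable_cdiffP; exists (d * u) => e e0.
have [r r0 rP] := fd e e0; exists r => // h hr.
have uh : normc (u * h) <= normc h by rewrite normcM ler_piMl// normc_ge0.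
rewrite mulrDr -mulrA (le_trans (rP _ (le_lt_trans uh hr)))//.
by rewrite ler_wpM2l// ltW.
Qed.

(** Analytic functions may be divided as soon as the order of vanishing of the
    denominator is nowhere larger: near each point both functions are a power
    times a nonvanishing factor, and the quotient of these expressions fills
    the removable singularities consistently. *)
Lemma analytic_quotient f g : analytic_disc f -> analytic_disc g ->
  (forall a, unit_disc R a -> exists m m',
     [/\ (m <= m')%N, zero_order f a m & zero_order g a m']) ->
  exists2 h, analytic_disc h & forall z, unit_disc R z -> g z = f z * h z.
Proof.
move=> fa ga ord.
have loc a : unit_disc R a -> exists k : R[i] -> R[i],
    derivable (k : R[i]^o -> R[i]^o) a 1 /\
    \forall x \near (a : R[i]^o), g x = f x * k x /\ (x != a -> f x != 0).
  move=> a1; have [m [m' [mm' [f1 [f1a f10 fE]] [g1 [g1a g10 gE]]]]] := ord a a1.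
  exists (fun z => (z - a) ^+ (m' - m) * (g1 z / f1 z)); split.
    apply: (@derivableM _ (R[i]^o) (fun z => (z - a) ^+ (m' - m)) (fun z => g1 z / f1 z)).
      have lin : analytic_disc (fun z => z - a).
        exact: (@analyticD (fun z => z) (fun=> - a) analytic_id (@analytic_cst (- a))).
      exact: (@analyticX _ (m' - m) lin).
    apply: (@derivableM _ (R[i]^o) g1 (fun z => (f1 z)^-1)); first exact: g1a.
    by apply: (@derivableV _ (R[i]^o) f1) => //; exact: f1a.
  near=> x.
  have x1 : unit_disc R x by near: x; exact: unit_disc_near.
  have f1x : f1 x != 0 by near: x; exact: analytic_near_neq0.
  rewrite fE// gE//; split => [|xa].
    rewrite -{1}(subnKC mm') exprD -!mulrA; congr (_ * _).
    rewrite mulrCA; congr (_ * _).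
    by rewrite mulrCA mulfV// mulr1.
  by rewrite mulf_neq0// expf_neq0// subr_eq0.
have /choice[k kP] a : exists k : R[i] -> R[i], unit_disc R a ->
    derivable (k : R[i]^o -> R[i]^o) a 1 /\
    \forall x \near (a : R[i]^o), g x = f x * k x /\ (x != a -> f x != 0).
  have [/loc[k kP]|a1] := pselect (unit_disc R a); first by exists k.
  by exists id.
exists (fun z => k z z) => [a a1|z /kP[_ /nbhs_singleton[]]//].
have [ka nk] := kP a a1.
apply: derivable_near ka; near=> x.
have x1 : unit_disc R x by near: x; exact: unit_disc_near.
have [->//|xa] := eqVneq x a.
have [gE /(_ xa) fx0] : g x = f x * k a x /\ (x != a -> f x != 0) by near: x.
have [_ /nbhs_singleton[gE' _]] := kP x x1.
by apply: (mulfI fx0); rewrite -gE.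
Unshelve. all: by end_near. Qed.

End ComplexModulus.

(** * The theorem of Goursat for closed forms on a rectangle *)

Section SegmentIntegral.
Context {R : realType}.
Implicit Types (f g : R -> R) (a b c d x y m k e : R).
Local Notation mu := (@lebesgue_measure R).

Definition segint f a b : R := \int[mu]_(x in `[a, b]) f x.

Lemma integrable_segment f a b :
  (forall x, x \in `[a, b] -> forall e, 0 < e -> exists2 d : R, 0 < d &
     forall y, y \in `[a, b] -> `|y - x| < d -> `|f y - f x| <= e) ->
  mu.-integrable `[a, b] (EFin \o f).
Proof.
move=> fc; apply: continuous_compact_integrable; first exact: segment_compact.
apply/subspace_continuousP => x xab; apply/cvgrPdist_le => e e0.
have [d d0 dP] := fc x xab e e0.
rewrite near_withinE; apply/nbhs_normP; exists d => //= y xy yab.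
by rewrite distrC dP// distrC.
Qed.

Lemma segintB f g a b : mu.-integrable `[a, b] (EFin \o f) ->
  mu.-integrable `[a, b] (EFin \o g) ->
  segint (fun x => f x - g x) a b = segint f a b - segint g a b.
Proof. by move=> fi gi; rewrite /segint RintegralB. Qed.

Lemma segint_split f a m b : a <= m -> m <= b ->
  mu.-integrable `[a, b] (EFin \o f) ->
  segint f a b = segint f a m + segint f m b.
Proof.
move=> am mb fi; apply/eqP; rewrite addrC -subr_eq /segint; apply/eqP.
rewrite Rintegral_itvB//.
apply: Rintegral_itv_obnd_cbnd; apply: integrableS fi => //.
by apply: subset_itvr; rewrite bnd_simp.
Qed.

Lemma integrable_segmentS f a b c d : a <= c -> d <= b ->
  mu.-integrable `[a, b] (EFin \o f) -> mu.-integrable `[c, d] (EFin \o f).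
Proof.
move=> ac db fi; apply: integrableS fi => //.
by apply: subset_itv; rewrite bnd_simp.
Qed.

Lemma segint_cst k a b : a <= b -> segint (fun=> k) a b = k * (b - a).
Proof.
move=> ab; rewrite /segint Rintegral_cst//= lebesgue_measure_itv/= lte_fin.
have [->|ba] := eqVneq a b; first by rewrite ltxx subrr.
by rewrite lt_neqAle ba ab.
Qed.

Lemma segint_near_cst f k e a b : a <= b ->
  mu.-integrable `[a, b] (EFin \o f) ->
  (forall x, x \in `[a, b] -> `|f x - k| <= e) ->
  `|segint f a b - k * (b - a)| <= e * (b - a).
Proof.
move=> ab fi fk.
have ci r : mu.-integrable `[a, b] (EFin \o (fun=> r : R)).
  apply: continuous_compact_integrable; first exact: segment_compact.
  by apply: continuous_subspaceT => x; exact: cvg_cst.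
have lo : (k - e) * (b - a) <= segint f a b.
  by rewrite -segint_cst//; apply: le_Rintegral => // x /fk; rewrite ler_distl => /andP[].
have hi : segint f a b <= (k + e) * (b - a).
  by rewrite -segint_cst//; apply: le_Rintegral => // x /fk; rewrite ler_distl => /andP[].
by rewrite ler_distl -mulrBl -mulrDl lo hi.
Qed.

End SegmentIntegral.

Section Goursat.
Context {R : realType}.
Implicit Types (a b c d u v x y m e : R).
Local Notation mu := (@lebesgue_measure R).
Variables (A B : R -> R -> R) (x0 x1 y0 y1 : R).
Hypotheses (x01 : x0 <= x1) (y01 : y0 <= y1).

(** First-order expansions of the coefficients of a form A dx + B dy which is
    closed at the point: the y-derivative of A and the x-derivative of B have
    the common value k. *)
Definition closed_at x y := exists A1 k B2, forall e, 0 < e ->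
  exists2 r : R, 0 < r & forall x' y', x' \in `[x0, x1] -> y' \in `[y0, y1] ->
    `|x' - x| < r -> `|y' - y| < r ->
    `|A x' y' - A x y - A1 * (x' - x) - k * (y' - y)| <= e * (`|x' - x| + `|y' - y|) /\
    `|B x' y' - B x y - k * (x' - x) - B2 * (y' - y)| <= e * (`|x' - x| + `|y' - y|).

Hypothesis closedP : forall x y, x \in `[x0, x1] -> y \in `[y0, y1] -> closed_at x y.

Let jet_cont (F : R) A1 k e r dx dy : 0 < e -> 0 < r ->
  `|dx| < Num.min r (e / (1 + `|A1| + `|k|)) -> dy = 0 ->
  `|F - A1 * dx - k * dy| <= 1 * (`|dx| + `|dy|) -> `|F| <= e.
Proof.
move=> e0 r0 + ->; rewrite lt_min => /andP[_].
have k0 : 0 < 1 + `|A1| + `|k| by rewrite ltr_wpDr// ltr_wpDr.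
rewrite ltr_pdivlMr// mulr0 subr0 normr0 addr0 mul1r => dxe H.
rewrite -(subrK (A1 * dx) F) (le_trans (ler_normD _ _))// (le_trans _ (ltW dxe))//.
rewrite normrM; have := normr_ge0 dx; have := normr_ge0 k; have := normr_ge0 A1.
by move: H; nra.
Qed.

Lemma closed_form_integrable_dx y : y \in `[y0, y1] -> mu.-integrable `[x0, x1] (EFin \o (A^~ y)).
Proof.
move=> yI; apply: integrable_segment => x xI e e0.
have [A1 [k [B2 /(_ 1 ltr01)[r r0 rP]]]] := closedP xI yI.
exists (Num.min r (e / (1 + `|A1| + `|k|))) => [|x' x'I xx'].
  by rewrite lt_min r0 divr_gt0// ltr_wpDr// ltr_wpDr.
have xr : `|x' - x| < r by move: xx'; rewrite lt_min => /andP[].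
have yr : `|y - y| < r by rewrite subrr normr0.
have [+ _] := rP x' y x'I yI xr yr.
by apply: (jet_cont e0 r0 xx'); rewrite subrr.
Qed.

Lemma closed_form_integrable_dy x : x \in `[x0, x1] -> mu.-integrable `[y0, y1] (EFin \o (B x)).
Proof.
move=> xI; apply: integrable_segment => y yI e e0.
have [A1 [k [B2 /(_ 1 ltr01)[r r0 rP]]]] := closedP xI yI.
exists (Num.min r (e / (1 + `|B2| + `|k|))) => [|y' y'I yy'].
  by rewrite lt_min r0 divr_gt0// ltr_wpDr// ltr_wpDr.
have yr : `|y' - y| < r by move: yy'; rewrite lt_min => /andP[].
have xr : `|x - x| < r by rewrite subrr normr0.
have [_] := rP x y' xI y'I xr yr.
rewrite addrAC [ `|x - x| + _]addrC.
by apply: (jet_cont e0 r0 yy'); rewrite subrr.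
Qed.

Let I a b c d := segint (A^~ c) a b + segint (B b) c d
                 - segint (A^~ d) a b - segint (B a) c d.

Let inx a b x : x0 <= a -> b <= x1 -> a <= x -> x <= b -> x \in `[x0, x1].
Proof.
move=> xa bx ax xb; rewrite in_itv/= (le_trans xa ax)/=.
exact: le_trans xb bx.
Qed.
Let iny a b x : y0 <= a -> b <= y1 -> a <= x -> x <= b -> x \in `[y0, y1].
Proof.
move=> xa bx ax xb; rewrite in_itv/= (le_trans xa ax)/=.
exact: le_trans xb bx.
Qed.

Let I_splitx a m b c d : x0 <= a -> a <= m -> m <= b -> b <= x1 ->
  y0 <= c -> c <= d -> d <= y1 -> I a b c d = I a m c d + I m b c d.
Proof.
move=> xa am mb bx yc cd dy; rewrite /I.
rewrite (@segint_split _ (A^~ c) a m b)//; last first.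
  by apply: (@integrable_segmentS _ _ x0 x1) => //; apply: closed_form_integrable_dx; exact: (iny yc dy).
rewrite (@segint_split _ (A^~ d) a m b)//; last first.
  by apply: (@integrable_segmentS _ _ x0 x1) => //; apply: closed_form_integrable_dx; exact: (iny yc dy).
by ring.
Qed.

Let I_splity a b c m d : x0 <= a -> a <= b -> b <= x1 ->
  y0 <= c -> c <= m -> m <= d -> d <= y1 -> I a b c d = I a b c m + I a b m d.
Proof.
move=> xa ab bx yc cm md dy; rewrite /I.
rewrite (@segint_split _ (B a) c m d)//; last first.
  by apply: (@integrable_segmentS _ _ y0 y1) => //; apply: closed_form_integrable_dy; exact: (inx xa bx).
rewrite (@segint_split _ (B b) c m d)//; last first.
  by apply: (@integrable_segmentS _ _ y0 y1) => //; apply: closed_form_integrable_dy; exact: (inx xa bx).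
by ring.
Qed.

Let I_small x y e : x \in `[x0, x1] -> y \in `[y0, y1] -> 0 < e ->
  exists2 r : R, 0 < r & forall a b c d, x0 <= a -> b <= x1 -> y0 <= c -> d <= y1 ->
    a <= x <= b -> c <= y <= d -> b - a < r -> d - c < r ->
    `|I a b c d| <= e * ((b - a) + (d - c)) ^+ 2.
Proof.
move=> xI yI e0; have [A1 [k [B2 /(_ _ (divr_gt0 e0 (ltr0n _ 2)))[r r0 rP]]]] := closedP xI yI.
exists r => // a b c d xa bx yc dy /andP[ax xb] /andP[cy yd] bar dcr.
have ab := le_trans ax xb; have cd := le_trans cy yd.
set S := (b - a) + (d - c).
have cc : c <= c <= d by rewrite lexx.
have dd : c <= d <= d by rewrite lexx andbT.
have aa : a <= a <= b by rewrite lexx.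
have bb : a <= b <= b by rewrite lexx andbT.
have E x' y' : a <= x' <= b -> c <= y' <= d ->
    `|A x' y' - A x y - A1 * (x' - x) - k * (y' - y)| <= e / 2 * S /\
    `|B x' y' - B x y - k * (x' - x) - B2 * (y' - y)| <= e / 2 * S.
  move=> /andP[ax' x'b] /andP[cy' y'd].
  have hx : `|x' - x| <= b - a by rewrite ler_norml; apply/andP; split; lra.
  have hy : `|y' - y| <= d - c by rewrite ler_norml; apply/andP; split; lra.
  have hS : e / 2 * (`|x' - x| + `|y' - y|) <= e / 2 * S.
    by rewrite ler_wpM2l ?lerD// divr_ge0// ltW.
  have [] := rP x' y' (inx xa bx ax' x'b) (iny yc dy cy' y'd) (le_lt_trans hx bar) (le_lt_trans hy dcr).
  by move=> h1 h2; split; [exact: le_trans hS|exact: le_trans hS].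
have hA : `|segint (fun x' => A x' c - A x' d) a b - (k * (c - d)) * (b - a)|
    <= (e * S) * (b - a).
  apply: segint_near_cst => //.
    rewrite (_ : EFin \o _ = (fun x' => (EFin \o A^~ c) x' - (EFin \o A^~ d) x')%E)//.
    apply: integrableB => //.
    - apply: (@integrable_segmentS _ _ x0 x1) => //; apply: closed_form_integrable_dx; exact: (iny yc dy).
    - apply: (@integrable_segmentS _ _ x0 x1) => //; apply: closed_form_integrable_dx; exact: (iny yc dy).
  move=> x'; rewrite in_itv/= => x'I.
  have [+ _] := E x' c x'I cc.
  move=> /ler_normlP[h1 h2].
  have [+ _] := E x' d x'I dd.
  move=> /ler_normlP[h3 h4].
  by rewrite ler_norml; apply/andP; split; nra.
have hB : `|segint (fun y' => B b y' - B a y') c d - (k * (b - a)) * (d - c)|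
    <= (e * S) * (d - c).
  apply: segint_near_cst => //.
    rewrite (_ : EFin \o _ = (fun x' => (EFin \o B b) x' - (EFin \o B a) x')%E)//.
    apply: integrableB => //.
    - apply: (@integrable_segmentS _ _ y0 y1) => //; apply: closed_form_integrable_dy; exact: (inx xa bx).
    - apply: (@integrable_segmentS _ _ y0 y1) => //; apply: closed_form_integrable_dy; exact: (inx xa bx).
  move=> y'; rewrite in_itv/= => y'I.
  have [_] := E b y' bb y'I.
  move=> /ler_normlP[h1 h2].
  have [_] := E a y' aa y'I.
  move=> /ler_normlP[h3 h4].
  by rewrite ler_norml; apply/andP; split; nra.
move: hA hB; rewrite segintB; last 2 first.
- apply: (@integrable_segmentS _ _ x0 x1) => //; apply: closed_form_integrable_dx; exact: (iny yc dy).
- apply: (@integrable_segmentS _ _ x0 x1) => //; apply: closed_form_integrable_dx; exact: (iny yc dy).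
rewrite segintB; last 2 first.
- apply: (@integrable_segmentS _ _ y0 y1) => //; apply: closed_form_integrable_dy; exact: (inx xa bx).
- apply: (@integrable_segmentS _ _ y0 y1) => //; apply: closed_form_integrable_dy; exact: (inx xa bx).
move=> hA hB.
have -> : I a b c d = (segint (A^~ c) a b - segint (A^~ d) a b - k * (c - d) * (b - a))
  + (segint (B b) c d - segint (B a) c d - k * (b - a) * (d - c)) by rewrite /I; ring.
rewrite (le_trans (ler_normD _ _))// (le_trans (lerD hA hB))//.
by rewrite -mulrDr -/S expr2 mulrA.
Qed.

(** Goursat's bisection: a rectangle over which the integral is not zero has a
    quarter over which it is at least a fourth as large, and so on; at the
    common point of the nested quarters the first-order expansion makes the
    integral much smaller than the area. *)
Lemma goursat : segint (A^~ y0) x0 x1 + segint (B x1) y0 y1 =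
                segint (A^~ y1) x0 x1 + segint (B x0) y0 y1.
Proof.
suff : I x0 x1 y0 y1 = 0.
  by rewrite /I => /eqP; rewrite -addrA -opprD subr_eq0 => /eqP.
apply/eqP; rewrite -normr_eq0; apply/negPn/negP => I0.
have {}I0 : 0 < `|I x0 x1 y0 y1| by rewrite lt_def I0 normr_ge0.
set eta := `|_| in I0; pose w := x1 - x0; pose h := y1 - y0.
have w0 : 0 <= w by rewrite subr_ge0.
have h0 : 0 <= h by rewrite subr_ge0.
(* After n bisections the sides are w q(n) and h q(n). *)
pose q n : R := 2 ^- n.
have q0 n : 0 < q n by rewrite invr_gt0 exprn_gt0.
have qS n : q n = q n.+1 + q n.+1.
  by rewrite /q exprS invfM; field; rewrite expf_neq0.
pose good n (p : R * R) := [/\ x0 <= p.1, p.1 + w * q n <= x1, y0 <= p.2,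
  p.2 + h * q n <= y1 & eta * (q n) ^+ 2 <= `|I p.1 (p.1 + w * q n) p.2 (p.2 + h * q n)|].
have stepP n p : exists p', good n p -> good n.+1 p' /\
    [/\ p.1 <= p'.1, p'.1 + w * q n.+1 <= p.1 + w * q n,
        p.2 <= p'.2 & p'.2 + h * q n.+1 <= p.2 + h * q n].
  have [gp|] := pselect (good n p); last by exists p.
  case: p gp => u v [/= xu ux yv vy].
  have W0 : 0 <= w * q n.+1 by rewrite mulr_ge0// ltW.
  have H0 : 0 <= h * q n.+1 by rewrite mulr_ge0// ltW.
  rewrite qS !mulrDr in ux vy *; rewrite !addrA in ux vy *.
  set W := w * _ in W0 ux *; set H := h * _ in H0 vy *.
  rewrite (@I_splitx u (u + W)) //; try lra.
  rewrite (@I_splity u (u + W) v (v + H)) //; try lra.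
  rewrite (@I_splity (u + W) (u + W + W) v (v + H)) //; try lra.
  set I1 := I u _ v _; set I2 := I u _ _ _; set I3 := I _ _ v _; set I4 := I _ _ _ _.
  rewrite -mulr2n -[q n.+1 *+ 2]mulr_natl exprMn => Ibig.
  have : eta * q n.+1 ^+ 2 <= `|I1| \/ eta * q n.+1 ^+ 2 <= `|I2| \/
         eta * q n.+1 ^+ 2 <= `|I3| \/ eta * q n.+1 ^+ 2 <= `|I4|.
    apply: contrapT => /not_orP[/negP+ /not_orP[/negP+ /not_orP[/negP+ /negP+]]].
    rewrite -!ltNge => n1 n2 n3 n4.
    have := ler_normD (I1 + I2) (I3 + I4); have := ler_normD I1 I2.
    have := ler_normD I3 I4; lra.
  case=> [g|[g|[g|g]]].
  - exists (u, v) => _; split; first by split => //=; rewrite -/W -/H; lra.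
    by split => //=; rewrite -/W -/H; lra.
  - exists (u, v + H) => _; split; first by split => //=; rewrite -/W -/H; lra.
    by split => //=; rewrite -/W -/H; lra.
  - exists (u + W, v) => _; split; first by split => //=; rewrite -/W -/H; lra.
    by split => //=; rewrite -/W -/H; lra.
  - exists (u + W, v + H) => _; split; first by split => //=; rewrite -/W -/H; lra.
    by split => //=; rewrite -/W -/H; lra.
have [step {}stepP] := choice (fun np : nat * (R * R) => stepP np.1 np.2).
pose P := fix P n := if n is m.+1 then step (m, P m) else (x0, y0).
have gP n : good n (P n).
  elim: n => [|n /(stepP (n, P n))[]//].
  by rewrite /good/= /q expr0 invr1 !mulr1 expr1n mulr1 /w /h !subrKC; split.
have nest (n m : nat) : [/\ (P n).1 <= (P (n + m)%N).1,
    (P (n + m)%N).1 + w * q (n + m)%N <= (P n).1 + w * q n,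
    (P n).2 <= (P (n + m)%N).2 &
    (P (n + m)%N).2 + h * q (n + m)%N <= (P n).2 + h * q n].
  elim: m => [|m [h1 h2 h3 h4]]; first by rewrite addn0; split.
  have [_ [/= k1 k2 k3 k4]] := stepP (n + m, P (n + m))%N (gP _).
  rewrite addnS; split => //=; first exact: le_trans k1.
  - exact: le_trans h2.
  - exact: le_trans k3.
  - exact: le_trans h4.
have ub1 (n m : nat) : (P n).1 <= (P m).1 + w * q m.
  have [+ _ _ _] := nest n m; have [_ + _ _] := nest m n.
  rewrite addnC => a1 a2.
  have : 0 <= w * q (n + m)%N by rewrite mulr_ge0// ltW.
  by lra.
have ub2 (n m : nat) : (P n).2 <= (P m).2 + h * q m.
  have [_ _ + _] := nest n m; have [_ _ _ +] := nest m n.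
  rewrite addnC => a1 a2.
  have : 0 <= h * q (n + m)%N by rewrite mulr_ge0// ltW.
  by lra.
pose X := sup (range (fun n => (P n).1)); pose Y := sup (range (fun n => (P n).2)).
have X1 n : (P n).1 <= X.
  by apply: ub_le_sup; [exists ((P 0%N).1 + w * q 0%N) => _ [m _ <-]|exists n].
have X2 n : X <= (P n).1 + w * q n.
  by apply: ge_sup; [exists (P 0%N).1; exists 0%N|move=> _ [m _ <-]].
have Y1 n : (P n).2 <= Y.
  by apply: ub_le_sup; [exists ((P 0%N).2 + h * q 0%N) => _ [m _ <-]|exists n].
have Y2 n : Y <= (P n).2 + h * q n.
  by apply: ge_sup; [exists (P 0%N).2; exists 0%N|move=> _ [m _ <-]].
have XI : X \in `[x0, x1].
  by have [/= a1 a2 _ _ _] := gP 0%N; exact: (inx a1 a2 (X1 0%N) (X2 0%N)).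
have YI : Y \in `[y0, y1].
  by have [/= _ _ a1 a2 _] := gP 0%N; exact: (iny a1 a2 (Y1 0%N) (Y2 0%N)).
pose K := (w + h) ^+ 2.
have K0 : 0 <= K by exact: sqr_ge0.
have e0 : 0 < eta / (K + 1) by rewrite divr_gt0// ltr_wpDl.
have [r r0 rP] := I_small XI YI e0.
pose n := Num.bound ((w + h) / r).
have nr : (w + h) * q n < r.
  rewrite /q ltr_pdivrMr ?exprn_gt0// mulrC -ltr_pdivrMr//.
  rewrite (lt_le_trans (archi_boundP (divr_ge0 (addr_ge0 w0 h0) (ltW r0))))//.
  by rewrite -natrX ler_nat ltnW// ltn_expl.
have [g1 g2 g3 g4 g5] := gP n.
have := rP _ _ _ _ g1 g2 g3 g4.
rewrite X1 X2 Y1 Y2 => /(_ isT isT).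
have E (s t : R) : s + t - s = t by ring.
rewrite !E -mulrDl exprMn.
have wq : 0 <= w * q n by rewrite mulr_ge0// ltW.
have hq : 0 <= h * q n by rewrite mulr_ge0// ltW.
move=> /(_ ltac:(lra) ltac:(lra)) /(le_trans g5).
rewrite -/K [leRHS]mulrA ler_pM2r ?exprn_gt0// mulrAC ler_pdivlMr ?ltr_wpDl// mulrDr mulr1.
by rewrite -subr_ge0 opprD addrA subrr sub0r oppr_ge0 leNgt I0.
Qed.

End Goursat.

(** * The maximum principle *)

Section CircleMean.
Context {R : realType}.
Implicit Types (a b x y e t : R) (z w : R[i]) (f g h : R[i] -> R[i]).
Local Notation Re := (@complex.Re R).
Local Notation Im := (@complex.Im R).

Definition cis t : R[i] := cos t +i* sin t.

Definition cexp z : R[i] := (expR (Re z))%:C * cis (Im z).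

Lemma cisD a b : cis (a + b) = cis a * cis b.
Proof.
by apply/eqP; rewrite eq_complex /= cosD sinD; apply/andP; split; apply/eqP; ring.
Qed.

Lemma cis0 : cis 0 = 1.
Proof. by rewrite /cis cos0 sin0. Qed.

Lemma normc_cis t : normc (cis t) = 1.
Proof. by rewrite /= cos2Dsin2 sqrtr1. Qed.

Lemma cis2pi : cis (2 * pi) = 1.
Proof. by rewrite /cis mulr_natl cos2pi sin2pi. Qed.

Lemma normc_cexp z : normc (cexp z) = expR (Re z).
Proof. by rewrite normcM normc_cis mulr1 normcR ger0_norm// expR_ge0. Qed.

Lemma cexpD z w : cexp (z + w) = cexp z * cexp w.
Proof.
case: z => a b; case: w => c d; rewrite /cexp/= expRD cisD rmorphM/=.
by ring.
Qed.

Lemma normc_le_ReIm z : normc z <= `|Re z| + `|Im z|.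
Proof.
case: z => a b /=; rewrite -(ler_pXn2r (_ : (0 < 2)%N)) ?nnegrE ?sqrtr_ge0 ?addr_ge0//.
rewrite sqr_sqrtr ?addr_ge0 ?sqr_ge0// -(real_normK (num_real a)) -(real_normK (num_real b)).
by have := normr_ge0 a; have := normr_ge0 b; nra.
Qed.

Lemma is_derive_eps (F : R -> R) x d : is_derive x 1 F d -> forall e, 0 < e ->
  exists2 r : R, 0 < r & forall y, `|y| < r -> `|F (x + y) - F x - d * y| <= e * `|y|.
Proof.
move=> Fd e e0; have [dF dE] := Fd.
move: dF => /cvg_ex[/= l Fl].
have ld : l = d by rewrite -dE; apply/esym/cvg_lim.
rewrite {}ld in Fl => {l}.
move: Fl => /cvgrPdist_le/(_ e e0); rewrite /dnbhs /= => /nbhs_normP[r /= r0 rP].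
exists r => // y yr; have [->|y0] := eqVneq y 0.
  by rewrite addr0 subrr mulr0 subrr normr0 mulr0.
have /= := rP y; rewrite sub0r normrN => /(_ yr y0).
rewrite -(ler_pM2r (_ : 0 < `|y|)) ?normr_gt0// -normrM => H.
rewrite distrC (le_trans _ H)// le_eqVlt; apply/orP; left; apply/eqP; congr (`|_|).
rewrite mulrBl; congr (_ - _).
rewrite [_ *: (1 : R)]mulr1 [_ *: (_ : R)]/(GRing.scale _ _)/= mulrAC mulVf// mul1r.
by rewrite [y + x]addrC.
Qed.

Lemma cdiff_cexp z : cdiff cexp z (cexp z).
Proof.
suff H e : 0 < e -> exists2 r : R, 0 < r & forall h : R[i], normc h < r ->
    normc (cexp h - 1 - h) <= e * normc h.
  move=> e e0; have E0 : 0 < e / expR (Re z) by rewrite divr_gt0 ?expR_gt0.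
  have [r r0 rP] := H _ E0; exists r => // h hr.
  have -> : cexp (z + h) - cexp z - cexp z * h = cexp z * (cexp h - 1 - h).
    by rewrite cexpD; ring.
  rewrite normcM normc_cexp mulrC -ler_pdivlMr ?expR_gt0//.
  by rewrite (le_trans (rP h hr))// mulrAC.
(* The bounds B1 and B2 below add up to 7 e1 n. *)
move=> e0; pose e1 := Num.min 1 (e / 16).
have e10 : 0 < e1 by rewrite lt_min ltr01 divr_gt0.
have e11 : e1 <= 1 by rewrite ge_min lexx.
have e1e : e1 <= e / 16 by rewrite ge_min lexx orbT.
have [r1 r10 r1P] := is_derive_eps (is_derive_expR 0) e10.
have [r2 r20 r2P] := is_derive_eps (is_derive_cos 0) e10.
have [r3 r30 r3P] := is_derive_eps (is_derive_sin 0) e10.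
exists (Num.min (Num.min r1 r2) (Num.min r3 e1)) => [|h]; first by rewrite 3!lt_min r10 r20 r30.
rewrite 3!lt_min => /andP[/andP[h1 h2] /andP[h3 h4]].
have hR := ler_Re_normc h; have hI := ler_Im_normc h.
have := r1P _ (le_lt_trans hR h1); have := r2P _ (le_lt_trans hI h2).
have := r3P _ (le_lt_trans hI h3); rewrite !add0r expR0 cos0 sin0 oppr0 !mul1r mul0r !subr0.
have c1 := cos_max (Im h); have c2 := sin_max (Im h).
move: (normc_le_ReIm (cexp h - 1 - h)); case: h h1 h2 h3 h4 hR hI c1 c2 => a b h1 h2 h3 h4 /= hR hI c1 c2 L S C E.
set n := Num.sqrt (a ^+ 2 + b ^+ 2) in h1 h2 h3 h4 hR hI *.
rewrite !mul0r !subr0 !addr0 in S L *.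
apply: (le_trans L).
have E1 : expR a * cos b - 1 - a = (expR a - 1 - a) * cos b + (1 + a) * (cos b - 1) by ring.
have E2 : expR a * sin b - b = (sin b - b) + (expR a - 1 - a) * sin b + a * sin b by ring.
have ha := normr_ge0 a; have hb := normr_ge0 b; have {}h4 : n < e1 := h4.
have B1 : `|expR a * cos b - 1 - a| <= 3 * e1 * n.
  rewrite E1 (le_trans (ler_normD _ _))// !normrM.
  have a1 : `|1 + a| <= 2.
    by rewrite (le_trans (ler_normD _ _))// normr1; lra.
  have t1 : `|expR a - 1 - a| * `|cos b| <= e1 * n * 1.
    by apply: ler_pM => //; nra.
  have t2 : `|1 + a| * `|cos b - 1| <= 2 * (e1 * n).
    by apply: ler_pM => //; nra.
  by lra.
have B2 : `|expR a * sin b - b| <= 4 * e1 * n.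
  rewrite E2 (le_trans (ler_normD _ _))// (le_trans (lerD (ler_normD _ _) (lexx _)))// !normrM.
  have t1 : `|expR a - 1 - a| * `|sin b| <= e1 * n * 1.
    by apply: ler_pM => //; nra.
  have sb : `|sin b| <= 2 * n.
    rewrite -(subrK b (sin b)) (le_trans (ler_normD _ _))//; nra.
  have t2 : `|a| * `|sin b| <= e1 * (2 * n).
    by apply: ler_pM => //; lra.
  have t3 : `|sin b - b| <= e1 * n by nra.
  by lra.
have n0 : 0 <= n by exact: sqrtr_ge0.
by nra.
Qed.

Lemma cdiff_comp f g z (d d' : R[i]) : cdiff g z d -> cdiff f (g z) d' ->
  cdiff (fun w => f (g w)) z (d' * d).
Proof.
move=> gd fd e e0; have [r1 r10 r1P] := cdiff_lipschitz gd.
pose K := 1 + normc d; have K0 : 0 < K by rewrite ltr_wpDr ?normc_ge0.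
pose e1 := e / 2 / K; pose e2 := e / 2 / (1 + normc d').
have d'0 : 0 < 1 + normc d' by rewrite ltr_wpDr ?normc_ge0.
have e10 : 0 < e1 by rewrite !divr_gt0.
have e20 : 0 < e2 by rewrite !divr_gt0.
have [r2 r20 r2P] := fd _ e10; have [r3 r30 r3P] := gd _ e20.
exists (Num.min r1 (Num.min (r2 / K) r3)) => [|h]; first by rewrite !lt_min r10 r30 divr_gt0.
rewrite !lt_min => /andP[h1 /andP[h2 h3]].
set k := g (z + h) - g z; have kh : normc k <= K * normc h by exact: r1P.
have kr : normc k < r2 by rewrite (le_lt_trans kh)// mulrC -ltr_pdivlMr.
have := r2P _ kr; rewrite [in f (g z + k)]/k [g z + _]addrC subrK => H.
have -> : f (g (z + h)) - f (g z) - d' * d * h =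
    (f (g (z + h)) - f (g z) - d' * k) + d' * (k - d * h) by ring.
rewrite (le_trans (normcD _ _))// (le_trans (lerD H (lexx _)))// normcM.
have H2 : e1 * normc k <= e / 2 * normc h.
  by rewrite (le_trans (ler_wpM2l (ltW e10) kh))// mulrA /e1 mulfVK// gt_eqF.
have H3 : normc d' * normc (k - d * h) <= e / 2 * normc h.
  rewrite (le_trans (ler_wpM2l (normc_ge0 _) (r3P h h3)))// mulrA ler_wpM2r ?normc_ge0//.
  by rewrite /e2 mulrCA ler_piMr ?divr_ge0 ?(ltW e0)// ler_pdivrMr// mul1r lerDr.
by lra.
Qed.

Lemma cdiff_mull f z (d u : R[i]) : cdiff f z d -> cdiff (fun w => u * f w) z (u * d).
Proof.
move=> fd e e0; have u0 : 0 < 1 + normc u by rewrite ltr_wpDr ?normc_ge0.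
have [r r0 rP] := fd _ (divr_gt0 e0 u0); exists r => // h /rP H.
have -> : u * f (z + h) - u * f z - u * d * h = u * (f (z + h) - f z - d * h) by ring.
rewrite normcM (le_trans (ler_wpM2l (normc_ge0 _) H))// mulrA ler_wpM2r ?normc_ge0//.
by rewrite mulrCA ler_piMr ?(ltW e0)// ler_pdivrMr// mul1r lerDr.
Qed.

(** The Cauchy-Riemann equations say that Im f dx + Re f dy is closed. *)
Lemma cdiff_closed_at f x0 x1 y0 y1 x y d : cdiff f (x +i* y) d ->
  closed_at (fun a b => Im (f (a +i* b))) (fun a b => Re (f (a +i* b)))
    x0 x1 y0 y1 x y.
Proof.
move=> fd; exists (Im d), (Re d), (- Im d) => e e0.
have [r r0 rP] := fd e e0; exists (r / 2); first by rewrite divr_gt0.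
move=> x' y' _ _ xx yy; set h : R[i] := (x' - x) +i* (y' - y).
have hE : (x +i* y) + h = x' +i* y'.
  by apply/eqP; rewrite eq_complex /= !subrKC !eqxx.
have hn : normc h <= `|x' - x| + `|y' - y| by exact: normc_le_ReIm.
have hr : normc h < r by rewrite (le_lt_trans hn)//; lra.
have := rP h hr; rewrite hE => H.
have {}H := le_trans H (ler_wpM2l (ltW e0) hn).
have HI := le_trans (ler_Im_normc _) H; have HR := le_trans (ler_Re_normc _) H.
move: HI HR; rewrite /h; case: (f (x' +i* y')) => p q; case: (f (x +i* y)) => s t.
case: d fd rP H => d1 d2 _ _ _ /= HI HR.
split; [apply: le_trans HI|apply: le_trans HR]; rewrite le_eqVlt; apply/orP; left;
  by apply/eqP; congr (`|_|); ring.
Qed.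

Lemma unit_disc_mul z w : unit_disc R z -> normc w <= 1 -> unit_disc R (z * w).
Proof.
by move=> z1 w1; rewrite /unit_disc/= normcM (le_lt_trans _ z1)// ler_piMr// normc_ge0.
Qed.

(** In the coordinate x + iy of z exp(x + iy), the form Im h dx + Re h dy is
    closed on the strip x <= 0 and 2 pi-periodic in y. Its integral around the
    rectangle [-S, 0] x [0, 2 pi] vanishes and the two horizontal sides cancel,
    so the mean of Re h over the circle through z is its mean over an
    arbitrarily small circle, where Re h is close to Re h(0). *)
Lemma Re_max_modulus h z (M : R) : analytic_disc h -> unit_disc R z ->
  (forall t, 0 <= t <= 2 * pi -> `|Re (h (z * cis t))| <= M) -> Re (h 0) <= M.
Proof.
move=> ha z1 hM; apply/ler_addgt0Pr => e e0.
have pi0 := pi_gt0 R.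
have d0 : unit_disc R 0 by rewrite /unit_disc/= !expr0n/= addr0 sqrtr0.
have /near_normcP[r r0 rP] := analytic_cont ha d0 e0.
pose S := Num.max 1 (- ln r).
have S0 : 0 <= S by rewrite le_max ler01.
have Sr : expR (- S) <= r.
  by rewrite -[leRHS](lnK r0) ler_expR lerNl le_max lexx orbT.
pose F w := h (z * cexp w).
have Fd x y : x <= 0 -> exists d, cdiff F (x +i* y) d.
  move=> x0.
  have w1 : unit_disc R (z * cexp (x +i* y)).
    by apply: unit_disc_mul => //; rewrite normc_cexp /= -expR0 ler_expR.
  have /derivable_cdiffP[d hd] := ha _ w1.
  exists (d * (z * cexp (x +i* y))).
  by apply: (@cdiff_comp h (fun w => z * cexp w)) => //; apply: cdiff_mull; exact: cdiff_cexp.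
have cl x y : x \in `[- S, 0] -> y \in `[0, 2 * pi] ->
    closed_at (fun a b => Im (F (a +i* b))) (fun a b => Re (F (a +i* b)))
      (- S) 0 0 (2 * pi) x y.
  rewrite in_itv/= => /andP[_ x0] _; have [d Fdd] := Fd x y x0.
  exact: cdiff_closed_at Fdd.
have S00 : - S <= 0 by rewrite oppr_le0.
have p0 : 0 <= 2 * pi :> R by rewrite mulr_ge0// ltW.
have := goursat S00 p0 cl.
have -> : (fun x => Im (F (x +i* (2 * pi)))) = (fun x => Im (F (x +i* 0))).
  by apply/funext => x; rewrite /F /cexp/= cis2pi cis0.
move=> /addrI J.
have in0 : 0 \in `[- S, 0 : R] by rewrite in_itv/= S00 lexx.
have inS : - S \in `[- S, 0 : R] by rewrite in_itv/= S00 lexx.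
have i0 := closed_form_integrable_dy cl in0.
have iS := closed_form_integrable_dy cl inS.
have ez0 : 0 < 2 * pi :> R by rewrite mulr_gt0.
clear cl Fd.
have up : `|segint (fun y => Re (F (0 +i* y))) 0 (2 * pi) - 0 * (2 * pi - 0)| <= M * (2 * pi - 0).
  apply: (segint_near_cst p0 i0) => y; rewrite in_itv/= => yI.
  by rewrite subr0 /F /cexp/= expR0 mul1r; exact: hM.
have lo : `|segint (fun y => Re (F (- S +i* y))) 0 (2 * pi) - Re (h 0) * (2 * pi - 0)| <= e * (2 * pi - 0).
  apply: (segint_near_cst p0 iS) => y _.
  have : normc (h (z * cexp (- S +i* y)) - h 0) < e.
    apply: rP; rewrite subr0 normcM normc_cexp/=.
    by apply: (lt_le_trans _ Sr); rewrite -[ltRHS]mul1r (ltr_pM2r (expR_gt0 _)); exact: z1.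
  move=> /ltW; apply: le_trans; apply: le_trans (ler_Re_normc _).
  by rewrite /F; case: (h (z * _)) => ? ?; case: (h 0) => ? ?.
move: up lo; rewrite J mul0r !subr0 => /ler_normlP[_ u1] /ler_normlP[l1 _].
have : Re (h 0) * (2 * pi) <= (M + e) * (2 * pi) by clear -u1 l1; lra.
by rewrite (ler_pM2r ez0).
Qed.

(** Multiplying h by a constant of modulus 1 makes h(0) nonnegative, which
    reduces the claim to real parts. *)
Lemma max_modulus h z (M : R) : analytic_disc h -> unit_disc R z ->
  (forall t, 0 <= t <= 2 * pi -> normc (h (z * cis t)) <= M) -> normc (h 0) <= M.
Proof.
move=> ha z1 hM; have [h0|h0] := eqVneq (h 0) 0.
  have pi0 := pi_ge0 R.
  rewrite h0 normc0 (le_trans (normc_ge0 (h (z * cis 0))))// hM//.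
  by rewrite lexx mulr_ge0.
pose u := (normc (h 0))%:C / h 0.
have u1 : normc u = 1.
  by rewrite normcM normcR normcV ger0_norm ?normc_ge0// mulfV// normc_eq0.
have uE : u * h 0 = (normc (h 0))%:C by rewrite divfK.
have -> : normc (h 0) = Re (u * h 0) by rewrite uE.
have uha : analytic_disc (fun w => u * h w).
  exact: (@analyticM _ (fun=> u) h (@analytic_cst _ u) ha).
apply: (Re_max_modulus uha z1).
by move=> t tI; rewrite (le_trans (ler_Re_normc _))// normcM u1 mul1r hM.
Qed.

End CircleMean.

(** * Means over the rotations by roots of unity *)

Section RotationMean.
Context {R : realType}.
Implicit Types (x y e s t : R) (z : R[i]) (h : R[i] -> R[i]).

Lemma powRK x s : 0 <= x -> s != 0 -> (x `^ s^-1) `^ s = x.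
Proof. by move=> x0 s0; rewrite -powRrM mulVf// powRr1. Qed.

Lemma powR_le_root x y s : 0 <= x -> 0 <= y -> 0 < s ->
  (x <= y `^ s^-1) = (x `^ s <= y).
Proof.
move=> x0 y0 s0; apply/idP/idP => [xy|xy].
  rewrite -(@powRK y s) ?gt_eqF// ge0_ler_powR ?nnegrE ?powR_ge0// ltW//.
rewrite -(@powRK x s^-1) ?invr_neq0 ?gt_eqF// invrK.
by rewrite ge0_ler_powR ?nnegrE ?powR_ge0// invr_ge0 ltW.
Qed.

Lemma powR_lt_root x y s : 0 <= x -> 0 <= y -> 0 < s ->
  (y `^ s^-1 < x) = (y < x `^ s).
Proof. by move=> x0 y0 s0; rewrite !ltNge powR_le_root. Qed.

Lemma powR_le_eps s x e : 0 < s -> 0 <= x -> 0 < e -> exists2 d : R, 0 < d &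
  forall y, 0 <= y -> `|y - x| < d -> `|y `^ s - x `^ s| <= e.
Proof.
move=> s0 x0 e0; pose u := (x `^ s + e) `^ s^-1.
have xe0 : 0 <= x `^ s + e by rewrite addr_ge0 ?powR_ge0// ltW.
have xu : x < u.
  rewrite -[ltLHS](@powRK x s^-1) ?invr_neq0 ?gt_eqF// invrK.
  by rewrite gt0_ltr_powR ?nnegrE ?powR_ge0 ?invr_gt0// ltrDl.
have up y : 0 <= y -> `|y - x| < u - x -> y `^ s <= x `^ s + e.
  move=> y0 /ltr_normlP[_ yx]; rewrite -powR_le_root//.
  by rewrite -/u; lra.
have [ex|xe] := ltP e (x `^ s).
  pose l := (x `^ s - e) `^ s^-1.
  have xe1 : 0 <= x `^ s - e by rewrite subr_ge0 ltW.
  have lx : l < x by rewrite powR_lt_root// ltrBlDr ltrDl.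
  exists (Num.min (u - x) (x - l)) => [|y y0]; first by rewrite lt_min !subr_gt0 xu.
  rewrite lt_min => /andP[y1 y2]; rewrite ler_distl up// andbT.
  apply/ltW; rewrite -powR_lt_root// -/l.
  by move/ltr_normlP: y2 => [y2 _]; lra.
exists (u - x) => [|y y0 y1]; first by rewrite subr_gt0.
rewrite ler_distl up// andbT (le_trans _ (powR_ge0 _ _))// subr_le0//.
Qed.

Lemma powR_prod (I : Type) (r : seq I) (F : I -> R) s :
  (forall i, 0 <= F i) -> (\prod_(i <- r) F i) `^ s = \prod_(i <- r) (F i) `^ s.
Proof.
move=> F0; elim: r => [|i r IH]; first by rewrite !big_nil powR1.
by rewrite !big_cons powRM ?IH// prodr_ge0.
Qed.

Lemma powR_exprn x s n : 0 <= x -> (x ^+ n) `^ s = (x `^ s) ^+ n.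
Proof.
move=> x0; elim: n => [|n IH]; first by rewrite !expr0 powR1.
by rewrite !exprS powRM ?IH// exprn_ge0.
Qed.

Lemma unif_cont_segment (f : R -> R) a b :
  (forall t, forall e, 0 < e -> exists2 d : R, 0 < d &
     forall t', `|t' - t| < d -> `|f t' - f t| <= e) ->
  forall e, 0 < e -> exists2 d : R, 0 < d & forall t t', t \in `[a, b] ->
     `|t' - t| < d -> `|f t' - f t| <= e.
Proof.
move=> fc e e0.
have := (@compact_near_coveringP R _).1 (@segment_compact R a b).
move=> /(_ R ((0 : R)^'+) (fun d t => forall t', `|t' - t| < d -> `|f t' - f t| <= e) _).
case=> [x _|d /= d0 dP].
  have [d d0 dP] := fc x (e / 2) (divr_gt0 e0 (ltr0n _ 2)).
  have d20 : 0 < d / 2 by rewrite divr_gt0.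
  near=> t d' => /= t' tt'.
  have xt : `|t - x| < d / 2.
    rewrite distrC; near: t; apply/nbhs_normP; exists (d / 2) => //=.
  have dd : d' < d / 2 by near: d'; apply: nbhs_right_lt.
  have h1 := dP t ltac:(lra).
  have h2 : `|t' - x| < d.
    have := ler_normD (t' - t) (t - x); rewrite addrA subrK; lra.
  have := dP t' h2; have := ler_normD (f t' - f x) (f x - f t).
  by rewrite addrA subrK [ `|f x - _|]distrC; lra.
have d20 : 0 < d / 2 by rewrite divr_gt0.
exists (d / 2) => // t t' tab; apply: (dP (d / 2)) => //=.
by rewrite sub0r normrN gtr0_norm//; lra.
Unshelve. all: by end_near. Qed.

Lemma analytic_circle_cont h z s : 0 < s -> analytic_disc h -> unit_disc R z ->
  forall t e, 0 < e -> exists2 d : R, 0 < d & forall t', `|t' - t| < d ->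
    `|normc (h (z * cis t')) `^ s - normc (h (z * cis t)) `^ s| <= e.
Proof.
move=> s0 ha z1 t e e0.
have cE x : z * cis x = z * cexp (0 +i* x) by rewrite /cexp/= expR0 mul1r.
have [d1 d10 d1P] := powR_le_eps s0 (normc_ge0 (h (z * cis t))) e0.
have w1 : unit_disc R (z * cexp (0 +i* t)).
  by apply: unit_disc_mul => //; rewrite normc_cexp/= expR0.
have /derivable_cdiffP[d hd] := ha _ w1.
have Fd := @cdiff_comp _ h (fun w => z * cexp w) _ _ _ (cdiff_mull z (@cdiff_cexp _ (0 +i* t))) hd.
have /near_normcP[r r0 rP] := cdiff_cont Fd d10.
exists r => // t' tt'; apply: d1P; first exact: normc_ge0.
have := rP (0 +i* t'); rewrite !cE => /(_ _)/le_lt_trans; apply.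
  rewrite ler_norml lerNl opprB; apply/andP; split; last exact: normc_lerB.
  by rewrite normc_distC; exact: normc_lerB.
by rewrite (le_lt_trans (normc_le_ReIm _))//= oppr0 addr0 normr0 add0r.
Qed.

(** Rotating the N + 1 points by any angle amounts to a rotation by less than
    2 pi / (N + 1), so uniform continuity on the circle keeps every rotated mean
    of |h|^s below the given one plus d. By the arithmetic-geometric inequality
    this bounds the product of the N + 1 rotates of h on the whole circle
    through z, hence at the origin by the maximum principle. *)
Lemma rotation_mean_ge h z s (d : R) :
  0 < s -> analytic_disc h -> unit_disc R z -> 0 < d ->
  exists N0 : nat, forall N : nat, (N0 <= N)%N ->
    normc (h 0) `^ s <=
      N.+1%:R^-1 * (\sum_(j < N.+1)
         normc (h (z * cis (j%:R * (2 * pi / N.+1%:R)))) `^ s) + d.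
Proof.
move=> s0 ha z1 d0; have pi0 := pi_gt0 R.
pose f t := normc (h (z * cis t)) `^ s.
have f0 t : 0 <= f t by exact: powR_ge0.
have fc := analytic_circle_cont s0 ha z1.
have [r r0 rP] := unif_cont_segment 0 (4 * pi) fc d0.
have pi20 : 0 < 2 * pi :> R by rewrite mulr_gt0.
exists (Num.bound (2 * pi / r)) => N NN.
pose P : R := 2 * pi / N.+1%:R; rewrite -/P.
have P0 : 0 < P by rewrite divr_gt0.
have NP : N.+1%:R * P = 2 * pi by rewrite mulrC divfK// pnatr_eq0.
have Pr : P < r.
  rewrite /P ltr_pdivrMr// [ltRHS]mulrC -ltr_pdivrMr//.
  rewrite (lt_le_trans (archi_boundP (divr_ge0 (ltW pi20) (ltW r0))))//.
  by rewrite ler_nat (leq_trans NN).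
pose m t := N.+1%:R^-1 * \sum_(j < N.+1) f (t + j%:R * P).
have m0E : m 0 = N.+1%:R^-1 * \sum_(j < N.+1) f (j%:R * P).
  by rewrite /m; congr (_ * _); apply: eq_bigr => j _; rewrite add0r.
rewrite -[X in _ <= X + _]m0E.
have fper t : f (t + 2 * pi) = f t by rewrite /f cisD cis2pi mulr1.
have mper t : m (t + P) = m t.
  rewrite /m; congr (_ * _); rewrite big_ord_recr big_ord_recl/= mul0r addr0.
  rewrite addrC; congr (_ + _).
    by rewrite -[RHS]fper -NP -natr1; congr f; ring.
  by apply: eq_bigr => j _; congr f; rewrite /bump/= add1n -natr1; ring.
have mper' t n : m (t + n%:R * P) = m t.
  elim: n => [|n IH]; first by rewrite mul0r addr0.
  by rewrite -natr1 mulrDl mul1r addrA mper.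
have mle t : 0 <= t -> m t <= m 0 + d.
  move=> t0; pose i := Num.truncn (t / P); pose t1 := t - i%:R * P.
  have tP0 : 0 <= t / P by rewrite divr_ge0// ltW.
  have t10 : 0 <= t1 by rewrite subr_ge0 -ler_pdivlMr// truncn_le.
  have t1P : t1 < P.
    rewrite /t1 ltrBlDr -{1}[P]mul1r -mulrDl -ltr_pdivrMr// addrC natr1.
    exact: truncnS_gt.
  rewrite -(subrK (i%:R * P) t) mper' -/t1.
  have -> : m 0 + d = N.+1%:R^-1 * \sum_(j < N.+1) (f (j%:R * P) + d).
    rewrite big_split/= sumr_const card_ord mulrDr -m0E -[d *+ _]mulr_natl mulrA.
    by rewrite mulVf ?mul1r// pnatr_eq0.
  rewrite ler_wpM2l// ?invr_ge0//; apply: ler_sum => j _.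
  have jI : j%:R * P \in `[0, 4 * pi].
    rewrite in_itv/= mulr_ge0 ?(ltW P0)//=.
    have : j%:R * P <= N.+1%:R * P by rewrite ler_pM2r// ler_nat ltnW.
    by rewrite NP; lra.
  have := rP (j%:R * P) (t1 + j%:R * P) jI.
  rewrite addrK ger0_norm// => /(_ (lt_trans t1P Pr)).
  by rewrite ler_distl => /andP[].
have md0 : 0 <= m 0 + d.
  by rewrite addr_ge0 ?(ltW d0)// mulr_ge0 ?invr_ge0// sumr_ge0.
pose H w := \prod_(j <- enum 'I_N.+1) h (cis (j%:R * P) * w).
have Ha : analytic_disc H.
  apply: analytic_prod => j; apply: analytic_scale => //.
  by rewrite normc_cis.
have HM t : 0 <= t <= 2 * pi -> normc (H (z * cis t)) <= ((m 0 + d) ^+ N.+1) `^ s^-1.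
  move=> /andP[t0 _]; rewrite powR_le_root ?normc_ge0 ?exprn_ge0//.
  rewrite normc_prod powR_prod; last by move=> j; exact: normc_ge0.
  rewrite (@le_trans _ _ (m t ^+ N.+1))//; last first.
    by rewrite lerXn2r ?nnegrE ?mle// mulr_ge0 ?invr_ge0// sumr_ge0.
  have := (@leif_AGM _ 'I_N.+1 'I_N.+1 (fun j : 'I_N.+1 => f (t + j%:R * P)) (fun=> fun=> f0 _)).1.
  rewrite card_ord mulrC big_enum/=.
  have eqp (F : 'I_N.+1 -> R) : \prod_(i in 'I_N.+1) F i = \prod_i F i by exact: eq_bigl.
  have eqs (F : 'I_N.+1 -> R) : \sum_(i in 'I_N.+1) F i = \sum_i F i by exact: eq_bigl.
  rewrite !eqp eqs -/(m t).
  apply: le_trans; rewrite le_eqVlt; apply/orP; left; apply/eqP.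
  apply: eq_bigr => j _; rewrite /f cisD; congr (normc (h _) `^ _).
  by rewrite mulrCA [_ * cis _]mulrC mulrA.
have := max_modulus Ha z1 HM.
rewrite /H normc_prod (eq_bigr (fun=> normc (h 0))); last by move=> j _; rewrite mulr0.
rewrite big_enum prodr_const card_ord powR_le_root ?exprn_ge0 ?normc_ge0//.
rewrite powR_exprn ?normc_ge0// ler_pXn2r// ?nnegrE ?powR_ge0//.
Qed.

End RotationMean.

(** * Expanding maps and rotations of the plane *)

Section ExpandingMaps.
Context {R : realType}.
Local Notation lam := (@lebesgue_measure R).
Implicit Types (S : R -> R) (D E : set R) (c t : R).

Lemma sub_itv_of_diam (X : set R) d : (forall x y, X x -> X y -> `|x - y| <= d) ->
  exists a b, X `<=` `[a, b] /\ (lam `[a, b]%classic <= d%:E)%E \/ X = set0.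
Proof.
move=> Xd; have [->|/set0P[x0 Xx0]] := eqVneq X set0; first by exists 0, 0; right.
have d0 : 0 <= d by rewrite (le_trans _ (Xd _ _ Xx0 Xx0)).
exists (inf X), (sup X); left.
have ubX : has_ubound X.
  by exists (x0 + d) => x Xx; have /ler_normlP[_] := Xd _ _ Xx Xx0; lra.
have lbX : has_lbound X.
  by exists (x0 - d) => x Xx; have /ler_normlP[+ _] := Xd _ _ Xx Xx0; lra.
split.
  by move=> x Xx /=; rewrite in_itv/= ub_le_sup//= ge_inf.
rewrite lebesgue_measure_itv/= lte_fin; case: ifPn => [_|_]; last by rewrite lee_fin.
rewrite lee_fin lerBlDr; apply: ge_sup; first by exists x0.
move=> x Xx; rewrite -lerBlDl; apply: lb_le_inf; first by exists x0.
by move=> y Xy; have /ler_normlP[_] := Xd _ _ Xx Xy; lra.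
Qed.

(** The preimage of an interval of length l has diameter at most l / c, and
    lengths are infima over covers by intervals. *)
Lemma expanding_preimage S D E c : 0 < c ->
  (forall x y, D x -> D y -> c * `|x - y| <= `|S x - S y|) ->
  measurable (E : set (measurableTypeR R)) ->
  measurable (D `&` S @^-1` E : set (measurableTypeR R)) ->
  (lam (D `&` S @^-1` E) <= (c^-1)%:E * lam E)%E.
Proof.
move=> c0 Sc mE mDE; rewrite lee_pdivlMl//.
apply: le_ereal_inf_tmp => _ [F [mF EF] <-].
have covK k : exists K : set (measurableTypeR R), [/\ measurable K,
    D `&` S @^-1` (F k) `<=` K & (lam K <= (c^-1)%:E * (wlength idfun (F k)))%E].
  have /ocitvP[->|[[a b]/= ab ->]] := mF k.
    by exists set0; rewrite preimage_set0 setI0 measure0 wlength0 mule0; split.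
  rewrite wlength_itv_bnd ?(ltW ab)//=.
  have /sub_itv_of_diam[x [y [[sub le]|->]]] : forall x y,
      (D `&` S @^-1` `]a, b]) x -> (D `&` S @^-1` `]a, b]) y -> `|x - y| <= (b - a) / c.
    move=> x y [Dx /=]; rewrite in_itv/= => /andP[ax xb] [Dy /=]; rewrite in_itv/= => /andP[ay yb].
    rewrite ler_pdivlMr// mulrC (le_trans (Sc _ _ Dx Dy))// ler_norml; apply/andP; split; lra.
  - exists `[x, y]%classic; split => //.
    by rewrite -EFinM mulrC.
  - exists set0; split => //; rewrite measure0 -EFinM lee_fin mulr_ge0 ?invr_ge0 ?(ltW c0)//.
    by rewrite subr_ge0 ltW.
have [K KP] := choice covK.
rewrite -lee_pdivlMl//.
apply: (@le_trans _ _ (\sum_(0 <= k <oo) lam (K k))%E).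
  apply: measure_sigma_subadditive => //; first by move=> k; have [] := KP k.
  move=> x [Dx /EF[k _ Fk]]; exists k => //.
  by have [_ + _] := KP k; apply; split.
rewrite -nneseriesZl; last by move=> k _; exact: wlength_ge0.
by apply: lee_nneseries => // k _; have [] := KP k.
Qed.

Lemma lebesgue_translation E t : measurable (E : set (measurableTypeR R)) ->
  lam ((fun x => x + t) @^-1` E) = lam E.
Proof.
have mtr s : measurable_fun setT (fun x : measurableTypeR R => ((x : R) + s : measurableTypeR R)).
  exact: measurable_funD.
have le s (A : set (measurableTypeR R)) : measurable A -> (lam ((fun x : R => (x + s)%R) @^-1` A) <= lam A)%E.
  move=> mA; have := @expanding_preimage (fun x => x + s) setT A 1.
  rewrite setTI invr1 mul1e; apply => //.
    by move=> x y _ _; rewrite mul1r opprD addrACA subrr addr0.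
  by have := mtr s measurableT A mA; rewrite setTI.
move=> mE; apply/eqP; rewrite eq_le le//=.
have -> : lam E = lam ((fun x => x - t) @^-1` ((fun x => x + t) @^-1` E)).
  by congr lam; apply/seteqP; split => x /=; rewrite subrK.
by apply: le; have := mtr t measurableT E mE; rewrite setTI.
Qed.

End ExpandingMaps.

Section PlaneRotation.
Context {R : realType}.
Local Notation lam := (@lebesgue_measure R).
Local Notation plane := (measurableTypeR R * measurableTypeR R)%type.
Implicit Types (A : set plane) (t : R) (u : R[i]).

Local Notation lam2 := (lam \x lam)%E.

Lemma measurable_lin (a b : R) :
  measurable_fun [set: plane] (fun p : plane => a * p.1 + b * p.2 : measurableTypeR R).
Proof.
apply: (@measurable_funD _ _ _ _ (fun p : plane => a * (p.1 : R)) (fun p : plane => b * (p.2 : R))).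
  by apply: measurable_funM => //; exact: measurable_fst.
by apply: measurable_funM => //; exact: measurable_snd.
Qed.

Lemma lam2E A : measurable A -> (lam \x lam)%E A = (lam \x^ lam)%E A.
Proof. by apply: product_measure_unique => B C mB mC; exact: product_measure2E. Qed.

Definition sheary t (p : plane) : plane := (p.1, (p.2 : R) + t * p.1).
Definition shearx t (p : plane) : plane := ((p.1 : R) + t * p.2, p.2).

Lemma measurable_sheary t : measurable_fun setT (sheary t).
Proof.
apply: measurable_fun_pair; first exact: measurable_fst.
apply: eq_measurable_fun (measurable_lin t 1) => p _.
by rewrite mul1r addrC.
Qed.

Lemma measurable_shearx t : measurable_fun setT (shearx t).
Proof.
apply: measurable_fun_pair; last exact: measurable_snd.
apply: eq_measurable_fun (measurable_lin 1 t) => p _.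
by rewrite mul1r.
Qed.

Lemma lam2_sheary A t : measurable A -> lam2 (sheary t @^-1` A) = lam2 A.
Proof.
move=> mA; rewrite /product_measure1; apply: eq_integral => x _ /=.
rewrite -(@lebesgue_translation _ (xsection A x) (t * x)); last exact: measurable_xsection.
by congr lam; apply/seteqP; split => y; rewrite /xsection/= !inE.
Qed.

Lemma lam2_shearx A t : measurable A -> lam2 (shearx t @^-1` A) = lam2 A.
Proof.
move=> mA; rewrite !lam2E//; last first.
  by have := measurable_shearx t measurableT mA; rewrite setTI.
rewrite /product_measure2; apply: eq_integral => y _ /=.
rewrite -(@lebesgue_translation _ (ysection A y) (t * y)); last exact: measurable_ysection.
by congr lam; apply/seteqP; split => x; rewrite /ysection/= !inE.
Qed.

Definition rot u (p : plane) : plane :=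
  let z := u * of_plane p in (complex.Re z, complex.Im z).

Lemma of_plane_rot u p : of_plane (rot u p) = u * of_plane p.
Proof. by rewrite /rot; case: (u * of_plane p). Qed.

Lemma rotM u v p : rot (u * v) p = rot u (rot v p).
Proof. by rewrite /rot/= -mulrA -of_plane_rot. Qed.

Lemma measurable_rot u : measurable_fun setT (rot u).
Proof.
case: u => a b; apply: measurable_fun_pair.
  apply: eq_measurable_fun (measurable_lin a (- b)) => -[x y] _ /=.
  by rewrite mulNr.
by apply: eq_measurable_fun (measurable_lin b a) => -[x y] _ /=; rewrite addrC.
Qed.

Lemma measurable_rot_preimage u A : measurable A -> measurable (rot u @^-1` A).
Proof. by move=> mA; have := measurable_rot u measurableT mA; rewrite setTI. Qed.

(** A rotation is a product of three shears, and a shear translates the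
    sections along its direction. *)
Lemma lam2_rot u A : normc u = 1 -> measurable A -> lam2 (rot u @^-1` A) = lam2 A.
Proof.
have cs c s : normc (c +i* s : R[i]) = 1 -> c ^+ 2 + s ^+ 2 = 1.
  move=> /= /(congr1 (fun x => x ^+ 2)); rewrite sqr_sqrtr ?addr_ge0 ?sqr_ge0//.
  by rewrite expr1n.
have gen (c s : R) B : c ^+ 2 + s ^+ 2 = 1 -> 1 + c != 0 -> measurable B ->
    lam2 (rot (c +i* s) @^-1` B) = lam2 B.
  move=> cs1 c1 mB; pose t := s / (1 + c).
  have -> : rot (c +i* s) @^-1` B =
      shearx (- t) @^-1` (sheary s @^-1` (shearx (- t) @^-1` B)).
    suff E p : rot (c +i* s) p = shearx (- t) (sheary s (shearx (- t) p)).
      by apply/seteqP; split => p /=; rewrite E.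
    have tc : t * (1 + c) = s by rewrite /t divfK.
    have ts : t * s = 1 - c.
      by apply: (mulIf c1); rewrite mulrAC tc; nra.
    case: p => x y; rewrite /rot /shearx /sheary/=; congr (_, _).
      have -> : x + - t * y + - t * (y + s * (x + - t * y)) = x * (1 - t * s) - y * (2 * t - t * s * t) by ring.
      rewrite ts; have -> : 2 * t - (1 - c) * t = t * (1 + c) by ring.
      by rewrite tc; ring.
    have -> : y + s * (x + - t * y) = s * x + y * (1 - t * s) by ring.
    by rewrite ts; ring.
  have mX : measurable (shearx (- t) @^-1` B).
    by have := measurable_shearx (- t) measurableT mB; rewrite setTI.
  have mY : measurable (sheary s @^-1` (shearx (- t) @^-1` B)).
    by have := measurable_sheary s measurableT mX; rewrite setTI.
  by rewrite lam2_shearx// lam2_sheary// lam2_shearx.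
case: u => c s /cs cs1 mA; have [c1|c1] := eqVneq (1 + c) 0; last exact: gen.
have cE : c = -1 by lra.
have sE : s = 0.
  by apply/eqP; rewrite -sqrf_eq0; apply/eqP; move: cs1; rewrite cE; lra.
(* The half turn, for which the shears degenerate, is the square of a quarter
   turn. *)
have -> : rot (c +i* s) @^-1` A = rot (0 +i* 1) @^-1` (rot (0 +i* 1) @^-1` A).
  apply/seteqP; split => p /=; rewrite -rotM cE sE.
    by congr A; congr (rot _ p); apply/eqP; rewrite eq_complex/=; apply/andP; split; apply/eqP; ring.
  by congr A; congr (rot _ p); apply/eqP; rewrite eq_complex/=; apply/andP; split; apply/eqP; ring.
rewrite gen ?gen ?addr0 ?oner_neq0 ?expr0n ?expr1n ?add0r//.
exact: measurable_rot_preimage.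
Qed.

Lemma areaE A : area R A = ((pi^-1)%:E * lam2 A)%E.
Proof. by []. Qed.

Lemma area_rot u A : normc u = 1 -> measurable A -> area R (rot u @^-1` A) = area R A.
Proof. by move=> u1 mA; rewrite !areaE lam2_rot. Qed.

Lemma measurable_normc : measurable_fun [set: plane]
  (fun p : plane => normc (of_plane p) : measurableTypeR R).
Proof.
apply: (@measurableT_comp _ _ _ _ _ _ (@Num.sqrt R : measurableTypeR R -> measurableTypeR R)).
  by apply: continuous_measurable_fun; exact: sqrt_continuous.
by apply: measurable_funD; apply: measurable_funX; [exact: measurable_fst|exact: measurable_snd].
Qed.

Lemma measurable_normc_preimage (E : set (measurableTypeR R)) : measurable E ->
  measurable [set p : plane | E (normc (of_plane p))].
Proof. by move=> mE; have := measurable_normc measurableT mE; rewrite setTI. Qed.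

Lemma measurable_plane_disc : measurable (plane_disc R).
Proof.
have := @measurable_normc_preimage `]-oo, 1[%classic (measurable_itv _).
by congr measurable; apply/seteqP; split => p /=; rewrite in_itv.
Qed.

(** The disc and the area are invariant under rotations. *)
Lemma integral_disc_rot (F : plane -> \bar R) u : normc u = 1 ->
  measurable_fun (plane_disc R) F -> (forall p, plane_disc R p -> (0 <= F p)%E) ->
  (\int[area R]_(p in plane_disc R) F (rot u p) = \int[area R]_(p in plane_disc R) F p)%E.
Proof.
move=> u1 mF F0.
have -> : (\int[area R]_(p in plane_disc R) F p =
    \int[pushforward (area R) (rot u)]_(p in plane_disc R) F p)%E.
  apply: eq_measure_integral; first exact: measurable_rot.
  by move=> mr A mA _; exact/esym/area_rot.
rewrite ge0_integral_pushforward//.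
- congr (integral _ _ _); apply/seteqP; split => p;
    by rewrite /plane_disc/= of_plane_rot /unit_disc/= normcM u1 mul1r.
- exact: measurable_rot.
- exact: measurable_plane_disc.
- by move=> p; rewrite inE => /F0.
Qed.

(** Every open subset of the plane is a countable union of squares with
    rational centres. *)
Lemma measurable_plane_open (U : set plane) :
  (forall p, U p -> exists2 r : R, 0 < r & forall q : plane,
     `|(q.1 : R) - p.1| < r -> `|(q.2 : R) - p.2| < r -> U q) -> measurable U.
Proof.
move=> Uo; pose sq (abn : rat * rat * nat) : set plane :=
  `](ratr abn.1.1 - abn.2.+1%:R^-1), (ratr abn.1.1 + abn.2.+1%:R^-1)[%classic `*`
  `](ratr abn.1.2 - abn.2.+1%:R^-1), (ratr abn.1.2 + abn.2.+1%:R^-1)[%classic.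
pose sqU abn := if pselect (sq abn `<=` U) then sq abn else set0.
have -> : U = \bigcup_abn sqU abn.
  apply/seteqP; split => [p Up|p [abn _]]; last first.
    by rewrite /sqU; case: pselect => // sub /sub.
  have [r r0 rP] := Uo p Up.
  pose n := Num.bound (2 / r); pose d : R := n.+1%:R^-1.
  have d0 : 0 < d by rewrite invr_gt0.
  have dr : d + d < r.
    rewrite /d -mulr2n -[_ *+ 2]mulr_natl ltr_pdivrMr// mulrC -ltr_pdivrMr//.
    rewrite (lt_le_trans (archi_boundP _)) ?divr_ge0 ?(ltW r0)//.
    by rewrite ler_nat.
  have rat_near (x : R) : exists a : rat, x - d < ratr a < x + d.
    have [a] := @rat_in_itvoo R (x - d) (x + d) ltac:(lra).
    by rewrite in_itv/= => /andP[h1 h2]; exists a; rewrite h1.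
  have [a /andP[a1 a2]] := rat_near p.1; have [b /andP[b1 b2]] := rat_near p.2.
  have sub : sq (a, b, n) `<=` U.
    move=> q; rewrite /sq/= !in_itv/= -/d => -[/andP[q1 q2] /andP[q3 q4]].
    by apply: rP; rewrite ltr_norml; apply/andP; split; lra.
  have E : sqU (a, b, n) = sq (a, b, n) by rewrite /sqU; case: (pselect _).
  exists (a, b, n) => //; rewrite E.
  by rewrite /sq/= !in_itv/= -/d; split; apply/andP; split; lra.
apply: countable_bigcupT_measurable; first exact: countableP.
move=> abn; rewrite /sqU; case: (pselect _) => ? //=.
by apply: measurableX; exact: measurable_itv.
Qed.

Lemma plane_disc_open p : plane_disc R p -> exists2 r : R, 0 < r & forall q : plane,
   `|(q.1 : R) - p.1| < r -> `|(q.2 : R) - p.2| < r -> plane_disc R q.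
Proof.
move=> /unit_disc_near/near_normcP[r r0 rP]; exists (r / 2); first by rewrite divr_gt0.
move=> q q1 q2; apply: rP; rewrite (le_lt_trans (normc_le_ReIm _))//=.
by rewrite [ltRHS]splitr ltrD.
Qed.

(** Continuity makes the superlevel sets of the modulus open. *)
Lemma measurable_analytic (f : R[i] -> R[i]) : analytic_disc f ->
  measurable_fun (plane_disc R) (fun p => normc (f (of_plane p)) : measurableTypeR R).
Proof.
move=> fa _; apply: (measurability _ (RGenOInfty.measurableE R)) => //;
  last exact: measurable_plane_disc.
move=> _ [_ [c ->] <-]; apply: measurable_plane_open => p [pD /=].
rewrite in_itv/= andbT => cp; have [r1 r10 r1P] := plane_disc_open pD.
have e0 : 0 < normc (f (of_plane p)) - c by rewrite subr_gt0.
have /near_normcP[r2 r20 r2P] := analytic_cont fa pD e0.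
exists (Num.min r1 (r2 / 2)) => [|q]; first by rewrite lt_min r10 divr_gt0.
rewrite !lt_min => /andP[q1 q2] /andP[q3 q4]; split; first exact: r1P.
rewrite /= in_itv/= andbT.
have : normc (f (of_plane q) - f (of_plane p)) < normc (f (of_plane p)) - c.
  apply: r2P; rewrite (le_lt_trans (normc_le_ReIm _))//=.
  by rewrite [ltRHS]splitr ltrD.
have := normc_lerB (f (of_plane p)) (f (of_plane q)).
by rewrite [normc (f _ - f _)]normc_distC; lra.
Qed.

End PlaneRotation.

(** * Integrals of almost everywhere Borel functions *)

Section NonmeasurableIntegral.
Context d (T : measurableType d) (R : realType) (mu : {measure set T -> \bar R}).
Implicit Types (D B : set T) (u v : T -> \bar R).
Local Open Scope ereal_scope.

Lemma ge0_le_integral_any D u v : (forall x, D x -> 0 <= u x) ->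
  (forall x, D x -> u x <= v x) ->
  \int[mu]_(x in D) u x <= \int[mu]_(x in D) v x.
Proof.
move=> u0 uv; have v0 x : D x -> 0 <= v x by move=> Dx; rewrite (le_trans (u0 x Dx)) ?uv.
rewrite !ge0_integralE//; apply: ereal_sup_le => _ [h hu <-]; exists h => //= x.
rewrite (le_trans (hu x))// /patch; case: ifPn => //; rewrite inE.
exact: uv.
Qed.

(** The integral of a nonnegative function being the supremum of the integrals
    of the simple functions below it, a measurable function agreeing with it
    off a null set has the same integral, measurable or not. *)
Lemma ge0_integral_eq_off D u v B : measurable D -> measurable_fun D v ->
  (forall x, D x -> 0 <= u x) -> (forall x, D x -> 0 <= v x) ->
  measurable B -> mu B = 0 -> (forall x, D x -> ~ B x -> u x = v x) ->
  \int[mu]_(x in D) u x = \int[mu]_(x in D) v x.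
Proof.
move=> mD mv u0 v0 mB B0 uv.
have mb : measurable_fun D (fun x => x \in B).
  apply: (measurable_fun_bool true); apply: measurableI => //.
  by rewrite (_ : _ @^-1` _ = B)//; apply/seteqP; split => x /=; [move=> /set_mem|move/mem_set].
have mif c : measurable_fun D (fun x => if x \in B then c else v x).
  by apply: measurable_fun_if => //; exact: measurable_funS mv.
have ae c : 0 <= c -> \int[mu]_(x in D) (if x \in B then c else v x) = \int[mu]_(x in D) v x.
  move=> c0; apply: ge0_ae_eq_integral => //.
    by move=> x Dx; case: ifP => // _; exact: v0.
  exists B; split => // x /= /not_implyP[Dx]; case: ifPn => [|//].
  by rewrite inE.
apply/eqP; rewrite eq_le; apply/andP; split.
  rewrite -(ae +oo)//; apply: ge0_le_integral_any => // x Dx.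
  by case: ifPn => [_|]; rewrite ?leey// notin_setE => nB; rewrite uv.
rewrite -(ae 0)//; apply: ge0_le_integral_any => x Dx.
  by case: ifPn => // _; exact: v0.
case: ifPn => [_|]; first exact: u0.
by rewrite notin_setE => nB; rewrite uv.
Qed.

End NonmeasurableIntegral.

(** * Area of radial sets *)

Section RadialMeasure.
Context {R : realType}.
Local Notation lam := (@lebesgue_measure R).
Local Notation lam2 := (lam \x lam)%E.
Local Notation plane := (measurableTypeR R * measurableTypeR R)%type.
Implicit Types (E : set (measurableTypeR R)) (t r x y : R).

Definition hyp t x : R := Num.sqrt (x ^+ 2 + t ^+ 2).

Lemma sqr_hyp t x : hyp t x ^+ 2 = x ^+ 2 + t ^+ 2.
Proof. by rewrite sqr_sqrtr// addr_ge0 ?sqr_ge0. Qed.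

Lemma hyp_ge0 t x : 0 <= hyp t x. Proof. exact: sqrtr_ge0. Qed.

Lemma ler_norm_hyp t x : `|t| <= hyp t x.
Proof.
rewrite -(ler_pXn2r (_ : (0 < 2)%N)) ?nnegrE ?hyp_ge0// sqr_hyp real_normK ?num_real//.
by rewrite lerDr sqr_ge0.
Qed.

Lemma measurable_hyp t : measurable_fun setT (hyp t : measurableTypeR R -> measurableTypeR R).
Proof.
apply: (@measurableT_comp _ _ _ _ _ _ (@Num.sqrt R : measurableTypeR R -> measurableTypeR R)).
  by apply: continuous_measurable_fun; exact: sqrt_continuous.
by apply: measurable_funD; [exact: measurable_funX|exact: measurable_cst].
Qed.

(** The derivative of the hypotenuse is the cosine of the angle, which is at
    least 1/2 where the abscissa dominates the ordinate. *)
Lemma hyp_expanding t x y : `|t| <= `|x| -> `|t| <= `|y| -> 0 <= x * y ->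
  2^-1 * `|x - y| <= `|hyp t x - hyp t y|.
Proof.
move=> tx ty xy.
have hle z : `|t| <= `|z| -> hyp t z <= 2 * `|z|.
  move=> tz; rewrite -(ler_pXn2r (_ : (0 < 2)%N)) ?nnegrE ?hyp_ge0 ?mulr_ge0//.
  rewrite sqr_hyp exprMn real_normK ?num_real//.
  have : t ^+ 2 <= z ^+ 2 by rewrite -(real_normK (num_real t)) -(real_normK (num_real z)) lerXn2r ?nnegrE.
  by have := sqr_ge0 z; lra.
have [xy0|xy0] := eqVneq (`|x| + `|y|) 0.
  have x0 : x = 0 by apply/eqP; rewrite -normr_eq0; have := normr_ge0 x; have := normr_ge0 y; lra.
  have y0 : y = 0 by apply/eqP; rewrite -normr_eq0; have := normr_ge0 x; have := normr_ge0 y; lra.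
  by rewrite x0 y0 !subrr normr0 mulr0.
have s0 : 0 < `|x| + `|y| by rewrite lt_def xy0 addr_ge0.
have sE : `|x + y| = `|x| + `|y|.
  have [x0|x0] := leP 0 x; have [y0|y0] := leP 0 y.
  - by rewrite !ger0_norm// addr_ge0.
  - have -> : x = 0 by nra.
    by rewrite add0r normr0 add0r.
  - have -> : y = 0 by nra.
    by rewrite addr0 normr0 addr0.
  - by rewrite !ltr0_norm//; lra.
rewrite -(ler_pM2r (_ : 0 < 2 * (`|x| + `|y|))); last by rewrite mulr_gt0.
rewrite mulrACA mulVf// mul1r -sE -normrM.
have -> : (x - y) * (x + y) = (hyp t x - hyp t y) * (hyp t x + hyp t y).
  by rewrite -!subr_sqr !sqr_hyp; ring.
rewrite normrM ler_wpM2l// ger0_norm ?addr_ge0 ?hyp_ge0// sE mulrDr lerD ?hle//.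
Qed.

Lemma section_le t E : measurable E ->
  (lam [set x : R | (`|t| <= `|x|)%R /\ E (hyp t x)] <= 4%:E * lam E)%E.
Proof.
move=> mE.
have mP : measurable (hyp t @^-1` E : set (measurableTypeR R)).
  by have := measurable_hyp t measurableT mE; rewrite setTI.
have half (D : set (measurableTypeR R)) : measurable D ->
    (forall x y, D x -> D y -> [/\ `|t| <= `|x|, `|t| <= `|y| & 0 <= x * y]) ->
    (lam (D `&` hyp t @^-1` E) <= 2%:E * lam E)%E.
  move=> mD DP; have := @expanding_preimage R (hyp t) D E 2^-1.
  rewrite invrK; apply => //; last exact: measurableI.
  by move=> x y Dx Dy; have [] := DP x y Dx Dy; exact: hyp_expanding.
have h1 := half `[ `|t|, +oo[%classic (measurable_itv _).
have h2 := half `]-oo, - `|t|]%classic (measurable_itv _).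
apply: (@le_trans _ _ (lam ((`[ `|t|, +oo[%classic `&` hyp t @^-1` E) `|`
    (`]-oo, - `|t|]%classic `&` hyp t @^-1` E)))).
  apply: le_measure; rewrite ?inE//.
  - have -> : [set x | `|t| <= `|x| /\ E (hyp t x)] =
        (`[ `|t|, +oo[%classic `|` `]-oo, - `|t|]%classic) `&` hyp t @^-1` E.
      apply/seteqP; split => x /=; rewrite !in_itv/= andbT ler_normr lerNr.
        by move=> [/orP[]]; tauto.
      by move=> [[->|->]]; rewrite ?orbT.
    by apply: measurableI => //; apply: measurableU; exact: measurable_itv.
  - by apply: measurableU; apply: measurableI => //; exact: measurable_itv.
  - move=> x [/=]; rewrite ler_normr lerNr => /orP[|] tx Ex; [left|right];
      by split => //=; rewrite in_itv/= ?andbT.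
rewrite (le_trans (measureU2 _ _ _))//; try by apply: measurableI => //; exact: measurable_itv.
have -> : (4%:E = 2%:E + 2%:E :> \bar R)%E by rewrite -EFinD; congr EFin; lra.
rewrite ge0_muleDl// leeD// ?h1 ?h2//.
  move=> x y /=; rewrite !in_itv/= !andbT => tx ty.
  have x0 : 0 <= x by exact: le_trans tx. have y0 : 0 <= y by exact: le_trans ty.
  by rewrite (ger0_norm x0) (ger0_norm y0); split => //; exact: mulr_ge0.
move=> x y /=; rewrite !in_itv/= => tx ty.
have x0 : x <= 0 by rewrite (le_trans tx)// oppr_le0.
have y0 : y <= 0 by rewrite (le_trans ty)// oppr_le0.
by rewrite !(ler0_norm x0) !(ler0_norm y0) mulr_le0//; split => //; rewrite lerNr.
Qed.

Lemma lam_itv_oo (a b : R) : a <= b -> lam `]a, b[%classic = (b - a)%:E.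
Proof.
move=> ab; rewrite lebesgue_measure_itv/= lte_fin; case: ltP => // ba.
by rewrite (_ : b = a) ?subrr//; apply/le_anti; rewrite ba ab.
Qed.

(** Slicing by the coordinate of smaller modulus gives slices of length at most
    4 |E|, none outside the strip of width 2. *)
Lemma radial_upper E : measurable E -> E `<=` `[0, 1[%classic ->
  (lam2 [set p : plane | E (normc (of_plane p))] <= 16%:E * lam E)%E.
Proof.
move=> mE E1; set N := [set _ | _].
have mN : measurable N by exact: measurable_normc_preimage.
have mfst : measurable_fun [set: plane] (fun p : plane => `|(p.1 : R)| : measurableTypeR R).
  by apply: measurableT_comp => //; exact: measurable_fst.
have msnd : measurable_fun [set: plane] (fun p : plane => `|(p.2 : R)| : measurableTypeR R).
  by apply: measurableT_comp => //; exact: measurable_snd.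
pose H := [set p : plane | `|(p.1 : R)| <= `|(p.2 : R)|].
pose V := [set p : plane | `|(p.2 : R)| <= `|(p.1 : R)|].
have mtrue : measurable [set true] by [].
have mH : measurable H.
  by have := measurable_fun_ler mfst msnd measurableT mtrue; rewrite setTI.
have mV : measurable V.
  by have := measurable_fun_ler msnd mfst measurableT mtrue; rewrite setTI.
have strip (F : measurableTypeR R -> \bar R) : measurable_fun setT F -> (forall x, 0 <= F x)%E ->
    (forall x, F x <= 4%:E * lam E)%E -> (forall x, 1 <= `|x| -> F x = 0%E) ->
    (\int[lam]_x F x <= 8%:E * lam E)%E.
  move=> mF F0 F4 Fout.
  have -> : (\int[lam]_x F x = \int[lam]_(x in `](-1)%R, 1%R[) F x)%E.
    rewrite [RHS]integral_mkcond; apply: eq_integral => x _; rewrite /patch.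
    case: ifPn => //; rewrite notin_setE/= in_itv/= => /negP.
    by rewrite -ltr_norml -leNgt; exact: Fout.
  apply: (@le_trans _ _ (\int[lam]_(x in `](-1)%R, 1%R[) (cst (4%:E * lam E) x))%E).
    by apply: ge0_le_integral => //; exact: measurable_funS mF.
  rewrite integral_cst//= lam_itv_oo// muleAC -EFinM.
  by have -> : 4 * (1 - -1) = 8 :> R by lra.
have out x (y : R) : 1 <= `|x| -> hyp x y < 1 -> False.
  by move=> x1 xy; have := le_lt_trans (le_trans x1 (ler_norm_hyp x y)) xy; rewrite ltxx.
have NH : (lam2 (N `&` H) <= 8%:E * lam E)%E.
  rewrite /product_measure1; apply: strip => [|//|x|x x1].
  - by apply: measurable_fun_xsection; exact: measurableI.
  - rewrite /= (_ : xsection _ x = [set y | `|x| <= `|y| /\ E (hyp x y)]); first exact: section_le.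
    apply/seteqP; split => y; rewrite /xsection/= inE /N /H/= /hyp [y ^+ 2 + _]addrC; tauto.
  - rewrite /= (_ : xsection _ x = set0) ?measure0//; apply/seteqP; split => y //.
    rewrite /xsection/= inE => -[/E1 + _]; rewrite /= in_itv/= => /andP[_].
    by rewrite addrC; exact: out.
have NV : (lam2 (N `&` V) <= 8%:E * lam E)%E.
  rewrite lam2E; last exact: measurableI.
  rewrite /product_measure2; apply: strip => [|//|x|x x1].
  - by apply: measurable_fun_ysection; exact: measurableI.
  - rewrite /= (_ : ysection _ x = [set y | `|x| <= `|y| /\ E (hyp x y)]); first exact: section_le.
    by apply/seteqP; split => y; rewrite /ysection/= inE /N /V/= /hyp; tauto.
  - rewrite /= (_ : ysection _ x = set0) ?measure0//; apply/seteqP; split => y //.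
    rewrite /ysection/= inE => -[/E1 + _]; rewrite /= in_itv/= => /andP[_].
    exact: out.
apply: (@le_trans _ _ (lam2 ((N `&` H) `|` (N `&` V)))).
  apply: le_measure; rewrite ?inE//.
    by apply: measurableU; exact: measurableI.
  move=> p Np; have [h|/ltW h] := leP `|(p.1 : R)| `|(p.2 : R)|; [left|right]; by split.
rewrite (le_trans (measureU2 _ _ _))//; try exact: measurableI.
have -> : (16%:E = 8%:E + 8%:E :> \bar R)%E by rewrite -EFinD; congr EFin; lra.
by rewrite ge0_muleDl// leeD.
Qed.

Definition leg t r : R := Num.sqrt (r ^+ 2 - t ^+ 2).

Lemma measurable_leg t : measurable_fun setT (leg t : measurableTypeR R -> measurableTypeR R).
Proof.
apply: (@measurableT_comp _ _ _ _ _ _ (@Num.sqrt R : measurableTypeR R -> measurableTypeR R)).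
  by apply: continuous_measurable_fun; exact: sqrt_continuous.
by apply: measurable_funB; [exact: measurable_funX|exact: measurable_cst].
Qed.

Lemma sqr_leg t r : 0 <= t <= r -> leg t r ^+ 2 = r ^+ 2 - t ^+ 2.
Proof. by move=> /andP[t0 tr]; rewrite sqr_sqrtr// subr_ge0 lerXn2r ?nnegrE//; exact: le_trans tr. Qed.

Lemma hyp_leg t r : 0 <= t <= r -> Num.sqrt (t ^+ 2 + leg t r ^+ 2) = r.
Proof.
move=> tr; rewrite sqr_leg// subrKC sqrtr_sqr ger0_norm//.
by case/andP: tr; exact: le_trans.
Qed.

Lemma leg_expanding t x y : 0 <= t <= x -> 0 <= t <= y ->
  1 * `|x - y| <= `|leg t x - leg t y|.
Proof.
move=> tx ty; rewrite mul1r.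
have x0 : 0 <= x by case/andP: tx; exact: le_trans.
have y0 : 0 <= y by case/andP: ty; exact: le_trans.
have lle z : 0 <= t <= z -> leg t z <= z.
  move=> tz; have z0 : 0 <= z by case/andP: tz; exact: le_trans.
  rewrite -(ler_pXn2r (_ : (0 < 2)%N)) ?nnegrE ?sqrtr_ge0// sqr_leg//.
  by rewrite gerBl sqr_ge0.
have [xy0|xy0] := eqVneq (x + y) 0.
  have -> : x = y by lra.
  by rewrite !subrr normr0.
have s0 : 0 < x + y by rewrite lt_def xy0 addr_ge0.
rewrite -(ler_pM2r s0) -{1}(ger0_norm (ltW s0)) -normrM.
have -> : (x - y) * (x + y) = (leg t x - leg t y) * (leg t x + leg t y).
  by rewrite -!subr_sqr !sqr_leg//; ring.
by rewrite normrM ler_wpM2l// ger0_norm ?addr_ge0 ?sqrtr_ge0// lerD ?lle.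
Qed.

(** At an abscissa x in ]0, 1/4[ the upper half of the vertical slice is the
    image of E under r -> sqrt(r^2 - x^2), which expands distances. *)
Lemma radial_lower E : measurable E -> E `<=` `[2^-1, 1[%classic ->
  ((4^-1)%:E * lam E <= lam2 [set p : plane | E (normc (of_plane p))])%E.
Proof.
move=> mE E1; set N := [set _ | _].
have mN : measurable N by exact: measurable_normc_preimage.
apply: (@le_trans _ _ (\int[lam]_(x in `]0%R, 4^-1%R[) lam (xsection N x))%E); last first.
  apply: ge0_subset_integral => //.
  exact: measurable_fun_xsection.
have -> : ((4^-1)%:E * lam E = \int[lam]_(x in `]0%R, 4^-1%R[) (cst (lam E) x))%E.
  rewrite integral_cst//= lam_itv_oo ?invr_ge0// subr0 muleC//.
apply: ge0_le_integral => //.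
  by apply: measurable_funS (measurable_fun_xsection lam mN).
move=> x; rewrite /= in_itv/= => /andP[x0 x4].
have tE r : E r -> 0 <= x <= r.
  by move=> /E1; rewrite /= in_itv/= => /andP[r2 _]; apply/andP; split; lra.
have -> : E = E `&` leg x @^-1` (xsection N x).
  apply/seteqP; split => [r Er|r []//]; split => //=.
  by rewrite /xsection/= inE /N/= hyp_leg// tE.
have := @expanding_preimage R (leg x) E (xsection N x) 1 ltr01.
rewrite invr1 mul1e; apply.
- by move=> a b /tE ha /tE hb; exact: leg_expanding.
- exact: measurable_xsection.
- apply: measurableI => //.
  by have := measurable_leg x measurableT (measurable_xsection x mN); rewrite setTI.
Qed.

End RadialMeasure.

(** * Profile and masses of a radial doubling weight *)

Section RadialWeight.
Context {R : realType}.
Local Notation lam := (@lebesgue_measure R).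
Local Notation lam2 := (lam \x lam)%E.
Local Notation plane := (measurableTypeR R * measurableTypeR R)%type.
Local Notation nrm := (fun p : plane => normc (of_plane p) : measurableTypeR R).
Implicit Types (E : set (measurableTypeR R)) (t r x y : R) (w : R[i] -> R) (v : R -> R).

Definition annulus r : set plane := [set p : plane | r <= normc (of_plane p) < 1].

Lemma unit_disc_real r : 0 <= r -> r < 1 -> unit_disc R r%:C.
Proof. by move=> r0 r1; rewrite /unit_disc/= expr0n/= addr0 sqrtr_sqr ger0_norm. Qed.

Lemma annulusE r : annulus r = nrm @^-1` `[r, 1[%classic.
Proof. by apply/seteqP; split => p /=; rewrite in_itv. Qed.

Lemma measurable_annulus r : measurable (annulus r).
Proof. by rewrite annulusE; have := measurable_normc measurableT (measurable_itv `[r, 1[); rewrite setTI. Qed.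

Lemma annulus0 : annulus 0 = plane_disc R.
Proof. by apply/seteqP; split => p /=; rewrite /annulus /plane_disc /unit_disc /= sqrtr_ge0. Qed.

(** A two-dimensional counterpart of [hat] for the radial weight of profile v. *)
Definition mass v r : \bar R := (\int[area R]_(p in annulus r) (v (normc (of_plane p)))%:E)%E.

Lemma measurable_radial v : measurable_fun setT (v : measurableTypeR R -> measurableTypeR R) ->
  measurable_fun [set: plane] (fun p : plane => (v (normc (of_plane p)))%:E).
Proof. by move=> mv; apply/measurable_EFinP; apply: measurableT_comp mv measurable_normc. Qed.

Section Comparison.
Variable v : R -> R.
Hypothesis mv : measurable_fun setT (v : measurableTypeR R -> measurableTypeR R).
Hypothesis v0 : forall x, 0 <= v x.

Let mvE D : measurable_fun D (fun x : measurableTypeR R => (v x)%:E).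
Proof. by apply/measurable_EFinP; exact: measurable_funS mv. Qed.

Let vE0 x : (0 <= (v x)%:E)%E. Proof. by rewrite lee_fin. Qed.

Let modulus_law : {measure set (measurableTypeR R) -> \bar R} :=
  measure_function_pushforward__canonical__measure_function_Measure (area R) measurable_normc.

Let mass_law r : mass v r = (\int[modulus_law]_(x in `[r, 1%R[) (v x)%:E)%E.
Proof.
rewrite ge0_integral_pushforward//; last exact: measurable_normc.
Qed.

Let restricted (m : {measure set (measurableTypeR R) -> \bar R}) r
    (mI : measurable (`[r, 1[%classic : set (measurableTypeR R))) :
  (\int[m]_(x in `[r, 1%R[) (v x)%:E = \int[mrestr m mI]_(x in `[r, 1%R[) (v x)%:E)%E.
Proof.
by apply: eq_measure_integral => A mA AI; rewrite -[in LHS](setIidl AI).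
Qed.

Lemma mass_le_integral r : 0 <= r ->
  (mass v r <= (pi^-1 * 16)%:E * \int[lam]_(x in `[r, 1%R[) (v x)%:E)%E.
Proof.
move=> r0; rewrite mass_law.
have k0 : 0 <= pi^-1 * 16 :> R by rewrite mulr_ge0// invr_ge0 pi_ge0.
rewrite -(@ge0_integral_mscale _ _ _ _ _ _ (NngNum k0))//.
have mI : measurable (`[r, 1[%classic : set (measurableTypeR R)) by exact: measurable_itv.
rewrite (restricted modulus_law mI) (restricted (mscale (NngNum k0) lam) mI).
apply: ge0_le_measure_integral => // S mS.
change (area R [set p | (S `&` `[r, 1%R[%classic) (nrm p)] <= (pi^-1 * 16)%:E * lam (S `&` `[r, 1%R[%classic))%E.
rewrite areaE EFinM -muleA lee_pmul2l// ?lte_fin ?invr_gt0 ?pi_gt0//.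
apply: radial_upper; first exact: measurableI.
move=> x [_] /=; rewrite !in_itv/= => /andP[rx ->]; rewrite (le_trans r0 rx)//.
Qed.

Lemma integral_le_mass r : 2^-1 <= r ->
  ((pi^-1 * 4^-1)%:E * \int[lam]_(x in `[r, 1%R[) (v x)%:E <= mass v r)%E.
Proof.
move=> r2; rewrite mass_law.
have k0 : 0 <= pi^-1 * 4^-1 :> R by rewrite mulr_ge0// invr_ge0 pi_ge0.
rewrite -(@ge0_integral_mscale _ _ _ _ _ _ (NngNum k0))//.
have mI : measurable (`[r, 1[%classic : set (measurableTypeR R)) by exact: measurable_itv.
rewrite (restricted modulus_law mI) (restricted (mscale (NngNum k0) lam) mI).
apply: ge0_le_measure_integral => // S mS.
change ((pi^-1 * 4^-1)%:E * lam (S `&` `[r, 1%R[%classic) <= area R [set p | (S `&` `[r, 1%R[%classic) (nrm p)])%E.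
rewrite areaE EFinM -muleA lee_pmul2l// ?lte_fin ?invr_gt0 ?pi_gt0//.
apply: radial_lower; first exact: measurableI.
move=> x [_] /=; rewrite !in_itv/= => /andP[rx ->]; rewrite (le_trans r2 rx)//.
Qed.

End Comparison.

(** By the theorem of Fubini almost every section of a null set is null. *)
Lemma null_section (B : set plane) e : measurable B -> lam2 B = 0%E -> 0 < e ->
  exists2 t, 0 < t < e & lam (xsection B t) = 0%E.
Proof.
move=> mB B0 e0; apply: contrapT => nex.
have mf := measurable_fun_xsection lam mB.
have : ae_eq lam setT (lam \o xsection B) (cst 0%E).
  apply/ae_eq_integral_abs => //.
  by rewrite -[RHS]B0 /product_measure1; apply: eq_integral => x _; rewrite gee0_abs.
move=> [N [mN N0 NP]].
have sub : `]0, e[%classic `<=` N.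
  move=> t; rewrite /= in_itv/= => t0e; apply: NP => /= /(_ Logic.I) H.
  by apply: nex; exists t.
have : (lam `]0%R, e[%classic <= lam N)%E.
  by apply: le_measure => //; rewrite inE//; exact: measurable_itv.
by rewrite [lam N]N0 lam_itv_oo ?(ltW e0)// subr0 lee_fin leNgt e0.
Qed.

(** A radial weight agrees almost everywhere with a function of the modulus
    alone which is Borel: along almost every vertical line x = t the weight at
    the modulus r is the value at height sqrt(r^2 - t^2) of a Borel function of
    two variables, and t may be taken as small as desired. *)
Lemma radial_profile w : weight w -> radial w -> exists v, exists M : set (measurableTypeR R),
  [/\ measurable_fun setT (v : measurableTypeR R -> measurableTypeR R),
      forall x, 0 <= v x, measurable M, lam M = 0%E &
      forall r, 0 < r < 1 -> ~ M r -> w r%:C = v r].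
Proof.
move=> [w0 [g gi gw] _] wr.
have mg : measurable_fun [set: plane] ((g : plane -> measurableTypeR R) \_ (plane_disc R)).
  apply: (measurable_restrictT _ (@measurable_plane_disc R)).1.
  by apply/measurable_EFinP; exact: measurable_int gi.
have [B [mB B0 BP]] := gw.
have {}B0 : lam2 B = 0%E.
  move/eqP: B0; rewrite areaE mule_eq0 eqe invr_eq0 => /orP[/eqP p0|/eqP//].
  by have := pi_gt0 R; rewrite p0 ltxx.
have /choice[t tP] (n : nat) : exists t, 0 < t < n.+1%:R^-1 /\ lam (xsection B t) = 0%E.
  by have [t t1 t2] := null_section mB B0 (ltac:(by rewrite invr_gt0) : 0 < n.+1%:R^-1); exists t.
pose Mn n : set (measurableTypeR R) := `]t n, 1[%classic `&` leg (t n) @^-1` (xsection B (t n)).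
have mMn n : measurable (Mn n).
  apply: measurableI; first exact: measurable_itv.
  by have := measurable_leg (t n) measurableT (measurable_xsection (t n) mB); rewrite setTI.
have tn r n : t n < r -> 0 <= t n <= r.
  by move=> /ltW ->; have [/andP[/ltW-> _] _] := tP n.
have Mn0 n : lam (Mn n) = 0%E.
  apply/eqP; rewrite eq_le measure_ge0 andbT.
  have := @expanding_preimage R (leg (t n)) `]t n, 1[%classic (xsection B (t n)) 1 ltr01.
  have [_ ->] := tP n; rewrite invr1 mule0; apply; [|exact: measurable_xsection|exact: mMn].
  move=> x y /=; rewrite !in_itv/= => /andP[/tn hx _] /andP[/tn hy _].
  exact: leg_expanding.
pose M := \bigcup_n Mn n.
have mM : measurable M by exact: bigcupT_measurable.
have M0 : lam M = 0%E.
  apply/negligibleP => //; apply: negligible_bigcup => n.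
  by exists (Mn n); split; [exact: mMn|exact: Mn0|].
pose G := [set r : measurableTypeR R | 0 < (r : R) < 1 /\ ~ M r].
have wG r n : G r -> t n < r -> w r%:C = g (t n, leg (t n) r).
  move=> [/andP[r0 r1] nM] tr.
  have pE : normc (of_plane (t n, leg (t n) r)) = r by rewrite /= hyp_leg// tn.
  have D : plane_disc R (t n, leg (t n) r) by change (normc (of_plane (t n, leg (t n) r)) < 1); rewrite pE.
  have -> : w r%:C = w (of_plane (t n, leg (t n) r)) by rewrite [RHS]wr// pE.
  apply: contrapT => nE; apply: nM; exists n => //; split.
    by rewrite /= in_itv/= tr.
  by rewrite /= /xsection/= inE; apply: BP => /= /(_ D).
pose v r := if pselect (G r) then w r%:C else 0.
exists v, M; split => //.
  (* v is the pointwise limit of the functions obtained along the lines x = t n. *)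
- pose h n r := if (t n < r) && (r < 1) && (r \notin M) then
     ((g : plane -> measurableTypeR R) \_ (plane_disc R)) (t n, leg (t n) r) else 0.
  apply: (@measurable_realfun.measurable_fun_cvg _ _ _ _ h) => [n|r _].
    apply: measurable_fun_ifT.
    + apply: measurable_and; first apply: measurable_and.
      * by apply: measurable_fun_ltr => //; exact: measurable_cst.
      * by apply: measurable_fun_ltr => //; exact: measurable_cst.
      * apply: measurable_neg; apply: (measurable_fun_bool true); rewrite setTI.
        by rewrite (_ : _ @^-1` _ = M)//; apply/seteqP; split => x /=; [move=> /set_mem|move/mem_set].
    + apply: (measurableT_comp mg).
      by apply: measurable_fun_pair; [exact: measurable_cst|exact: measurable_leg].
    + exact: measurable_cst.
  rewrite /v; case: (pselect (G r)) => [Gr|nG] /=.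
    have [/andP[r0 r1] nM] := Gr.
    apply/cvgrPdist_lt => e e0; near=> n.
    have tr : t n < r.
      have [/andP[_ tn1] _] := tP n; apply: (lt_trans tn1).
      by near: n; exact: near_infty_natSinv_lt (PosNum r0).
    have pE : normc (of_plane (t n, leg (t n) r)) = r by rewrite /= hyp_leg// tn.
    have D : plane_disc R (t n, leg (t n) r) by change (normc (of_plane (t n, leg (t n) r)) < 1); rewrite pE.
    rewrite /h tr r1 (memNset nM)/= /patch mem_set// -wG// subrr normr0//.
  have h0 n : h n r = 0.
    rewrite /h; case: ifPn => // /andP[/andP[tr r1] /negP rM]; exfalso; apply: nG.
    split; last by move=> Mr; apply: rM; exact: mem_set.
    by rewrite r1 andbT; have [/andP[tn0 _] _] := tP n; exact: lt_trans tr.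
  by under eq_cvg do rewrite h0; exact: cvg_cst.
- move=> x; rewrite /v; case: (pselect (G x)) => //= -[/andP[x0 x1] _].
  by apply: w0; apply: unit_disc_real => //; exact: ltW.
- by move=> r r01 nM; rewrite /v; case: (pselect (G r)) => // -[].
Unshelve. all: by end_near. Qed.

(** The areas of radial sets and the lengths of their traces on a radius are
    comparable away from the origin, so the doubling condition on [hat] becomes
    one on [mass]: the lower comparison is applied only at (1 + r) / 2, which is
    at least 1/2. *)
Lemma Dhat_profile w : Dhat w -> exists v,
  [/\ measurable_fun setT (v : measurableTypeR R -> measurableTypeR R) /\ (forall x, 0 <= v x),
      exists2 B : set plane, measurable B /\ area R B = 0%E & forall p, plane_disc R p -> ~ B p ->
        w (of_plane p) = v (normc (of_plane p)),
      (0 < mass v 0 < +oo)%E &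
      exists2 C : R, 0 < C & forall r, 0 <= r < 1 -> (mass v r <= C%:E * mass v ((1 + r) / 2)%R)%E].
Proof.
move=> [wt wr [C C1 dbl]].
have [v [M [mv v0 mM M0 wv]]] := radial_profile wt wr; exists v.
(* The profile is the weight only at positive moduli off M. *)
pose M1 : set (measurableTypeR R) := (M `&` `[0, 1[%classic) `|` [set 0].
have mM1 : measurable M1.
  by apply: measurableU; [apply: measurableI => //; exact: measurable_itv|exact: measurable_set1].
have M10 : lam M1 = 0%E.
  apply/eqP; rewrite eq_le measure_ge0 andbT (le_trans (measureU2 _ _ _))//.
  - by apply: measurableI => //; exact: measurable_itv.
  rewrite [X in (_ + X)%E](lebesgue_measure_set1 0) adde0 -[leRHS]M0 le_measure ?inE//.
  by apply: measurableI => //; exact: measurable_itv.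
pose B := [set p : plane | M1 (normc (of_plane p))].
have mB : measurable B by exact: measurable_normc_preimage.
have B0 : area R B = 0%E.
  rewrite areaE; have -> : lam2 B = 0%E; last by rewrite mule0.
  apply/eqP; rewrite eq_le measure_ge0 andbT.
  have := radial_upper mM1; rewrite M10 mule0; apply.
  move=> x [[] //|->]; by rewrite /= in_itv/= lexx ltr01.
have wB p : plane_disc R p -> ~ B p -> w (of_plane p) = v (normc (of_plane p)).
  move=> pD nB; rewrite wr//; apply: wv.
    rewrite pD andbT lt_def normc_ge0 andbT; apply/eqP => p0.
    by apply: nB; right.
  move=> Mp; apply: nB; left; split => //; rewrite /= in_itv/=.
  by apply/andP; split; [exact: sqrtr_ge0|exact: pD].
have [w0 [g gi gw] wn0] := wt.
have mV D : measurable_fun D (fun p : plane => (v (normc (of_plane p)))%:E).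
  by apply: measurable_funS (measurable_radial mv).
split=> //; first by exists B.
- apply/andP; split.
    rewrite lt0e integral_ge0 ?andbT; last by move=> p _; rewrite lee_fin.
    apply/eqP => m0; apply: wn0.
    have : ae_eq (area R) (plane_disc R) (fun p : plane => (v (normc (of_plane p)))%:E) (cst 0%E).
      apply/ae_eq_integral_abs => //; first exact: measurable_plane_disc.
      rewrite -annulus0 -[RHS]m0; apply: eq_integral => p _.
      by rewrite gee0_abs// lee_fin.
    move=> [N [mN N0 NP]]; exists (N `|` B); split; first exact: measurableU.
      by rewrite measureU0.
    move=> p /= /not_implyP[pD wp0].
    have [Bp|nB] := pselect (B p); first by right.
    left; apply: NP => /= /(_ pD) [vp]; apply: wp0.
    by rewrite wB.
  have [N [mN N0 NP]] := gw.
  have -> : mass v 0 = (\int[area R]_(p in plane_disc R) `|(g p)%:E|)%E.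
    rewrite /mass annulus0; apply: (@ge0_integral_eq_off _ _ _ _ _ _ _ (N `|` B)).
    - exact: measurable_plane_disc.
    - by apply: measurableT_comp => //; exact: measurable_int gi.
    - by move=> p _; rewrite lee_fin.
    - by move=> p _; rewrite lee_fin.
    - exact: measurableU.
    - by rewrite measureU0.
    move=> p pD /not_orP[nN nB]; rewrite -wB//.
    have -> : g p = w (of_plane p).
      have [//|nE] := pselect (g p = w (of_plane p)).
      by exfalso; apply: nN; apply: NP => /= /(_ pD)/esym.
    by rewrite gee0_abs// lee_fin w0.
  by case/integrableP: gi.
- have hatE r : 0 <= r -> hat w r = (\int[lam]_(s in `[r, 1%R[) (v s)%:E)%E.
    move=> r0; apply: (@ge0_integral_eq_off _ _ _ _ _ _ _ M1) => //.
    + by apply/measurable_EFinP; exact: measurable_funS mv.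
    + move=> s; rewrite /= in_itv/= => /andP[rs s1]; rewrite lee_fin w0//.
      by apply: unit_disc_real; rewrite ?(le_trans r0 rs).
    + by move=> s _; rewrite lee_fin.
    + move=> s; rewrite /= in_itv/= => /andP[rs s1] nM; congr EFin; apply: wv.
        rewrite s1 andbT lt_def (le_trans r0 rs) andbT; apply/eqP => s0.
        by apply: nM; right.
      by move=> Ms; apply: nM; left; split => //; rewrite /= in_itv/= s1 (le_trans r0 rs).
  have pi0 := pi_gt0 R.
  (* 64 is the quotient of the constants 16 and 1/4 of the two comparisons. *)
  exists (64 * C) => [|r /andP[r0 r1]]; first by rewrite mulr_gt0// (lt_le_trans ltr01).
  apply: (le_trans (mass_le_integral mv v0 r0)).
  have r20 : 2^-1 <= (1 + r) / 2 by lra.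
  rewrite -hatE//; apply: (@le_trans _ _ ((pi^-1 * 16)%:E * (C%:E * hat w ((1 + r) / 2)%R))%E).
    by rewrite lee_wpmul2l ?lee_fin ?mulr_ge0 ?invr_ge0 ?(ltW pi0)// dbl// r0.
  rewrite hatE; last by lra.
  apply: (@le_trans _ _ ((64 * C)%:E * ((pi^-1 * 4^-1)%:E * \int[lam]_(s in `[((1 + r) / 2)%R, 1%R[) (v s)%:E))%E).
    rewrite !muleA -!EFinM; have -> // : pi^-1 * 16 * C = 64 * C * (pi^-1 * 4^-1).
      by rewrite (_ : 16 = 64 / 4 :> R); [ring|lra].
  rewrite lee_wpmul2l ?integral_le_mass// lee_fin mulr_ge0// (le_trans ler01)//.
Unshelve. all: by end_near. Qed.

End RadialWeight.

(** * Infinite products with nonnegative coefficients *)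

Lemma taylor_step (T : comNzRingType) (x h : T) i :
  (x + h) ^+ i.+1 - x ^+ i.+1 - (x ^+ i *+ i.+1) * h =
  (x + h) * ((x + h) ^+ i - x ^+ i - (x ^+ i.-1 *+ i) * h) + (x ^+ i.-1 *+ i) * h ^+ 2.
Proof.
case: i => [|i]; first by rewrite !expr1 !expr0 mulr0n mulr1n; ring.
rewrite /= -(mulr_natr _ i.+2) -(mulr_natr _ i.+1) -[i.+2]add1n natrD !exprS.
by move: ((x + h) ^+ i) (x ^+ i) (i.+1%:R) => u v k; ring.
Qed.

Section NonnegPolynomial.
Context {R : realType}.
Implicit Types (p q : {poly R}) (z h w : R[i]) (r s H : R).

Definition nneg_poly p := forall i, 0 <= p`_i.

Definition evalC p z : R[i] := \sum_(i < size p) (p`_i)%:C * z ^+ i.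

Definition devalC p z : R[i] := \sum_(i < size p) (p`_i)%:C * (z ^+ i.-1 *+ i).

Lemma evalCE p z : evalC p z = (map_poly (real_complex R) p).[z].
Proof.
rewrite horner_coef size_map_poly; apply: eq_bigr => i _.
by rewrite coef_map.
Qed.

Lemma devalCE p z : devalC p z = (map_poly (real_complex R) p)^`().[z].
Proof.
have -> : map_poly (real_complex R) p = \sum_(i < size p) (p`_i)%:C *: 'X^i.
  rewrite -[LHS]coefK poly_def size_map_poly; apply: eq_bigr => i _.
  by rewrite coef_map.
rewrite (big_morph (@deriv R[i]) (@derivD _) (@deriv0 _)) horner_sum; apply: eq_bigr => i _.
by rewrite derivZ derivXn hornerZ hornerMn hornerXn.
Qed.

Lemma nneg_polyD p q : nneg_poly p -> nneg_poly q -> nneg_poly (p + q).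
Proof. by move=> p0 q0 i; rewrite coefD addr_ge0. Qed.

Lemma nneg_polyM p q : nneg_poly p -> nneg_poly q -> nneg_poly (p * q).
Proof. by move=> p0 q0 i; rewrite coefM sumr_ge0// => j _; rewrite mulr_ge0. Qed.

Lemma nneg_polyC r : 0 <= r -> nneg_poly r%:P.
Proof. by move=> r0 i; rewrite coefC; case: ifP. Qed.

Lemma nneg_polyXn n : nneg_poly 'X^n.
Proof. by move=> i; rewrite coefXn ler0n. Qed.

Lemma nneg_horner_le p r s : nneg_poly p -> 0 <= r -> r <= s -> p.[r] <= p.[s].
Proof.
move=> p0 r0 rs; rewrite !horner_coef; apply: ler_sum => i _.
by rewrite ler_wpM2l// lerXn2r ?nnegrE// (le_trans r0).
Qed.

Lemma nneg_horner_ge0 p r : nneg_poly p -> 0 <= r -> 0 <= p.[r].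
Proof.
by move=> p0 r0; rewrite horner_coef sumr_ge0// => i _; rewrite mulr_ge0// exprn_ge0.
Qed.

Lemma normc_natmul z n : normc (z *+ n) = normc z *+ n.
Proof. by rewrite -mulr_natl normcM -(rmorph_nat (real_complex R)) normcR normr_nat mulr_natl. Qed.

Lemma normc_evalC p z : nneg_poly p -> normc (evalC p z) <= p.[normc z].
Proof.
move=> p0; rewrite (le_trans (normc_sum _ _ _))// horner_coef ler_sum// => i _.
by rewrite normcM normcR ger0_norm// normcX.
Qed.

Let E r H i := (r + H) ^+ i - r ^+ i - (r ^+ i.-1 *+ i) * H.

Let E_S r H i : E r H i.+1 = (r + H) * E r H i + (r ^+ i.-1 *+ i) * H ^+ 2.
Proof.
exact: taylor_step.
Qed.

Let E_ge0 r H i : 0 <= r -> 0 <= H -> 0 <= E r H i.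
Proof.
move=> r0 H0; elim: i => [|i IH]; first by rewrite /E !expr0 mulr0n mul0r; lra.
rewrite E_S; apply: addr_ge0; first by apply: mulr_ge0 => //; exact: addr_ge0.
by apply: mulr_ge0; [rewrite mulrn_wge0// exprn_ge0|exact: exprn_ge0].
Qed.

Let taylor_monomial z h H i : 0 < H -> normc h <= H ->
  normc ((z + h) ^+ i - z ^+ i - (z ^+ i.-1 *+ i) * h) <= (normc h / H) ^+ 2 * E (normc z) H i.
Proof.
move=> H0 hH; elim: i => [|i IH].
  have -> : (z + h) ^+ 0 - z ^+ 0 - (z ^+ 0.-1 *+ 0) * h = 0 by rewrite !expr0 mulr0n mul0r; ring.
  by rewrite normc0 mulr_ge0 ?sqr_ge0// E_ge0 ?normc_ge0 ?ltW.
rewrite taylor_step.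
rewrite (le_trans (normcD _ _))// E_S [leRHS]mulrDr; apply: lerD.
  rewrite normcM mulrCA ler_pM ?normc_ge0// (le_trans (normcD _ _))// lerD2l//.
rewrite normcM normc_natmul !normcX [leRHS]mulrCA ler_wpM2l ?mulrn_wge0 ?exprn_ge0 ?normc_ge0//.
by rewrite expr_div_n divfK// expf_neq0// gt_eqF.
Qed.

(** A polynomial with nonnegative coefficients controls its own second order
    Taylor remainder: the coefficients of the remainder are nonnegative and the
    remainder starts with the second power of the increment. *)
Lemma nneg_taylor p z h H : nneg_poly p -> 0 < H -> normc h <= H ->
  normc (evalC p (z + h) - evalC p z - devalC p z * h) <=
    (normc h / H) ^+ 2 * p.[normc z + H].
Proof.
move=> p0 H0 hH; rewrite mulr_suml -!sumrB.
rewrite (le_trans (normc_sum _ _ _))// horner_coef mulr_sumr ler_sum// => i _.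
rewrite -mulrA -!mulrBr normcM normcR ger0_norm// mulrCA ler_wpM2l//.
rewrite (le_trans (taylor_monomial z i H0 hH))// ler_wpM2l ?sqr_ge0// /E.
rewrite -addrA gerDl -opprD oppr_le0 addr_ge0 ?exprn_ge0 ?normc_ge0//.
by rewrite mulr_ge0 ?mulrn_wge0 ?exprn_ge0 ?normc_ge0// ltW.
Qed.

Lemma nneg_deriv p z H : nneg_poly p -> 0 < H ->
  normc (devalC p z) <= p.[normc z + H] / H.
Proof.
move=> p0 H0; rewrite ler_pdivlMr// -[leLHS]mulrC.
rewrite -ler_pdivlMl// (le_trans (normc_sum _ _ _))// horner_coef mulr_sumr ler_sum// => i _.
rewrite normcM normcR ger0_norm// mulrCA ler_wpM2l// normc_natmul normcX ler_pdivlMl//.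
rewrite mulrC; have := E_ge0 i (normc_ge0 z) (ltW H0); rewrite /E.
by have := exprn_ge0 i (normc_ge0 z); lra.
Qed.

End NonnegPolynomial.

Section ComplexSequence.
Context {R : realType}.
Implicit Types (u v : nat -> R[i]) (l m : R[i]) (c : nat -> R).

Definition ccvg u l := forall e : R, 0 < e ->
  exists K0 : nat, forall K, (K0 <= K)%N -> normc (u K - l) <= e.

Lemma ccvg_norm_le u l C : ccvg u l -> (forall K, normc (u K) <= C) -> normc l <= C.
Proof.
move=> ul uC; apply/ler_addgt0Pr => e e0; have [K /(_ K (leqnn K)) uK] := ul e e0.
by have := normc_lerB l (u K); rewrite normc_distC; have := uC K; lra.
Qed.

Lemma ccvg_cst l : ccvg (fun=> l) l.
Proof. by move=> e e0; exists 0%N => K _; rewrite subrr normc0 ltW. Qed.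

Lemma ccvgD u v l m : ccvg u l -> ccvg v m -> ccvg (fun K => u K + v K) (l + m).
Proof.
move=> ul vm e e0; have e20 : 0 < e / 2 by rewrite divr_gt0.
have [K1 h1] := ul _ e20; have [K2 h2] := vm _ e20; exists (maxn K1 K2) => K.
rewrite geq_max => /andP[/h1 k1 /h2 k2]; rewrite opprD addrACA (le_trans (normcD _ _))//.
by lra.
Qed.

Lemma ccvgM u l (a : R[i]) : ccvg u l -> ccvg (fun K => a * u K) (a * l).
Proof.
move=> ul e e0; have a0 : 0 < 1 + normc a by rewrite ltr_wpDr ?normc_ge0.
have [K0 h0] := ul _ (divr_gt0 e0 a0); exists K0 => K /h0 uK.
rewrite -mulrBr normcM (le_trans (ler_wpM2l (normc_ge0 _) uK))//.
by rewrite mulrCA ler_piMr ?(ltW e0)// ler_pdivrMr// mul1r lerDr.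
Qed.

Lemma ccvg_unique u l m : ccvg u l -> ccvg u m -> l = m.
Proof.
move=> ul um; apply/eqP; rewrite -subr_eq0 -normc_eq0 eq_le normc_ge0 andbT.
have := ccvgD ul (ccvgM (-1) um) => /ccvg_norm_le => /(_ 0); rewrite mulN1r; apply.
by move=> K; rewrite mulN1r subrr normc0.
Qed.

Lemma ccvg_shift u l (m : nat) : ccvg u l -> ccvg (fun K => u (m + K)%N) l.
Proof.
move=> ul e e0; have [K0 h0] := ul e e0; exists K0 => K K0K.
by apply: h0; rewrite (leq_trans K0K)// leq_addl.
Qed.

Lemma bounded_monotone_tail c C : (forall K L, (L <= K)%N -> c L <= c K) ->
  (forall K, c K <= C) -> exists l : R, forall e : R, 0 < e ->
    exists K0 : nat, forall K, (K0 <= K)%N -> l - e <= c K <= l.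
Proof.
move=> cm cC; pose A := range c; exists (sup A) => e e0.
have sA : has_sup A by split; [exists (c 0%N); exists 0%N|exists C => _ [K _ <-]].
have [_ [K0 _ <-] cK0] := sup_adherent e0 sA.
exists K0 => K K0K; rewrite (le_trans (ltW cK0) (cm _ _ K0K))/=.
by apply: ub_le_sup; [case: sA|exists K].
Qed.

(** The real and imaginary parts become monotone when the dominating monotone
    sequence is added to them. *)
Lemma ccvg_dominated u c C :
  (forall K L, (L <= K)%N -> normc (u K - u L) <= c K - c L) ->
  (forall K, c K <= C) -> exists l, ccvg u l.
Proof.
move=> uc cC.
have cm K L : (L <= K)%N -> c L <= c K.
  by move=> /uc; have := normc_ge0 (u K - u L); lra.
have [lc lcP] := bounded_monotone_tail cm cC.
have real_part (g : R[i] -> R) : (forall z w, `|g z - g w| <= normc (z - w)) ->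
    exists l : R, forall e : R, 0 < e -> exists K0 : nat, forall K, (K0 <= K)%N -> `|g (u K) - l| <= e.
  move=> g1.
  have gc K L : (L <= K)%N -> `|g (u K) - g (u L)| <= c K - c L.
    by move=> LK; rewrite (le_trans (g1 _ _))// uc.
  have [l lP] := @bounded_monotone_tail (fun K => g (u K) + c K) (g (u 0%N) + C + C - c 0%N)
    (fun K L LK => ltac:(have /ler_normlP[+ _] := gc K L LK; lra))
    (fun K => ltac:(have /ler_normlP[_] := gc K 0%N isT; have := cC K; lra)).
  exists (l - lc) => e e0; have e20 : 0 < e / 2 by rewrite divr_gt0.
  have [K1 h1] := lP _ e20; have [K2 h2] := lcP _ e20; exists (maxn K1 K2) => K.
  rewrite geq_max => /andP[/h1/andP[a1 a2] /h2/andP[a3 a4]].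
  by rewrite ler_norml; apply/andP; split; lra.
have [|x xP] := real_part (@complex.Re R).
  by move=> [a b] [a' b']; exact: (@ler_Re_normc _ ((a +i* b) - (a' +i* b'))).
have [|y yP] := real_part (@complex.Im R).
  by move=> [a b] [a' b']; exact: (@ler_Im_normc _ ((a +i* b) - (a' +i* b'))).
exists (x +i* y) => e e0; have e20 : 0 < e / 2 by rewrite divr_gt0.
have [K1 h1] := xP _ e20; have [K2 h2] := yP _ e20; exists (maxn K1 K2) => K.
rewrite geq_max => /andP[/h1 a1 /h2 a2]; rewrite (le_trans (normc_le_ReIm _))//.
by case: (u K) a1 a2 => a b /= a1 a2; lra.
Qed.

End ComplexSequence.

Section InfiniteProduct.
Context {R : realType}.
Implicit Types (a : nat -> R) (n : nat -> nat) (K L m : nat) (z h : R[i]) (r S : R).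

Definition pprod a n K : {poly R} := \prod_(j < K) (1 + (a j)%:P * 'X^(n j)).

Definition pprodC a n K z : R[i] := \prod_(j < K) (1 + (a j)%:C * z ^+ n j).

Definition iprod a n z : R[i] := xget 0 [set l | ccvg (fun K => pprodC a n K z) l].

(** All factors being at least 1 on the radius, this is the convergence of the
    product there. *)
Definition bounded_pprod a n := forall r, 0 <= r < 1 ->
  exists S, forall K, (pprod a n K).[r] <= S.

Lemma evalC_pprod a n K z : evalC (pprod a n K) z = pprodC a n K z.
Proof.
rewrite evalCE rmorph_prod horner_prod; apply: eq_bigr => j _.
by rewrite rmorphD rmorphM/= rmorph1 map_polyC map_polyXn hornerD hornerC hornerM hornerC hornerXn.
Qed.

Lemma pprodS a n K : pprod a n K.+1 = pprod a n K + (a K)%:P * 'X^(n K) * pprod a n K.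
Proof. by rewrite /pprod big_ord_recr/= mulrDr mulr1 mulrC. Qed.

Lemma horner_pprod a n K r : (pprod a n K).[r] = \prod_(j < K) (1 + a j * r ^+ n j).
Proof.
rewrite horner_prod; apply: eq_bigr => j _.
by rewrite hornerD hornerC hornerM hornerC hornerXn.
Qed.

Lemma pprodC_add a n m K z :
  pprodC a n (m + K) z = pprodC a n m z * pprodC (fun j => a (m + j)%N) (fun j => n (m + j)%N) K z.
Proof. by rewrite /pprodC big_split_ord. Qed.

Section Nonneg.
Variables (a : nat -> R) (n : nat -> nat).
Hypothesis a0 : forall j, 0 <= a j.

Lemma nneg_pprod K : nneg_poly (pprod a n K).
Proof.
elim: K => [|K IH]; first by rewrite /pprod big_ord0; exact: nneg_polyC.
rewrite pprodS; apply: nneg_polyD => //; apply: nneg_polyM => //.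
by apply: nneg_polyM; [exact: nneg_polyC|exact: nneg_polyXn].
Qed.

Lemma nneg_pprodB K L : (L <= K)%N -> nneg_poly (pprod a n K - pprod a n L).
Proof.
move=> /subnK <-; elim: (K - L)%N => [|M IH]; first by rewrite subrr; exact: nneg_polyC.
rewrite addSn pprodS addrAC; apply: nneg_polyD => //; apply: nneg_polyM; last exact: nneg_pprod.
by apply: nneg_polyM; [exact: nneg_polyC|exact: nneg_polyXn].
Qed.

Lemma pprod_ge1 K r : 0 <= r -> 1 <= (pprod a n K).[r].
Proof.
move=> r0; have := nneg_horner_ge0 (nneg_pprodB (leq0n K)) r0.
by rewrite hornerD hornerN {2}/pprod big_ord0 hornerC subr_ge0.
Qed.

Lemma pprod_le K L r : (L <= K)%N -> 0 <= r -> (pprod a n L).[r] <= (pprod a n K).[r].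
Proof.
move=> LK r0; have := nneg_horner_ge0 (nneg_pprodB LK) r0.
by rewrite hornerD hornerN subr_ge0.
Qed.

Lemma normc_pprodC K z : normc (pprodC a n K z) <= (pprod a n K).[normc z].
Proof. by rewrite -evalC_pprod normc_evalC//; exact: nneg_pprod. Qed.

Lemma normc_pprodCB K L z r : (L <= K)%N -> normc z <= r ->
  normc (pprodC a n K z - pprodC a n L z) <= (pprod a n K).[r] - (pprod a n L).[r].
Proof.
move=> LK zr; rewrite -!evalC_pprod !evalCE -hornerN -hornerD -rmorphB -evalCE.
rewrite -hornerN -hornerD (le_trans (normc_evalC _ (nneg_pprodB LK)))//.
by apply: nneg_horner_le (normc_ge0 z) zr; exact: nneg_pprodB.
Qed.

Hypothesis bounded : bounded_pprod a n.

Lemma iprodP z : unit_disc R z -> ccvg (fun K => pprodC a n K z) (iprod a n z).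
Proof.
move=> z1; have [S SP] := bounded (ltac:(by rewrite normc_ge0) : 0 <= normc z < 1).
have [l lP] := ccvg_dominated (fun K L LK => normc_pprodCB LK (lexx (normc z))) SP.
exact: (@xgetPex _ 0 [set l | ccvg (fun K => pprodC a n K z) l]) (ex_intro _ l lP).
Qed.

Lemma normc_iprod_le z S : unit_disc R z -> (forall K, (pprod a n K).[normc z] <= S) ->
  normc (iprod a n z) <= S.
Proof.
move=> z1 SP; apply: (ccvg_norm_le (iprodP z1)) => K.
by rewrite (le_trans (normc_pprodC K z)).
Qed.

(** The Taylor estimate [nneg_taylor] holds for the partial products with a
    constant which does not depend on K, hence it passes to the limit. *)
Lemma analytic_iprod : analytic_disc (iprod a n).
Proof.
move=> z z1; apply/derivable_cdiffP.
pose H := (1 - normc z) / 2; pose r := normc z + H.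
have zlt : normc z < 1 := z1.
have H0 : 0 < H by rewrite divr_gt0// subr_gt0.
have r01 : 0 <= r < 1 by rewrite /r addr_ge0 ?normc_ge0 ?(ltW H0)//= /H; lra.
have [S SP] := bounded r01.
have S0 : 0 <= S by rewrite (le_trans ler01)// (le_trans (pprod_ge1 0 _) (SP 0%N))//; case/andP: r01.
have [d dP] : exists d, ccvg (fun K => devalC (pprod a n K) z) d.
  apply: (@ccvg_dominated _ _ (fun K => (pprod a n K).[r] / H) (S / H)) => [K L LK|K].
    rewrite !devalCE -hornerN -hornerD -derivB -rmorphB -devalCE -mulrBl -hornerN -hornerD.
    by apply: nneg_deriv => //; exact: nneg_pprodB.
  by rewrite ler_pM2r ?invr_gt0.
have bound h : normc h <= H -> normc (iprod a n (z + h) - iprod a n z - d * h) <= (normc h / H) ^+ 2 * S.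
  move=> hH; have zh1 : unit_disc R (z + h).
    rewrite /unit_disc/= (le_lt_trans (normcD _ _))// (le_lt_trans (lerD (lexx _) hH))//.
    by case/andP: r01.
  have cv := ccvgD (ccvgD (iprodP zh1) (ccvgM (-1) (iprodP z1))) (ccvgM (- h) dP).
  have -> : iprod a n (z + h) - iprod a n z - d * h =
     iprod a n (z + h) + -1 * iprod a n z + - h * d.
    by rewrite mulN1r mulNr [d * h]mulrC.
  apply: (ccvg_norm_le cv) => K; rewrite -!evalC_pprod.
  have -> : evalC (pprod a n K) (z + h) + -1 * evalC (pprod a n K) z + - h * devalC (pprod a n K) z =
    evalC (pprod a n K) (z + h) - evalC (pprod a n K) z - devalC (pprod a n K) z * h.
    by rewrite mulN1r mulNr [devalC _ _ * h]mulrC.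
  rewrite (le_trans (nneg_taylor z (nneg_pprod K) H0 hH))// ler_wpM2l ?sqr_ge0//.
have S1 : 0 < S + 1 by rewrite ltr_wpDl.
exists d => e e0; exists (Num.min H (e * H ^+ 2 / (S + 1))) => [|h].
  by rewrite lt_min H0 divr_gt0// mulr_gt0// exprn_gt0.
rewrite lt_min => /andP[/ltW hH hS]; rewrite (le_trans (bound h hH))//.
move: hS; rewrite ltr_pdivlMr// => hS.
rewrite expr_div_n mulrAC ler_pdivrMr ?exprn_gt0// expr2 -!mulrA [e * _]mulrC -mulrA ler_wpM2l ?normc_ge0//.
rewrite [_ * e]mulrC (le_trans _ (ltW hS))// ler_wpM2l ?normc_ge0// lerDl//.
Qed.

Lemma iprod0 : (forall j, (0 < n j)%N) -> iprod a n 0 = 1.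
Proof.
move=> n0; have z1 : unit_disc R 0 by rewrite /unit_disc/= !expr0n/= addr0 sqrtr0.
apply: (ccvg_unique (iprodP z1)).
have -> : (fun K => pprodC a n K 0) = fun=> 1 :> R[i]; last exact: ccvg_cst.
apply/funext => K; rewrite /pprodC big1// => j _.
by rewrite expr0n eqn0Ngt n0 mulr0 addr0.
Qed.

End Nonneg.

Definition tail T (u : nat -> T) m j := u (m + j)%N.

Section Tails.
Variables (a : nat -> R) (n : nat -> nat).
Hypothesis a0 : forall j, 0 <= a j.
Hypothesis bounded : bounded_pprod a n.

Let a0' m j : 0 <= tail a m j. Proof. exact: a0. Qed.

Let pprod_add m K r : (pprod a n (m + K)).[r] = (pprod a n m).[r] * (pprod (tail a m) (tail n m) K).[r].
Proof. by rewrite !horner_pprod big_split_ord. Qed.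

Lemma bounded_tail m : bounded_pprod (tail a m) (tail n m).
Proof.
move=> r r01; have [S SP] := bounded r01; exists S => K.
have r0 : 0 <= r by case/andP: r01.
rewrite (le_trans _ (SP (m + K)%N))// pprod_add ler_peMl ?pprod_ge1//.
by rewrite (le_trans ler01)// pprod_ge1.
Qed.

Lemma iprod_split m z : unit_disc R z ->
  iprod a n z = pprodC a n m z * iprod (tail a m) (tail n m) z.
Proof.
move=> z1; apply: (ccvg_unique (ccvg_shift m (iprodP a0 bounded z1))).
have -> : (fun K => pprodC a n (m + K) z) =
    (fun K => pprodC a n m z * pprodC (tail a m) (tail n m) K z).
  by apply/funext => K; rewrite pprodC_add.
exact: ccvgM (iprodP (a0' m) (@bounded_tail m) z1).
Qed.

(** The tails of a convergent product tend to 1. *)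
Lemma iprod_tail_neq0 z : unit_disc R z -> exists m,
  iprod (tail a m) (tail n m) z != 0.
Proof.
move=> z1; have [S SP] := bounded (ltac:(by rewrite normc_ge0) : 0 <= normc z < 1).
have [l lP] := bounded_monotone_tail (fun K L LK => pprod_le n a0 LK (normc_ge0 z)) SP.
have h2 : 0 < 2^-1 :> R by rewrite invr_gt0.
have [m mP] := lP _ h2; exists m.
have cv := iprodP (a0' m) (@bounded_tail m) z1.
apply/eqP => t0; rewrite t0 in cv.
have : normc (1 : R[i]) <= 2^-1; last by rewrite normc1; lra.
have := ccvgD (ccvg_cst 1) (ccvgM (-1) cv); rewrite mulr0 addr0 => /ccvg_norm_le; apply => K.
rewrite mulN1r normc_distC.
have := normc_pprodCB (tail n m) (a0' m) (leq0n K) (lexx (normc z)).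
rewrite [pprodC _ _ 0 z]/pprodC [pprod _ _ 0]/pprod !big_ord0 hornerC => /le_trans; apply.
have /andP[c1 c2] := mP m (leqnn m); have /andP[_ c3] := mP (m + K)%N (leq_addr _ _).
rewrite pprod_add in c3.
have := pprod_ge1 n a0 m (normc_ge0 z); have := pprod_ge1 (tail n m) (a0' m) K (normc_ge0 z).
by nra.
Qed.

End Tails.
End InfiniteProduct.

(** * Counting zeros *)

Section Cardinals.

Lemma card_uniq_seq (T : choiceType) (s : seq T) : uniq s ->
  ([set x | x \in s] #= `I_(size s))%card.
Proof.
move=> us; have -> : [set x | x \in s] = [set` (seq_fset tt s)].
  by apply/seteqP; split => x xs; [have : x \in seq_fset tt s by rewrite seq_fsetE|rewrite /= -(seq_fsetE tt)].
by apply/card_eq_fsetP; rewrite size_seq_fset undup_id.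
Qed.

Lemma card_disjoint_union (T : choiceType) (A B : set T) m n :
  (A #= `I_m)%card -> (B #= `I_n)%card -> (forall x, A x -> ~ B x) ->
  (A `|` B #= `I_(m + n))%card.
Proof.
have get C k : (C #= `I_k)%card -> exists s : seq T, [/\ uniq s, size s = k & C = [set x | x \in s]].
  move=> Ck; have fC : finite_set C by apply/finite_setP; exists k.
  exists (enum_fset (fset_set C)); split; first exact: fset_uniq.
    exact: card_fset_set.
  by rewrite -[LHS](fset_setK fC).
move=> /get[s [us <- ->]] /get[t [ut <- ->]] dis.
rewrite -size_cat; have -> : [set x | x \in s] `|` [set x | x \in t] = [set x | x \in s ++ t].
  by apply/seteqP; split => x /=; rewrite mem_cat => /orP.
apply: card_uniq_seq; rewrite cat_uniq us ut andbT/=.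
by apply/hasPn => x xt; apply/negP => xs; exact: dis xs xt.
Qed.

Lemma card_inj_image (T U : choiceType) (f : T -> U) (A : set T) n : injective f ->
  (A #= `I_n)%card -> (f @` A #= `I_n)%card.
Proof.
by move=> fi An; apply: card_eq_trans An; apply: inj_card_eq; exact: in2W.
Qed.

Lemma card_seq_union (R : realType) (I J : countType) (z : I -> R[i]) (w : J -> R[i]) a m n :
  ([set k | z k = a] #= `I_m)%card -> ([set k | w k = a] #= `I_n)%card ->
  ([set k | seq_union z w k = a] #= `I_(m + n))%card.
Proof.
move=> zm wn; have -> : [set k | seq_union z w k = a] =
    (@inl I J) @` [set k | z k = a] `|` (@inr I J) @` [set k | w k = a].
  apply/seteqP; split => [[i|j] /= ka|_ [[k /= ka <-]|[k /= ka <-]]//]; [left|right].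
    by exists i.
  by exists j.
apply: card_disjoint_union.
- by apply: card_inj_image zm => x y [].
- by apply: card_inj_image wn => x y [].
- by move=> x [i _ <-] [].
Qed.

Lemma card_nth (T : eqType) (x0 a : T) (s : seq T) :
  ([set j : 'I_(size s) | nth x0 s (nat_of_ord j) = a] #= `I_(count_mem a s))%card.
Proof.
pose t : seq 'I_(size s) := [seq j <- enum 'I_(size s) | nth x0 s (nat_of_ord j) == a].
have -> : [set j : 'I_(size s) | nth x0 s (nat_of_ord j) = a] = [set j | j \in t].
  by apply/seteqP; split => j /=; rewrite mem_filter mem_enum andbT => /eqP.
have -> : count_mem a s = size t; last first.
  by apply: card_uniq_seq; rewrite filter_uniq// enum_uniq.
rewrite size_filter -{1}(mkseq_nth x0 s) /mkseq count_map -val_enum_ord count_map.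
exact: eq_count.
Qed.

End Cardinals.

(** * The zero set of an infinite product *)

Section ProductZeros.
Context {R : realType}.
Implicit Types (z b : R[i]) (k m : nat) (X : set (R[i] -> R[i])).

Lemma prod_sub_split (s : seq R[i]) b z :
  \prod_(x <- s) (z - x) =
  (z - b) ^+ count_mem b s * \prod_(x <- [seq x <- s | x != b]) (z - x).
Proof.
elim: s => [|x s IH]; first by rewrite !big_nil expr0 mul1r.
rewrite big_cons IH/=; have [->|xb] /= := eqVneq x b; first by rewrite exprS mulrA.
by rewrite big_cons mulrCA.
Qed.

Variables (a : nat -> R) (n : nat -> nat).
Hypotheses (a1 : forall k, 1 < a k) (n0 : forall k, (0 < n k)%N).
Hypothesis bounded : bounded_pprod a n.

Let a0 k : 0 <= a k. Proof. by rewrite (le_trans ler01)// ltW. Qed.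

Let factor_roots k : exists s : seq R[i], forall z,
  1 + (a k)%:C * z ^+ n k = (a k)%:C * \prod_(x <- s) (z - x).
Proof.
pose p : {poly R[i]} := 1 + (a k)%:C%:P * 'X^(n k).
have ak : (a k)%:C != 0 :> R[i].
  by rewrite (inj_eq (@complexI R)) gt_eqF// (lt_trans ltr01).
have lp : lead_coef p = (a k)%:C.
  rewrite /p lead_coefDr ?lead_coefM ?lead_coefC ?lead_coefXn ?mulr1//.
  by rewrite size_poly1 mul_polyC size_scale// size_polyXn ltnS n0.
have [s sE] := closed_field_poly_normal p; exists s => z.
have := congr1 (horner ^~ z) sE.
rewrite lp hornerD hornerC hornerM hornerC hornerXn hornerZ horner_prod => ->.
by congr (_ * _); apply: eq_bigr => x _; rewrite hornerXsubC.
Qed.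

Let rs := projT1 (choice factor_roots).
Let rsE k z : 1 + (a k)%:C * z ^+ n k = (a k)%:C * \prod_(x <- rs k) (z - x).
Proof. exact: (projT2 (choice factor_roots)). Qed.

Let ak_neq0 k : (a k)%:C != 0 :> R[i].
Proof. by rewrite (inj_eq (@complexI R)) gt_eqF// (lt_trans ltr01). Qed.

Let root_factor k b : (b \in rs k) = (1 + (a k)%:C * b ^+ n k == 0).
Proof.
rewrite rsE mulf_eq0 (negbTE (ak_neq0 k))/= prodf_seq_eq0.
apply/idP/hasP => [bk|[x xk /=]]; first by exists b; rewrite //= subrr.
by rewrite subr_eq0 => /eqP->.
Qed.

Let flatten_recr m : flatten (mkseq rs m.+1) = flatten (mkseq rs m) ++ rs m.
Proof. by rewrite /mkseq -addn1 iotaD map_cat flatten_cat/= cats0. Qed.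

Let pprodC_roots m z : pprodC a n m z =
  (\prod_(k < m) (a k)%:C) * \prod_(x <- flatten (mkseq rs m)) (z - x).
Proof.
rewrite /pprodC; elim: m => [|m IH]; first by rewrite !big_ord0 big_nil mulr1.
rewrite !big_ord_recr IH rsE flatten_recr big_cat.
by rewrite mulrACA.
Qed.

(** A zero is indexed by a factor which vanishes there and a position in the
    list of the roots of that factor, so that multiplicities are counted. *)
Definition product_zeros (i : {k : nat & 'I_(size (rs k))}) : R[i] :=
  nth 0 (rs (tag i)) (tagged i).

Let card_zeros_below b m :
  ([set i | (tag i < m)%N /\ product_zeros i = b] #= `I_(count_mem b (flatten (mkseq rs m))))%card.
Proof.
elim: m => [|m IH].
  by rewrite (_ : [set _ | _] = set0) ?card_eq00// ?II0//; apply/seteqP; split => // i [].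
rewrite flatten_recr count_cat.
have -> : [set i | (tag i < m.+1)%N /\ product_zeros i = b] =
    [set i | (tag i < m)%N /\ product_zeros i = b] `|`
    (existT (fun k => 'I_(size (rs k))) m) @` [set j : 'I_(size (rs m)) | nth 0 (rs m) j = b].
  apply/seteqP; split => [[k j] /= [km kb]|i [[im ib]|[j /= jb <-]]].
  - move: km; rewrite ltnS leq_eqVlt => /predU1P[km|km]; last by left.
    by right; subst k; exists j.
  - by split => //; rewrite (ltn_trans im).
  - by split => //=.
apply: card_disjoint_union IH _ _; last by move=> i [im _] [j _ ij]; rewrite -ij/= ltnn in im.
apply: card_inj_image; last exact: card_nth.
by move=> x y /eqP; rewrite eq_Tagged => /eqP.
Qed.

(** At a given point some tail of the product does not vanish, so only the
    roots of finitely many factors matter; the roots lie in the disc because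
    the coefficients exceed 1. *)
Lemma zero_set_iprod X : X (iprod a n) -> zero_set X product_zeros.
Proof.
move=> Xf; split.
  move=> [k j]; have : nth 0 (rs k) j \in rs k by exact: mem_nth.
  rewrite root_factor addrC addr_eq0 => /eqP/(congr1 (@normc R)).
  rewrite normcN normc1 normcM normcX normcR ger0_norm// => E.
  rewrite /unit_disc/product_zeros/= -/(normc _) ltNge; apply/negP => z1.
  have := a1 k; rewrite ltNge => /negP; apply.
  by rewrite -E ler_peMr// exprn_ege1.
exists (iprod a n) => // b b1.
have [m tm] := iprod_tail_neq0 a0 bounded b1.
exists (count_mem b (flatten (mkseq rs m))).
  exists (fun z => ((\prod_(k < m) (a k)%:C) *
     \prod_(x <- [seq x <- flatten (mkseq rs m) | x != b]) (z - x)) * iprod (tail a m) (tail n m) z).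
  have tb := @bounded_tail _ a n a0 bounded m.
  split.
  - apply: (@analyticM _ (fun z => (\prod_(k < m) (a k)%:C) *
       \prod_(x <- [seq x <- flatten (mkseq rs m) | x != b]) (z - x))); last first.
      by apply: analytic_iprod => // j; exact: a0.
    apply: (@analyticM _ (fun=> \prod_(k < m) (a k)%:C)); first exact: analytic_cst.
    apply: (@analytic_prod _ _ _ (fun x z => z - x)) => x.
    exact: (@analyticD _ (fun z => z) (fun=> - x) analytic_id (@analytic_cst _ (- x))).
  - rewrite !mulf_neq0//.
      by apply/prodf_neq0 => k _; exact: ak_neq0.
    rewrite prodf_seq_neq0; apply/allP => x; rewrite mem_filter => /andP[xb _] /=.
    by rewrite subr_eq0 eq_sym.
  - move=> z z1; rewrite (iprod_split a0 bounded m z1) pprodC_roots (prod_sub_split _ b).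
    by rewrite !mulrA; congr (_ * _ * _); rewrite mulrC.
have -> : [set i | product_zeros i = b] = [set i | (tag i < m)%N /\ product_zeros i = b].
  apply/seteqP; split => [i /= ib|i []//]; split => //; rewrite ltnNge; apply/negP => mi.
  have bi : b \in rs (tag i) by rewrite -ib; exact: mem_nth.
  have tb := @bounded_tail _ a n a0 bounded m.
  have a0' j : 0 <= tail a m j by exact: a0.
  have F : 1 + (tail a m (tag i - m))%:C * b ^+ tail n m (tag i - m) = 0.
    by apply/eqP; rewrite /tail (subnKC mi) -root_factor.
  by move: tm; rewrite (iprod_split a0' tb (tag i - m).+1 b1) /pprodC big_ord_recr/= F mulr0 mul0r eqxx.
exact: card_zeros_below.
Qed.

End ProductZeros.

(** * Dyadic masses and moments *)

Section DyadicMasses.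
Context {R : realType}.
Local Notation plane := (measurableTypeR R * measurableTypeR R)%type.
Implicit Types (phi psi : R -> R) (r s x p : R).

Lemma sum_half_le K : \sum_(k < K) (2^-1 : R) ^+ k <= 2.
Proof.
have -> : \sum_(l < K) (2^-1 : R) ^+ l = 2 - 2 * 2^-1 ^+ K.
  by elim: K => [|K IH]; rewrite ?big_ord0 ?expr0 ?mulr1 ?subrr// big_ord_recr/= IH exprS; lra.
by rewrite lerBlDr lerDl mulr_ge0 ?exprn_ge0.
Qed.

Lemma sum_half_tail_le K : \sum_(k < K) (2^-1 : R) ^+ k.+2 <= 2^-1.
Proof.
under eq_bigr => k _ do rewrite !exprS mulrA.
by rewrite -mulr_sumr; have := sum_half_le K; lra.
Qed.

(** The radius whose distance to the unit circle is 2^-m. *)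
Definition dyadic_radius m : R := 1 - 2^-1 ^+ m.
Local Notation rho := dyadic_radius.

Lemma dyadic_radius_itv m : 0 <= rho m < 1.
Proof.
have h0 : 0 < 2^-1 :> R by lra.
by rewrite /rho subr_ge0 exprn_ile1 ?ltW ?ltrBlDr ?ltrDl ?exprn_gt0//=; lra.
Qed.

Lemma dyadic_radiusS m : (1 + rho m) / 2 = rho m.+1.
Proof. by rewrite /rho exprS; lra. Qed.

Lemma dyadic_radius_le m k : (m <= k)%N -> rho m <= rho k.
Proof.
move=> mk; rewrite /rho lerD2l lerN2 ler_wiXn2l//; lra.
Qed.

Lemma dyadic_radius_cvg r : r < 1 -> exists m, r < rho m.
Proof.
move=> r1; have r1' : 0 < 1 - r by rewrite subr_gt0.
have : (2^-1 : R) ^+ n @[n --> \oo] --> 0 by apply: cvg_expr; rewrite ger0_norm; lra.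
move/cvgr0Pnorm_lt => /(_ _ r1')[m _ /(_ m (leqnn m))] /=.
by move=> /ltr_normlP[_ h]; exists m; rewrite /rho; lra.
Qed.

Lemma measurable_ge_indic r :
  measurable_fun setT ((fun x => (r <= x)%R%:R) : measurableTypeR R -> measurableTypeR R).
Proof.
have -> : (fun x => (r <= x)%R%:R) = \1_(`[r, +oo[%classic) :> (R -> R).
  by apply/funext => x; rewrite indicE; congr (_%:R); rewrite mem_setE/= in_itv/= andbT.
by apply: measurable_indic; exact: measurable_itv.
Qed.

Variable v : R -> R.
Hypothesis mv : measurable_fun setT (v : measurableTypeR R -> measurableTypeR R).
Hypothesis v0 : forall x, 0 <= v x.

Definition radint phi : \bar R :=
  (\int[area R]_(p in plane_disc R) (phi (normc (of_plane p)) * v (normc (of_plane p)))%:E)%E.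

Let mdisc : measurable (plane_disc R) := @measurable_plane_disc R.

Let mphi phi : measurable_fun setT (phi : measurableTypeR R -> measurableTypeR R) ->
  measurable_fun (plane_disc R)
    (fun p : plane => (phi (normc (of_plane p)) * v (normc (of_plane p)))%:E).
Proof.
move=> mf; apply/measurable_EFinP; apply: measurable_funM.
  exact: measurable_funTS (measurableT_comp mf measurable_normc).
exact: measurable_funTS (measurableT_comp mv measurable_normc).
Qed.

Lemma le_radint phi psi : (forall x, 0 <= x < 1 -> 0 <= phi x <= psi x) ->
  (radint phi <= radint psi)%E.
Proof.
move=> le; apply: ge0_le_integral_any => p p1; rewrite lee_fin;
  have /andP[f0 fp] := le (normc (of_plane p)) (introT andP (conj (normc_ge0 _) p1)).
  by rewrite mulr_ge0.
by rewrite ler_wpM2r.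
Qed.

Lemma radint_sum n (c : nat -> R) (phi : nat -> R -> R) : (forall l, 0 <= c l) ->
  (forall l, measurable_fun setT (phi l : measurableTypeR R -> measurableTypeR R)) ->
  (forall l x, 0 <= phi l x) ->
  (radint (fun x => (\sum_(l < n) c l * phi l x)%R) = \sum_(l < n) (c l)%:E * radint (phi l))%E.
Proof.
move=> c0 mf f0.
pose F (l : 'I_n) (p : plane) : \bar R :=
  ((c l)%:E * (phi l (normc (of_plane p)) * v (normc (of_plane p)))%:E)%E.
have -> : (\sum_(l < n) (c l)%:E * radint (phi l) =
    \sum_(l < n) \int[area R]_(p in plane_disc R) F l p)%E.
  apply: eq_bigr => l _; rewrite (ge0_integralZl _ mdisc (mphi (mf l))) ?lee_fin//.
  by move=> x _; rewrite lee_fin mulr_ge0.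
rewrite -(ge0_integral_sum _ mdisc).
- apply: eq_integral => p _; rewrite mulr_suml -sumEFin.
  by apply: eq_bigr => l _; rewrite /F -EFinM mulrA.
- by move=> l; apply: measurable_funeM; exact: mphi.
- by move=> l p _; rewrite /F -EFinM lee_fin !mulr_ge0.
Qed.

Lemma mass_radint r : 0 <= r -> mass v r = radint (fun x => (r <= x)%R%:R).
Proof.
move=> r0; rewrite /mass /radint integral_mkcond [RHS]integral_mkcond.
apply: eq_integral => p _; rewrite /patch.
have [rp|rp] := leP r (normc (of_plane p)); last first.
  rewrite mul0r memNset; first by case: ifP.
  by rewrite /annulus /= leNgt rp.
rewrite mul1r; suff -> : (p \in annulus r) = (p \in plane_disc R) by [].
apply/idP/idP => /set_mem h; apply/mem_set; first by case/andP: h.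
by apply/andP; split.
Qed.

Lemma le_mass r s : 0 <= r -> r <= s -> (mass v s <= mass v r)%E.
Proof.
move=> r0 rs; rewrite !mass_radint ?(le_trans r0)//; apply: le_radint => x _.
by rewrite ler0n ler_nat; case: (leP s x) => // sx; rewrite (le_trans rs sx).
Qed.

Lemma mass_ge0 r : (0 <= mass v r)%E.
Proof. by apply: integral_ge0 => p _; rewrite lee_fin. Qed.

Hypothesis mass_pos : (0 < mass v 0 < +oo)%E.
Variable C : R.
Hypothesis C0 : 0 < C.
Hypothesis doubling : forall r, 0 <= r < 1 -> (mass v r <= C%:E * mass v ((1 + r) / 2)%R)%E.

Definition dyadic_mass m : R := fine (mass v (rho m)).
Local Notation W := dyadic_mass.

Lemma mass_fin r : 0 <= r -> mass v r \is a fin_num.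
Proof.
move=> r0; rewrite ge0_fin_numE ?mass_ge0//; case/andP: mass_pos => _.
by apply: le_lt_trans; exact: le_mass.
Qed.

Lemma dyadic_massE m : mass v (rho m) = (W m)%:E.
Proof. by rewrite /W fineK// mass_fin//; case/andP: (dyadic_radius_itv m). Qed.

Lemma le_dyadic_mass m k : (m <= k)%N -> W k <= W m.
Proof.
move=> mk; rewrite -lee_fin -!dyadic_massE le_mass ?dyadic_radius_le//.
by case/andP: (dyadic_radius_itv m).
Qed.

Lemma dyadic_mass_doubling m : W m <= C * W m.+1.
Proof.
have := doubling (dyadic_radius_itv m).
by rewrite dyadic_radiusS !dyadic_massE -EFinM lee_fin.
Qed.

Lemma dyadic_mass_doubling_iter N l : (l <= N)%N -> W (N - l) <= C ^+ l * W N.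
Proof.
elim: l => [|l IH] lN; first by rewrite subn0 expr0 mul1r.
rewrite (le_trans (dyadic_mass_doubling _))// exprS -mulrA ler_wpM2l ?(ltW C0)//.
by rewrite -subSn// subSS IH// ltnW.
Qed.

Lemma dyadic_mass_gt0 m : 0 < W m.
Proof.
have := dyadic_mass_doubling_iter (leqnn m); rewrite subnn => h.
have : 0 < W 0.
  have r0 : rho 0 = 0 by rewrite /rho expr0 subrr.
  by rewrite -lte_fin -dyadic_massE r0; case/andP: mass_pos.
move=> /lt_le_trans/(_ h).
by rewrite pmulr_rgt0// exprn_gt0.
Qed.

Lemma mass_gt0 r : 0 <= r < 1 -> (0 < mass v r)%E.
Proof.
move=> /andP[r0 /dyadic_radius_cvg[m rm]].
have : (0 < mass v (rho m))%E by rewrite dyadic_massE lte_fin dyadic_mass_gt0.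
by move=> /lt_le_trans; apply; rewrite le_mass// ltW.
Qed.

(** The annuli shrink to the empty set and the total mass is finite. *)
Lemma dyadic_mass_cvg0 e : 0 < e -> exists m, W m <= e.
Proof.
move=> e0.
have ig : (area R).-integrable (plane_disc R) (fun p : plane => (v (normc (of_plane p)))%:E).
  apply/integrableP; split; first exact: measurable_funTS (measurable_radial mv).
  under eq_integral => p _ do rewrite abse_EFin ger0_norm//.
  by case/andP: mass_pos => _; rewrite /mass annulus0.
pose F m (p : plane) := ((rho m <= normc (of_plane p))%R%:R * v (normc (of_plane p)))%:E.
have mF m : measurable_fun (plane_disc R) (F m) by exact: (mphi (measurable_ge_indic (rho m))).
have := @dominated_cvg _ _ _ (area R) _ mdisc F (cst 0%E) (fun p : plane => (v (normc (of_plane p)))%:E) mF.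
have cF (p : plane) : plane_disc R p -> F m p @[m --> \oo] --> cst 0%E p.
    move=> p1; have [m rm] := dyadic_radius_cvg p1.
    apply: cvg_near_cst; exists m => // k /= mk; rewrite /F.
    by rewrite leNgt (lt_le_trans rm)// ?dyadic_radius_le// mul0r.
have dF m (p : plane) : plane_disc R p -> (`|F m p| <= (v (normc (of_plane p)))%:E)%E.
    move=> _; rewrite /F abse_EFin lee_fin ger0_norm ?mulr_ge0//.
    by rewrite ler_piMl// lern1; case: (_ <= _).
move=> /(_ cF (fun (p : plane) _ => isT) ig dF); rewrite integral0.
have -> : (fun m => (\int[area R]_(p in plane_disc R) F m p)%E) = (fun m => (W m)%:E).
  by apply/funext => m; rewrite -dyadic_massE mass_radint//; case/andP: (dyadic_radius_itv m).
move=> /fine_cvgP[_] /cvgr0Pnorm_lt/(_ _ e0)[m _ /(_ m (leqnn m))] /= h.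
by exists m; rewrite (le_trans (ler_norm _))// ltW.
Qed.

(** A double exponential beats any exponential. *)
Lemma expR_decay p : 0 < p -> exists2 K : R, 0 < K &
  forall l, expR (- (p * 2 ^+ l)) * C ^+ l <= K * 2^-1 ^+ l.
Proof.
move=> p0; have C20 : 0 <= 2 * C by rewrite mulr_ge0// ltW.
have [M CM] : exists M, 2 * C <= 2 ^+ M.+1.
  exists (Num.bound (2 * C)); rewrite (le_trans (ltW (archi_boundP C20)))//.
  by rewrite -natrX ler_nat ltnW// (ltn_trans (ltnSn _))// ltn_expl.
pose K := (M.+1)`!%:R / p ^+ M.+1.
have K0 : 0 < K by rewrite divr_gt0 ?exprn_gt0// ltr0n fact_gt0.
exists K => // l; rewrite exprVn ler_pdivlMr ?exprn_gt0// -mulrA -exprMn [C * 2]mulrC.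
rewrite expRN -ler_pdivlMl ?invr_gt0 ?expR_gt0// invrK.
have := @expR_ge1Dxn R (p * 2 ^+ l) M; rewrite mulr_ge0 ?exprn_ge0 ?(ltW p0)// => /(_ isT) h.
have CMl : (2 * C) ^+ l <= (2 ^+ l) ^+ M.+1.
  by rewrite -exprM mulnC exprM lerXn2r ?nnegrE ?exprn_ge0.
rewrite (le_trans CMl)// -ler_pdivrMr//.
rewrite (le_trans _ h)// exprMn /K invf_div.
rewrite -[leLHS]addr0 addrC lerD//.
by rewrite mulrCA mulrA.
Qed.

Lemma dyadic_power_decay x N l : (l < N)%N -> 0 <= x -> x < rho (N - l) ->
  x ^+ (2 ^ N) <= expR (- 2 ^+ l).
Proof.
move=> lN x0 xr.
have -> : - 2 ^+ l = - 2^-1 ^+ (N - l) *+ (2 ^ N) :> R.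
  rewrite mulNrn; congr (- _); rewrite -[_ *+ (2 ^ N)]mulr_natl natrX exprVn -{1}(subnK (ltnW lN)) exprD.
  by rewrite mulrAC divff ?mul1r// expf_neq0.
rewrite -[_ *+ (2 ^ N)]mulr_natr expRM_natr lerXn2r ?nnegrE ?expR_ge0//.
rewrite (le_trans (ltW xr))//; exact: expR_ge1Dx.
Qed.

Let weightc p l : R := if l is l'.+1 then expR (- (p * 2 ^+ l')) else 1.

(** Let l be least such that the radius of index N - l is at most x. Unless
    l = 0, the distance from x to 1 exceeds 2^(l - 1) / 2^N, so the power at x is
    at most the l-th weight. *)
Lemma power_le_steps p x N : 0 < p -> 0 <= x < 1 ->
  (x ^+ (2 ^ N)) `^ p <= \sum_(l < N.+1) weightc p l * (rho (N - l) <= x)%R%:R.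
Proof.
move=> p0 /andP[x0 x1].
have x2 l : 0 <= weightc p l * (rho (N - l) <= x)%R%:R.
  by rewrite mulr_ge0//; case: l => [|l]//=; rewrite expR_ge0.
have ex : exists l, (l <= N)%N && (rho (N - l) <= x).
  by exists N; rewrite leqnn subnn /rho expr0 subrr.
case: (ex_minnP ex) => l /andP[lN rl] lmin.
have lN' : (l < N.+1)%N by rewrite ltnS.
rewrite (bigD1 (Ordinal lN'))//=.
rewrite rl mulr1 -[leLHS]addr0 lerD ?sumr_ge0//.
case: l lN rl lmin {lN'} => [|l] lN rl lmin /=.
  have p1 : 1 `^ p = 1 by rewrite powR1.
  by rewrite -[leRHS]p1 ge0_ler_powR ?nnegrE ?exprn_ge0 ?(ltW p0)// exprn_ile1// ltW.
rewrite (_ : - (p * 2 ^+ l) = (- 2 ^+ l) * p) ?expRM; last by rewrite mulNr mulrC.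
rewrite ge0_ler_powR ?nnegrE ?exprn_ge0 ?expR_ge0 ?(ltW p0)//.
apply: dyadic_power_decay => //; rewrite ltNge; apply/negP => h.
by have := lmin l; rewrite h ltnW// => /(_ isT); rewrite ltnn.
Qed.

(** The moments of the weight are dominated by its dyadic masses: x^n is
    super-exponentially small in l once x is further than 2^l/n from 1,
    whereas doubling lets the masses grow only exponentially in l. *)
Lemma dyadic_moment p : 0 < p -> exists2 K : R, 0 < K & forall N,
  (radint (fun x => ((x ^+ (2 ^ N)) `^ p)%R) <= (K * W N)%:E)%E.
Proof.
move=> p0; have [K K0 KP] := expR_decay p0; exists (1 + C * (K * 2)).
  by rewrite addr_gt0// !mulr_gt0.
have wc0 l : 0 <= weightc p l by case: l => [|l] //=; exact: expR_ge0.
move=> N; apply: (@le_trans _ _ (radint (fun x =>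
    (\sum_(l < N.+1) weightc p l * (rho (N - l) <= x)%R%:R)%R))).
  by apply: le_radint => x x01; rewrite powR_ge0/= power_le_steps.
rewrite (@radint_sum N.+1 (weightc p) (fun l x => (rho (N - l) <= x)%R%:R))//; last first.
  by move=> l; exact: measurable_ge_indic.
under eq_bigr => l _.
  rewrite -mass_radint; last by case/andP: (dyadic_radius_itv (N - l)).
  rewrite dyadic_massE -EFinM; over.
rewrite sumEFin lee_fin.
rewrite big_ord_recl/= subn0 mul1r mulrDl mul1r lerD2l.
have le l : (l < N)%N -> expR (- (p * 2 ^+ l)) * W (N - l.+1) <= C * (K * 2^-1 ^+ l) * W N.
  move=> lN; rewrite (le_trans (ler_wpM2l (expR_ge0 _) (dyadic_mass_doubling_iter lN)))//.
  have := ler_wpM2r (ltW (dyadic_mass_gt0 N)) (ler_wpM2l (ltW C0) (KP l)).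
  by rewrite exprS !mulrA [C * expR _]mulrC.
rewrite (@le_trans _ _ (\sum_(l < N) C * (K * 2^-1 ^+ l) * W N))//.
  by apply: ler_sum => l _; rewrite add0n /bump add1n; exact: le.
rewrite -mulr_suml ler_wpM2r ?(ltW (dyadic_mass_gt0 N))// -mulr_sumr ler_wpM2l ?(ltW C0)//.
rewrite -mulr_sumr ler_wpM2l ?(ltW K0)//.
exact: sum_half_le.
Qed.

End DyadicMasses.

(** * The mean value inequality on annuli *)

Section SubharmonicMean.
Context {R : realType}.
Local Notation plane := (measurableTypeR R * measurableTypeR R)%type.
Implicit Types (h : R[i] -> R[i]) (r s d : R) (p : plane).

Lemma le_limn_einf (c : R) (u : nat -> R) :
  (forall d, 0 < d -> exists N0, forall N, (N0 <= N)%N -> c <= u N + d) ->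
  (c%:E <= limn_einf (fun N => (u N)%:E))%E.
Proof.
move=> cu; apply/lee_addgt0Pr => d d0; have [N0 cN] := cu d d0.
rewrite -leeBlDr// limn_einf_lim; apply: lime_ge; first exact: is_cvg_einfs.
exists N0 => // N /= N0N; apply: le_ereal_inf_tmp => _ [k /= Nk <-].
by rewrite -EFinB lee_fin lerBlDr -lee_fin EFinD -EFinD lee_fin cN// (leq_trans N0N).
Qed.

Variable v : R -> R.
Hypothesis mv : measurable_fun setT (v : measurableTypeR R -> measurableTypeR R).
Hypothesis v0 : forall x, 0 <= v x.

Let mdisc : measurable (plane_disc R) := @measurable_plane_disc R.

Let on_annulus r p : R := (r <= normc (of_plane p))%R%:R * v (normc (of_plane p)).

Let on_annulus_ge0 r p : 0 <= on_annulus r p.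
Proof. by rewrite mulr_ge0. Qed.

Let measurable_on_annulus r : measurable_fun (plane_disc R) (on_annulus r : plane -> measurableTypeR R).
Proof.
apply: measurable_funM.
  exact: measurable_funTS (measurableT_comp (measurable_ge_indic r) measurable_normc).
exact: measurable_funTS (measurableT_comp mv measurable_normc).
Qed.

Let measurable_normc_powR h s : analytic_disc h ->
  measurable_fun (plane_disc R) ((fun p => normc (h (of_plane p)) `^ s) : plane -> measurableTypeR R).
Proof.
move=> ha; exact: measurableT_comp (measurable_powR s) (measurable_analytic ha).
Qed.

Let measurable_weighted h s r : analytic_disc h ->
  measurable_fun (plane_disc R) (fun p => (normc (h (of_plane p)) `^ s * on_annulus r p)%:E).
Proof.
move=> ha; apply/measurable_EFinP; apply: measurable_funM.
  exact: measurable_normc_powR.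
exact: measurable_on_annulus.
Qed.

Let integral_annulusE r (F : plane -> R) :
  (\int[area R]_(p in annulus r) (F p * v (normc (of_plane p)))%:E =
   \int[area R]_(p in plane_disc R) (F p * on_annulus r p)%:E)%E.
Proof.
rewrite integral_mkcond [RHS]integral_mkcond; apply: eq_integral => p _.
rewrite /patch /on_annulus.
have [rp|rp] := leP r (normc (of_plane p)); last first.
  rewrite mul0r mulr0 memNset; first by case: ifP.
  by rewrite /annulus /= leNgt rp.
rewrite mul1r; suff -> : (p \in annulus r) = (p \in plane_disc R) by [].
apply/idP/idP => /set_mem h; apply/mem_set; first by case/andP: h.
by apply/andP; split.
Qed.

Section Mean.
Variables (h : R[i] -> R[i]) (s r : R).
Hypotheses (ha : analytic_disc h) (s0 : 0 < s) (r0 : 0 <= r).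

Let I := (\int[area R]_(p in plane_disc R) (normc (h (of_plane p)) `^ s * on_annulus r p)%:E)%E.

Let rotated u p : \bar R := (normc (h (u * of_plane p)) `^ s * on_annulus r p)%:E.

Let integral_rotated u : normc u = 1 ->
  (\int[area R]_(p in plane_disc R) rotated u p = I)%E.
Proof.
move=> u1; rewrite /I -[RHS](integral_disc_rot u1); first last.
- by move=> p _; rewrite lee_fin mulr_ge0 ?powR_ge0.
- exact: measurable_weighted.
apply: eq_integral => p _; rewrite /rotated of_plane_rot /on_annulus of_plane_rot.
by rewrite normcM u1 mul1r.
Qed.

Let mean N p : R := N.+1%:R^-1 *
  (\sum_(j < N.+1) normc (h (of_plane p * cis (j%:R * (2 * pi / N.+1%:R)))) `^ s) * on_annulus r p.

Let meanE N p : (mean N p)%:E =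
  (N.+1%:R^-1%:E * \sum_(j < N.+1) rotated (cis (j%:R * (2 * pi / N.+1%:R))) p)%E.
Proof.
rewrite /mean -mulrA EFinM mulr_suml sumEFin; congr (_ * _%:E)%E.
by apply: eq_bigr => j _; rewrite mulrC mulrC [of_plane p * _]mulrC.
Qed.

Let measurable_rotated u : normc u = 1 -> measurable_fun (plane_disc R) (rotated u).
Proof.
by move=> u1; apply: (@measurable_weighted (fun z => h (u * z))); apply: analytic_scale; rewrite ?u1.
Qed.

Let measurable_mean N : measurable_fun (plane_disc R) (fun p => (mean N p)%:E).
Proof.
under eq_fun => p do rewrite meanE.
apply: measurable_funeM; apply: emeasurable_sum => j; apply: measurable_rotated.
exact: normc_cis.
Qed.

Let integral_mean N : (\int[area R]_(p in plane_disc R) (mean N p)%:E = I)%E.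
Proof.
under eq_integral => p _ do rewrite meanE.
have r0' u p : plane_disc R p -> (0 <= rotated u p)%E.
  by move=> _; rewrite lee_fin mulr_ge0 ?powR_ge0.
have mr u : normc u = 1 -> measurable_fun (plane_disc R) (rotated u) by exact: measurable_rotated.
have mS : measurable_fun (plane_disc R)
    (fun p => (\sum_(j < N.+1) rotated (cis (j%:R * (2 * pi / N.+1%:R))) p)%E).
  by apply: emeasurable_sum => j; apply: mr; exact: normc_cis.
have S0 p : plane_disc R p ->
    (0 <= \sum_(j < N.+1) rotated (cis (j%:R * (2 * pi / N.+1%:R))) p)%E.
  by move=> p1; apply: sume_ge0 => j _; exact: r0'.
rewrite (ge0_integralZl (area R) mdisc mS S0) ?lee_fin ?invr_ge0//.
rewrite (@ge0_integral_sum _ _ _ (area R) _ mdisc 'I_N.+1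
  (fun j p => rotated (cis (j%:R * (2 * pi / N.+1%:R))) p)).
- under eq_bigr => j _ do rewrite integral_rotated ?normc_cis//.
  have sumI m : (\sum_(j < m) I = m%:R%:E * I)%E.
    elim: m => [|m IH]; first by rewrite big_ord0 mul0e.
    by rewrite big_ord_recr/= IH -natr1 EFinD ge0_muleDl ?lee_fin// mul1e.
  rewrite sumI muleA -EFinM mulVf ?mul1e//.
- by move=> j; apply: mr; exact: normc_cis.
- by move=> j p; exact: r0'.
Qed.

(** The mean value inequality for |h|^s against a rotation invariant weight:
    averaging the integrand over the rotations by the N-th roots of unity
    leaves the integral unchanged, and in the limit the averages dominate
    |h(0)|^s pointwise, so the inequality follows from the lemma of Fatou. *)
Lemma annulus_mean_ge : ((normc (h 0) `^ s)%:E * mass v r <=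
  \int[area R]_(p in annulus r) (normc (h (of_plane p)) `^ s * v (normc (of_plane p)))%:E)%E.
Proof.
rewrite integral_annulusE -/I.
have -> : ((normc (h 0) `^ s)%:E * mass v r =
    \int[area R]_(p in plane_disc R) (normc (h 0) `^ s * on_annulus r p)%:E)%E.
  rewrite mass_radint// /radint -ge0_integralZl ?lee_fin ?powR_ge0//.
  - by apply/measurable_EFinP; exact: measurable_on_annulus.
  - by move=> p _; rewrite lee_fin mulr_ge0.
have le p : plane_disc R p -> ((normc (h 0) `^ s * on_annulus r p)%:E <=
    limn_einf (fun N => (mean N p)%:E))%E.
  move=> p1; apply: le_limn_einf => d d0; set m := on_annulus r p.
  have m0 : 0 <= m by exact: on_annulus_ge0.
  have d1 : 0 < d / (1 + m) by rewrite divr_gt0// ltr_pwDl.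
  have [N0 NP] := rotation_mean_ge s0 ha p1 d1.
  exists N0 => N NN; rewrite (le_trans (ler_wpM2r m0 (NP N NN)))// mulrDl lerD2l.
  by rewrite -mulrA ler_piMr ?(ltW d0)// ler_pdivrMl ?ltr_pwDl// mulr1 lerDr.
apply: (@le_trans _ _ (\int[area R]_(p in plane_disc R) limn_einf (fun N => (mean N p)%:E))%E).
  by apply: ge0_le_integral_any => p p1; [rewrite lee_fin mulr_ge0 ?powR_ge0|exact: le].
apply: (le_trans (fatou (area R) mdisc measurable_mean _)).
  move=> N p _; rewrite lee_fin !mulr_ge0// sumr_ge0// => j _; exact: powR_ge0.
under [X in limn_einf X]eq_fun => N do rewrite integral_mean.
by have [-> _] := cvg_limn_einf_sup (cvg_cst I : (fun=> I) @ \oo --> I).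
Qed.

End Mean.
End SubharmonicMean.

(** * Moments of lacunary products *)

Section LacunaryProduct.
Context {R : realType}.
Local Notation plane := (measurableTypeR R * measurableTypeR R)%type.
Implicit Types (x r p q : R) (k K : nat).

(** A sum which beats the geometric series must have a term which beats the
    corresponding term of that series. *)
Lemma powR_sum_le (x : nat -> R) p K : 0 < p -> (forall k, 0 <= x k) ->
  (1 + \sum_(k < K) x k) `^ p <= 2 `^ p + \sum_(k < K) (2 ^+ k.+2 * x k) `^ p.
Proof.
move=> p0 x0; set S := (X in _ <= X).
have t0 (k : 'I_K) : 0 <= (2 ^+ k.+2 * x k) `^ p by exact: powR_ge0.
have S0 : 0 <= S by rewrite addr_ge0 ?powR_ge0 ?sumr_ge0.
rewrite -powR_le_root ?addr_ge0 ?sumr_ge0//.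
have y2 : 2 <= S `^ p^-1 by rewrite powR_le_root// lerDl sumr_ge0.
set y := S `^ p^-1 in y2 *.
have xy (k : 'I_K) : x k <= y * 2^-1 ^+ k.+2.
  rewrite exprVn ler_pdivlMr ?exprn_gt0// mulrC.
  have l0 : 0 <= 2 ^+ k.+2 * x k by rewrite mulr_ge0 ?exprn_ge0.
  rewrite /y (powR_le_root l0 S0 p0) /S (bigD1 k)//= addrCA lerDl.
  by rewrite addr_ge0 ?powR_ge0 ?sumr_ge0// => i _; exact: powR_ge0.
have geo : \sum_(k < K) y * 2^-1 ^+ k.+2 <= y / 2.
  rewrite -mulr_sumr ler_wpM2l//; first by rewrite (le_trans _ y2).
  exact: sum_half_tail_le.
have : \sum_(k < K) x k <= \sum_(k < K) y * 2^-1 ^+ k.+2 by apply: ler_sum => k _; exact: xy.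
move: geo y2; clear; set A := \sum_(k < K) _; set B := \sum_(k < K) _; lra.
Qed.

Variables (a : nat -> R) (e : nat -> nat).
Hypothesis a0 : forall k, 0 <= a k.
Let n k := (2 ^ e k)%N.

(** As the factors of index j < k are at most 1 + a_j, the factor of index k
    contributes at most b_k x^n_k to the growth of the product. *)
Let b k : R := a k * \prod_(j < k) (1 + a j).

Let b0 k : 0 <= b k.
Proof. by rewrite mulr_ge0// prodr_ge0// => j _; rewrite addr_ge0. Qed.

Lemma pprod_le_sum K x : 0 <= x <= 1 -> (pprod a n K).[x] <= 1 + \sum_(k < K) b k * x ^+ n k.
Proof.
move=> /andP[x0 x1]; elim: K => [|K IH].
  by rewrite horner_pprod !big_ord0 addr0.
rewrite horner_pprod big_ord_recr/= -horner_pprod mulrDr mulr1 big_ord_recr/= addrA lerD//.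
rewrite mulrA ler_wpM2r ?exprn_ge0// /b mulrC ler_wpM2l// horner_pprod.
apply: ler_prod => j _; rewrite addr_ge0 ?mulr_ge0 ?exprn_ge0//= lerD2l.
by rewrite ler_piMr// exprn_ile1.
Qed.

Variable v : R -> R.
Hypothesis mv : measurable_fun setT (v : measurableTypeR R -> measurableTypeR R).
Hypothesis v0 : forall x, 0 <= v x.
Hypothesis mass_pos : (0 < mass v 0 < +oo)%E.
Variable C : R.
Hypothesis C0 : 0 < C.
Hypothesis doubling : forall r, 0 <= r < 1 -> (mass v r <= C%:E * mass v ((1 + r) / 2)%R)%E.

(** The condition under which the terms of [pprod_le_sum] have summable
    p-th moments, in view of [powR_sum_le]. *)
Definition summable_terms p := exists B, forall k,
  (2 ^+ k.+2 * (a k * \prod_(j < k) (1 + a j))) `^ p * dyadic_mass v (e k) <= B * 2^-1 ^+ k.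

Let measurable_power p m :
  measurable_fun setT ((fun x => (x ^+ m) `^ p) : measurableTypeR R -> measurableTypeR R).
Proof. exact: measurableT_comp (measurable_powR p) (exprn_measurable m). Qed.

Let term_moment p : 0 < p -> summable_terms p -> exists2 B, 0 <= B & forall k,
  (((2 ^+ k.+2 * b k) `^ p)%:E * radint v (fun x => ((x ^+ n k) `^ p)%R) <= (B * 2^-1 ^+ k)%:E)%E.
Proof.
move=> p0 [B BP]; have [K K0 KP] := dyadic_moment mv v0 mass_pos C0 doubling p0.
have B0 : 0 <= B.
  have := BP 0%N; rewrite expr0 mulr1; apply: le_trans.
  by rewrite mulr_ge0 ?powR_ge0// ltW// (dyadic_mass_gt0 v0 mass_pos C0 doubling).
exists (K * B) => [|k]; first by rewrite mulr_ge0// ltW.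
apply: (le_trans (lee_wpmul2l _ (KP (e k)))); first by rewrite lee_fin powR_ge0.
by rewrite -EFinM lee_fin mulrCA -[leRHS]mulrA ler_wpM2l ?(ltW K0)//; exact: BP.
Qed.

Lemma radintZ c (phi : R -> R) : 0 <= c ->
  measurable_fun setT (phi : measurableTypeR R -> measurableTypeR R) -> (forall x, 0 <= phi x) ->
  (radint v (fun x => (c * phi x)%R) = c%:E * radint v phi)%E.
Proof.
move=> c0 mf f0.
have := radint_sum mv v0 1 (fun _ : nat => c0) (fun=> mf) (fun=> f0).
by rewrite big_ord1 => <-; congr radint; apply/funext => x; rewrite big_ord1.
Qed.

(** A point value of an increasing function is controlled by its integral
    beyond that point. *)
Lemma summable_terms_bounded p : 0 < p -> summable_terms p -> bounded_pprod a n.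
Proof.
move=> p0 /(term_moment p0)[B B0 BP] r r01; have /andP[r0 r1] := r01.
have mr := mass_gt0 v0 mass_pos C0 doubling r01.
have mf := mass_fin v0 mass_pos r0.
set m := fine (mass v r); have mE : mass v r = m%:E by rewrite /m fineK.
have m0 : 0 < m by rewrite -lte_fin -mE.
pose T := (B / m) `^ p^-1; have T0 : 0 <= T by exact: powR_ge0.
have term k : 2 ^+ k.+2 * (b k * r ^+ n k) <= T.
  have l0 : 0 <= 2 ^+ k.+2 * (b k * r ^+ n k) by rewrite mulr_ge0 ?exprn_ge0// mulr_ge0// exprn_ge0.
  have Bm : 0 <= B / m by rewrite divr_ge0// ltW.
  rewrite /T (powR_le_root l0 Bm p0) ler_pdivlMr//.
  have c0 : 0 <= 2 ^+ k.+2 * b k by rewrite mulr_ge0 ?exprn_ge0.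
  rewrite mulrA (powRM _ c0 (exprn_ge0 _ r0)).
  have : (((2 ^+ k.+2 * b k) `^ p)%:E * (((r ^+ n k) `^ p)%:E * mass v r) <= B%:E)%E.
    apply: (le_trans _ (le_trans (BP k) _)); last first.
      by rewrite lee_fin ler_piMr// exprn_ile1 ?invr_ge0// invf_le1// ler1n.
    apply: lee_wpmul2l; first by rewrite lee_fin powR_ge0.
    rewrite mass_radint// -radintZ ?powR_ge0//; last exact: measurable_ge_indic.
    apply: le_radint => // x /andP[x0 _]; rewrite mulr_ge0 ?powR_ge0//=.
    have [rx|_] := leP r x; last by rewrite mulr0 powR_ge0.
    by rewrite mulr1 ge0_ler_powR ?nnegrE ?exprn_ge0 ?(ltW p0)// lerXn2r ?nnegrE.
  by rewrite mE -!EFinM lee_fin mulrA.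
exists (1 + T) => K; rewrite (le_trans (pprod_le_sum K _)) ?r0 ?(ltW r1)// lerD2l.
have le k : b k * r ^+ n k <= T * 2^-1 ^+ k.+2.
  by rewrite exprVn ler_pdivlMr ?exprn_gt0// mulrC.
rewrite (@le_trans _ _ (\sum_(k < K) T * 2^-1 ^+ k.+2))//; first by apply: ler_sum => k _; exact: le.
rewrite -mulr_sumr ler_piMr//.
by rewrite (le_trans (sum_half_tail_le K))// invf_le1// ler1n.
Qed.

Let pprod_moment p : 0 < p -> summable_terms p -> exists B, forall K,
  (radint v (fun x => ((pprod a n K).[x] `^ p)%R) <= B%:E)%E.
Proof.
move=> p0 /(term_moment p0)[B B0 BP].
exists (2 `^ p * fine (mass v 0) + B * 2) => K.
pose c k : R := if k is k'.+1 then (2 ^+ k'.+2 * b k') `^ p else 2 `^ p.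
pose phi k x : R := if k is k'.+1 then (x ^+ n k') `^ p else (0 <= x)%R%:R.
apply: (@le_trans _ _ (radint v (fun x => (\sum_(l < K.+1) c l * phi l x)%R))).
  apply: le_radint => // x /andP[x0 x1]; rewrite powR_ge0/=.
  have xk k : 0 <= b k * x ^+ n k by rewrite mulr_ge0 ?exprn_ge0.
  apply: (@le_trans _ _ ((1 + \sum_(k < K) b k * x ^+ n k) `^ p)).
    rewrite ge0_ler_powR ?nnegrE ?(ltW p0)//.
    - by rewrite (le_trans ler01)// pprod_ge1.
    - by rewrite addr_ge0// sumr_ge0.
    - by rewrite pprod_le_sum// x0 ltW.
  rewrite (le_trans (powR_sum_le K p0 xk))// big_ord_recl/= x0 mulr1 lerD2l.
  by apply: ler_sum => k _; rewrite mulrA powRM ?exprn_ge0// mulr_ge0.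
rewrite (radint_sum mv v0); first last.
- by move=> [|k] x //=; exact: powR_ge0.
- by move=> [|k] /=; [exact: measurable_ge_indic|exact: measurable_power].
- by move=> [|k] /=; exact: powR_ge0.
rewrite big_ord_recl EFinD leeD//.
  by rewrite /= -mass_radint// EFinM fineK// (mass_fin v0 mass_pos).
apply: (@le_trans _ _ (\sum_(k < K) (B * 2^-1 ^+ k)%:E)%E).
  by apply: lee_sum => k _; exact: BP.
rewrite sumEFin lee_fin -mulr_sumr ler_wpM2l//.
exact: sum_half_le.
Qed.

(** The values of the partial products at |z| increase with K, so monotone
    convergence turns the uniform bound for their moments into one for the
    infinite product. *)
Lemma iprod_moment p : 0 < p -> summable_terms p ->
  (\int[area R]_(z in plane_disc R)
     (normc (iprod a n (of_plane z)) `^ p * v (normc (of_plane z)))%:E < +oo)%E.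
Proof.
move=> p0 sp; have bounded := summable_terms_bounded p0 sp.
have [B BP] := pprod_moment p0 sp.
pose g K (z : plane) : \bar R :=
  ((pprod a n K).[normc (of_plane z)] `^ p * v (normc (of_plane z)))%:E.
have mdisc : measurable (plane_disc R) := @measurable_plane_disc R.
have mg K : measurable_fun (plane_disc R) (g K).
  apply/measurable_EFinP; apply: measurable_funM.
    apply: measurable_funTS; apply: measurableT_comp (measurable_powR p) _.
    have mP : measurable_fun setT
        (horner (pprod a n K) : measurableTypeR R -> measurableTypeR R) by exact: measurable_poly.
    exact: measurableT_comp mP measurable_normc.
  exact: measurable_funTS (measurableT_comp mv measurable_normc).
have g0 K z : plane_disc R z -> (0 <= g K z)%E by move=> _; rewrite lee_fin mulr_ge0 ?powR_ge0.
have gm z : plane_disc R z -> {homo g^~ z : K L / (K <= L)%N >-> (K <= L)%E}.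
  move=> _ K L KL; rewrite lee_fin ler_wpM2r// ge0_ler_powR ?nnegrE ?(ltW p0)//.
  - by rewrite (le_trans ler01)// pprod_ge1// normc_ge0.
  - by rewrite (le_trans ler01)// pprod_ge1// normc_ge0.
  - by rewrite pprod_le// normc_ge0.
apply: (@le_lt_trans _ _ B%:E); last exact: ltry.
apply: (@le_trans _ _ (\int[area R]_(z in plane_disc R) limn (g^~ z))%E).
  apply: ge0_le_integral_any => z z1; first by rewrite lee_fin mulr_ge0 ?powR_ge0.
  have cg : cvgn (g^~ z) by apply: ereal_nondecreasing_is_cvgn; exact: gm.
  have gl K : (g K z <= limn (g^~ z))%E.
    by apply: lime_ge => //; exists K => // L /= KL; exact: gm.
  move: gl; case: (limn (g^~ z)) => [y|_|h]; last 2 first.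
  - by rewrite leey.
  - by have := h 0%N; rewrite leeNy_eq.
  move=> gy; rewrite lee_fin.
  have [->|vz] := eqVneq (v (normc (of_plane z))) 0.
    by rewrite mulr0; have := gy 0%N; rewrite lee_fin; apply: le_trans; rewrite mulr_ge0 ?powR_ge0.
  have vz0 : 0 < v (normc (of_plane z)) by rewrite lt_neqAle eq_sym vz v0.
  have y0 : 0 <= y / v (normc (of_plane z)).
    rewrite divr_ge0//; have := gy 0%N; rewrite lee_fin; apply: le_trans.
    by rewrite mulr_ge0 ?powR_ge0.
  rewrite -ler_pdivlMr// -powR_le_root ?normc_ge0//.
  apply: (normc_iprod_le a0 bounded z1) => K.
  rewrite powR_le_root//; last by rewrite (le_trans ler01)// pprod_ge1// normc_ge0.
  by rewrite ler_pdivlMr//; have := gy K; rewrite lee_fin.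
rewrite (monotone_convergence (area R) mdisc mg g0 gm).
apply: lime_le; last by exists 0%N => // K _; exact: BP.
apply: ereal_nondecreasing_is_cvgn => K L KL; apply: ge0_le_integral_any => z z1; first exact: g0.
exact: gm.
Qed.

End LacunaryProduct.

(** * Choice of the exponents and of the coefficients *)

Section ParameterChoice.
Context {R : realType}.
Implicit Types (D E q p : R) (k N : nat).
Variable W : nat -> R.
Hypotheses (W0 : forall m, 0 < W m) (le_W : forall m k, (m <= k)%N -> W k <= W m).
Hypothesis W_small : forall e : R, 0 < e -> exists m, W m <= e.
Variable q : R.
Hypothesis q0 : 0 < q.

Let coef k N : R := 8 * k.+1%:R * W N `^ (- q^-1).

Let scale k D : R := 2 ^+ (k + 5) * k.+1%:R * D.

Let next_exponent k N D : exists N',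
  [/\ (N <= N')%N, (k < N')%N, W N' <= 1 & W N' * scale k D `^ (q * k%:R) <= 1].
Proof.
set P := _ `^ _; have P0 : 0 <= P by exact: powR_ge0.
have P1 : 0 < 1 + P by rewrite ltr_pwDl.
have [m mP] := W_small (eqbRL (invr_gt0 _) P1).
(* k < N' makes every exponent positive, for [dyadic_radius_power]. *)
exists (maxn (maxn N k.+1) m).
have small : W (maxn (maxn N k.+1) m) <= (1 + P)^-1.
  by rewrite (le_trans (le_W _) mP)// leq_maxr.
split.
- by rewrite -maxnA leq_maxl.
- by rewrite (leq_trans (leq_maxr N k.+1))// leq_maxl.
- by rewrite (le_trans small)// invf_le1// lerDl.
- rewrite (le_trans (ler_wpM2r P0 small))// ler_pdivrMl// mulr1.
  by rewrite lerDr.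
Qed.

(** The mass W (e k) must be small compared with all coefficients of index less
    than k, while the coefficient of index k is determined by that mass; so both
    sequences come from one recursion, whose state carries the last exponent and
    the product of the previous factors. *)
Lemma exists_parameters : exists (e : nat -> nat) (a : nat -> R), forall k,
  [/\ (k < e k)%N, (e k <= e k.+1)%N, 8 <= a k,
      a k = 8 * k.+1%:R * W (e k) `^ (- q^-1) &
      W (e k) * (2 ^+ (k + 5) * k.+1%:R * \prod_(j < k) (1 + a j)) `^ (q * k%:R) <= 1].
Proof.
have /choice[pick pickP] : forall t : nat * nat * R, exists N', _ :=
  fun t => next_exponent t.1.1 t.1.2 t.2.
pose st := fix st k : nat * R := if k is k'.+1 then
  let N := pick (k', (st k').1, (st k').2) in (N, (st k').2 * (1 + coef k' N)) else (0%N, 1).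
pose e k := (st k.+1).1; pose a k := coef k (e k).
have stD k : (st k).2 = \prod_(j < k) (1 + a j).
  by elim: k => [|k IH]; rewrite ?big_ord0// big_ord_recr/= -IH.
exists e, a => k.
have [h1 h2 h3 h4] := pickP (k, (st k).1, (st k).2).
split => //.
- by have [] := pickP (k.+1, (st k.+1).1, (st k.+1).2).
- rewrite /a /coef powRN -mulrA ler_peMr// -[leLHS]mulr1 ler_pM//; first by rewrite ler1n.
  rewrite invf_ge1 ?powR_gt0//.
  have p1 : 1 `^ q^-1 = 1 :> R by rewrite powR1.
  by rewrite -[leRHS]p1 ge0_ler_powR ?nnegrE ?(ltW (W0 _))// invr_ge0 ltW.
- by rewrite -stD; exact: h4.
Qed.

Lemma geometric_tail_bound (M : nat -> R) k0 : (forall k, 0 <= M k) ->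
  (forall k, (k0 <= k)%N -> M k <= 2^-1 ^+ k) -> exists B, forall k, M k <= B * 2^-1 ^+ k.
Proof.
move=> M0 Mk; exists (1 + \sum_(j < k0) M j * 2 ^+ j) => k.
have t0 (j : 'I_k0) : 0 <= M j * 2 ^+ j by rewrite mulr_ge0 ?exprn_ge0.
have [/Mk kk|kk] := leqP k0 k.
  by rewrite (le_trans kk)// ler_peMl ?exprn_ge0// lerDl sumr_ge0.
rewrite exprVn ler_pdivlMr ?exprn_gt0// (bigD1 (Ordinal kk))//= addrCA lerDl.
by rewrite addr_ge0// sumr_ge0.
Qed.

(** The left-hand side is E^p w^(1 - p / q), and w <= E^(- q k) bounds it by
    E^(p - k (q - p)). *)
Lemma parameter_decay E w p k : 1 <= E -> 0 < w -> 0 < p < q ->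
  w * E `^ (q * k%:R) <= 1 -> p + 1 <= k%:R * (q - p) ->
  (E * w `^ (- q^-1)) `^ p * w <= E^-1.
Proof.
move=> E1 w0 /andP[p0 pq] wE kp; have E0 : 0 < E by rewrite (lt_le_trans ltr01).
have E0' : E != 0 by rewrite gt_eqF.
pose th := 1 - p / q; have th0 : 0 <= th by rewrite subr_ge0 ler_pdivrMr// mul1r ltW.
have -> : (E * w `^ (- q^-1)) `^ p * w = E `^ p * w `^ th.
  rewrite powRM ?powR_ge0 ?(ltW E0)// -mulrA; congr (_ * _).
  rewrite -powRrM -{2}(powRr1 (ltW w0)) -powRD; last by apply/implyP => _; rewrite gt_eqF.
  by congr (_ `^ _); rewrite /th; field; rewrite gt_eqF.
have wth : w `^ th * E `^ (k%:R * (q - p)) <= 1.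
  have -> : k%:R * (q - p) = q * k%:R * th by rewrite /th; field; rewrite gt_eqF.
  rewrite [E `^ _]powRrM -powRM ?powR_ge0 ?(ltW w0)//.
  have p1 : 1 `^ th = 1 :> R by rewrite powR1.
  by rewrite -[leRHS]p1 ge0_ler_powR ?nnegrE ?mulr_ge0 ?powR_ge0 ?(ltW w0).
rewrite -[leRHS]mul1r ler_pdivlMr// (le_trans _ wth)//.
rewrite mulrAC mulrC ler_wpM2l ?powR_ge0//.
rewrite -{2}(powRr1 (ltW E0)) -powRD ?E0' ?implybT//.
by rewrite ler_powR.
Qed.

End ParameterChoice.

(** * Lower bound for the partial products *)

Section FactorLowerBound.
Context {R : realType}.
Implicit Types (z : R[i]) (k N : nat).

Lemma dyadic_radius_power N : (0 < N)%N -> 4^-1 <= (dyadic_radius N : R) ^+ (2 ^ N).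
Proof.
case: N => // N _; elim: N => [|N IH].
  by rewrite /dyadic_radius expn1 expr1 expr2; lra.
rewrite expnS exprM (le_trans IH)// lerXn2r ?nnegrE ?sqr_ge0//.
  by case/andP: (@dyadic_radius_itv R N.+1).
rewrite /dyadic_radius [_ ^+ N.+2]exprS; set x := _ ^+ N.+1.
by rewrite -subr_ge0 (_ : _ - _ = (2^-1 * x) ^+ 2) ?sqr_ge0//; field.
Qed.

(** On the annulus of index k all the powers z^n_j with j <= k have modulus at
    least 1/4, so that each factor is dominated by its second term. *)
Lemma normc_pprodC_ge (a : nat -> R) (e : nat -> nat) k z :
  (forall j, 8 <= a j) -> (forall j, (j < e j)%N) -> (forall j, (e j <= e j.+1)%N) ->
  dyadic_radius (e k) <= normc z < 1 ->
  a k / 8 <= normc (pprodC a (fun j => (2 ^ e j)%N) k.+1 z).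
Proof.
move=> a8 je e_incr /andP[rz z1].
have e_mono j : (j <= k)%N -> (e j <= e k)%N.
  by move=> jk; apply: (homo_leq leqnn leq_trans e_incr).
have factor j : (j <= k)%N -> a j / 8 <= normc (1 + (a j)%:C * z ^+ (2 ^ e j)).
  move=> jk; have aj := a8 j; have aj0 : 0 <= a j by lra.
  have z4 : 4^-1 <= normc z ^+ (2 ^ e j).
    have ek0 : (0 < e k)%N by rewrite (leq_ltn_trans (leq0n k)).
    rewrite (le_trans (dyadic_radius_power ek0))//.
    have r0 : 0 <= (dyadic_radius (e k) : R) by case/andP: (@dyadic_radius_itv R (e k)).
    rewrite (@le_trans _ _ (normc z ^+ (2 ^ e k)))//; first by rewrite lerXn2r ?nnegrE ?normc_ge0.
    by rewrite ler_wiXn2l ?normc_ge0 ?(ltW z1)// leq_exp2l// e_mono.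
  have := normc_lerBD ((a j)%:C * z ^+ (2 ^ e j)) 1.
  rewrite normc1 normcM normcX normcR ger0_norm// [1 + _]addrC.
  move: (ler_wpM2l aj0 z4) aj; clear; move: (normc (_ + 1)) (a j * normc z ^+ _) => x y; lra.
rewrite /pprodC normc_prod big_ord_recr/=.
have /(_ k (leqnn k)) : forall i, (i <= k)%N ->
    1 <= \prod_(j < i) normc (1 + (a j)%:C * z ^+ (2 ^ e j)).
  elim=> [|i IH] ik; first by rewrite big_ord0.
  rewrite big_ord_recr/= -[leLHS]mulr1 ler_pM ?IH ?(ltnW ik)//.
  by rewrite (le_trans _ (factor _ (ltnW ik)))// ler_pdivlMr ?mul1r.
move=> h; rewrite (le_trans (factor k (leqnn k)))// ler_peMl ?normc_ge0//.
Qed.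

End FactorLowerBound.

(** * Zero sets of unions *)

Section ZeroSetsOfUnions.
Context {R : realType}.
Local Notation plane := (measurableTypeR R * measurableTypeR R)%type.
Implicit Types (f g : R[i] -> R[i]) (p : R).

Lemma half_itv p : 0 < p -> 0 < p / 2 < p.
Proof. by move=> p0; apply/andP; split; lra. Qed.

Lemma zero_orderM f g b m m' : zero_order f b m -> zero_order g b m' ->
  zero_order (fun z => f z * g z) b (m + m').
Proof.
move=> [f1 [f1a f1b fE]] [g1 [g1a g1b gE]]; exists (fun z => f1 z * g1 z); split.
- exact: (@analyticM _ f1 g1).
- by rewrite mulf_neq0.
- by move=> z z1; rewrite fE// gE// exprD mulrACA.
Qed.

Variable w : R[i] -> R.
Hypothesis hw : Dhat w.
Variable v : R -> R.
Hypothesis mv : measurable_fun setT (v : measurableTypeR R -> measurableTypeR R).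
Hypothesis v0 : forall x, 0 <= v x.
Variable B : set plane.
Hypotheses (mB : measurable B) (B0 : area R B = 0%E).
Hypothesis wv : forall p : plane, plane_disc R p -> ~ B p -> w (of_plane p) = v (normc (of_plane p)).

Let moment f p : \bar R :=
  (\int[area R]_(z in plane_disc R) (normc (f (of_plane z)) `^ p * v (normc (of_plane z)))%:E)%E.

Let measurable_moment f p : analytic_disc f -> measurable_fun (plane_disc R)
  (fun z => (normc (f (of_plane z)) `^ p * v (normc (of_plane z)))%:E).
Proof.
move=> fa; apply/measurable_EFinP; apply: measurable_funM.
  exact: measurableT_comp (measurable_powR p) (measurable_analytic fa).
exact: measurable_funTS (measurableT_comp mv measurable_normc).
Qed.

Let moment_ge0 f p : (0 <= moment f p)%E.
Proof. by apply: integral_ge0 => z _; rewrite lee_fin mulr_ge0 ?powR_ge0. Qed.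

(** Integrals against w and against its profile coincide because the two agree
    off a null set. *)
Lemma bergmanE f p : bergman w p f <-> analytic_disc f /\ (moment f p < +oo)%E.
Proof.
suff e : analytic_disc f -> (\int[area R]_(xy in plane_disc R)
       (normc (f (of_plane xy)) `^ p * w (of_plane xy))%:E)%E = moment f p.
  by split=> -[fa fi]; split => //; move: fi; rewrite e.
move=> fa; have [[w0 _ _] _ _] := hw.
apply: (@ge0_integral_eq_off _ _ _ _ _ _ _ B) => //.
- exact: measurable_plane_disc.
- exact: measurable_moment.
- by move=> z z1; rewrite lee_fin mulr_ge0 ?powR_ge0 ?w0.
- by move=> z z1; rewrite lee_fin mulr_ge0 ?powR_ge0.
- by move=> z z1 Bz; rewrite wv.
Qed.

(** The product is at most the square of the larger factor. *)
Lemma powR_mul_le (x y p : R) : 0 <= x -> 0 <= y -> 0 < p ->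
  (x * y) `^ (p / 2) <= x `^ p + y `^ p.
Proof.
move=> x0 y0 p0; have p2 : 0 <= p / 2 by rewrite divr_ge0// ltW.
have sq (t : R) : 0 <= t -> (t * t) `^ (p / 2) = t `^ p.
  have pp : p / 2 + p / 2 = p by lra.
  by move=> t0; rewrite powRM// -powRD pp// gt_eqF.
have [xy|yx] := leP x y.
  rewrite (@le_trans _ _ (y `^ p)) ?lerDr ?powR_ge0// -(sq y)//.
  by rewrite (ge0_ler_powR p2) ?nnegrE ?mulr_ge0// ler_wpM2r.
rewrite (@le_trans _ _ (x `^ p)) ?lerDl ?powR_ge0// -(sq x)//.
by rewrite (ge0_ler_powR p2) ?nnegrE ?mulr_ge0// ler_wpM2l// ltW.
Qed.

Lemma bergmanM f g p : 0 < p -> bergman w p f -> bergman w p g ->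
  bergman w (p / 2) (fun z => f z * g z).
Proof.
move=> p0 /bergmanE[fa fi] /bergmanE[ga gi]; apply/bergmanE.
have fga : analytic_disc (fun z => f z * g z) by exact: (@analyticM _ f g).
split; first exact: fga.
apply: le_lt_trans (lte_add_pinfty fi gi).
rewrite /moment -ge0_integralD//; last 5 first.
- exact: measurable_plane_disc.
- by move=> z _; rewrite lee_fin mulr_ge0 ?powR_ge0.
- exact: measurable_moment.
- by move=> z _; rewrite lee_fin mulr_ge0 ?powR_ge0.
- exact: measurable_moment.
apply: ge0_le_integral_any => z _; first by rewrite lee_fin mulr_ge0 ?powR_ge0.
rewrite -EFinD lee_fin -mulrDl ler_wpM2r// normcM powR_mul_le ?normc_ge0//.
Qed.

Lemma zero_set_union (I J : countType) (z : I -> R[i]) (z' : J -> R[i]) p : 0 < p ->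
  zero_set (bergman w p) z -> zero_set (bergman w p) z' ->
  zero_set (bergman w (p / 2)) (seq_union z z').
Proof.
move=> p0 [z1 [f fb fz]] [z'1 [g gb gz]]; split; first by case.
exists (fun u => f u * g u); first exact: bergmanM.
move=> u u1; have [m fm cm] := fz u u1; have [m' gm cm'] := gz u u1.
by exists (m + m')%N; [exact: zero_orderM|exact: card_seq_union].
Qed.

Hypothesis mass_pos : (0 < mass v 0 < +oo)%E.
Variable C : R.
Hypothesis C0 : 0 < C.
Hypothesis doubling : forall r, 0 <= r < 1 -> (mass v r <= C%:E * mass v ((1 + r) / 2)%R)%E.
Variable q : R.
Hypothesis q0 : 0 < q.

Let W := dyadic_mass v.
Let W0 : forall m, 0 < W m := dyadic_mass_gt0 v0 mass_pos C0 doubling.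

Variables (e : nat -> nat) (a : nat -> R).
Hypothesis par : forall k,
  [/\ (k < e k)%N, (e k <= e k.+1)%N, 8 <= a k,
      a k = 8 * k.+1%:R * W (e k) `^ (- q^-1) &
      W (e k) * (2 ^+ (k + 5) * k.+1%:R * \prod_(j < k) (1 + a j)) `^ (q * k%:R) <= 1].

Let a0 k : 0 <= a k.
Proof. by have [_ _ a8 _ _] := par k; lra. Qed.

Let n k := (2 ^ e k)%N.

(** The factor 2^(k + 5) in the choice of W (e k) absorbs the constant 8 of a_k
    and the 2^(k + 2) of [powR_sum_le], which leaves exactly the quantity of
    [parameter_decay]. *)
Lemma summable_terms_parameters p : 0 < p < q -> summable_terms a e v p.
Proof.
move=> pq; have /andP[p0 plt] := pq.
have [k0 k0P] : exists k0 : nat, p + 1 <= k0%:R * (q - p).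
  have qp : 0 < q - p by rewrite subr_gt0.
  have x0 : 0 <= (p + 1) / (q - p) by rewrite divr_ge0 ?(ltW qp)// addr_ge0// ltW.
  by exists (Num.bound ((p + 1) / (q - p))); rewrite -ler_pdivrMr// ltW// archi_boundP.
apply: (@geometric_tail_bound _ _ k0) => k.
  by rewrite mulr_ge0 ?powR_ge0// ltW.
move=> kk; have [_ _ _ aE Wk] := par k.
set E := (X in X `^ (q * _)) in Wk.
have D1 : 1 <= \prod_(j < k) (1 + a j).
  elim: (k) => [|i IH]; first by rewrite big_ord0.
  by rewrite big_ord_recr/= -[leLHS]mulr1 ler_pM// lerDl.
have E2 : 2 ^+ k <= E.
  rewrite /E -mulrA -[leLHS]mulr1 ler_pM ?exprn_ge0//.
    by rewrite ler_weXn2l ?leq_addr// ler1n.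
  by rewrite -[leLHS]mulr1 ler_pM// ler1n.
have E1 : 1 <= E by rewrite (le_trans _ E2)// exprn_ege1// ler1n.
have -> : 2 ^+ k.+2 * (a k * \prod_(j < k) (1 + a j)) = E * W (e k) `^ (- q^-1).
  rewrite aE /E addnC !exprS; move: (\prod_(j < k) _) (_ `^ _) k.+1%:R (2 ^+ k).
  by move=> x y u t; ring.
rewrite (le_trans (parameter_decay q0 E1 (W0 _) pq Wk _))//.
  by rewrite (le_trans k0P)// ler_wpM2r ?ler_nat// subr_ge0 ltW.
by rewrite exprVn lef_pV2 ?posrE ?exprn_gt0// (lt_le_trans ltr01).
Qed.

Let bounded : bounded_pprod a n.
Proof.
have q2 := half_itv q0; have /andP[q20 _] := q2.
exact: (summable_terms_bounded a0 mv v0 mass_pos C0 doubling q20 (summable_terms_parameters q2)).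
Qed.

Let n0 k : (0 < n k)%N.
Proof. by rewrite expn_gt0. Qed.

Lemma iprod_bergman p : 0 < p < q -> bergman w p (iprod a n).
Proof.
move=> pq; have /andP[p0 _] := pq; apply/bergmanE; split; first exact: analytic_iprod.
exact: (iprod_moment a0 mv v0 mass_pos C0 doubling p0 (summable_terms_parameters pq)).
Qed.

(** On the annulus of index k both copies of the first k + 1 factors have modulus
    at least a_k / 8; the remaining factors times h form an analytic function
    with the value h(0) at the origin, to which the mean value inequality
    applies. The coefficient a_k compensates the mass of the annulus, up to the
    factor k + 1, which is what makes the moments unbounded. *)
Lemma multiple_moment_ge h k : analytic_disc h ->
  ((k.+1%:R `^ q * normc (h 0) `^ (q / 2))%:E <=
   moment (fun z => iprod a n z * iprod a n z * h z)%R (q / 2)%R)%E.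
Proof.
move=> ha; have /andP[q2 _] := half_itv q0.
have [ke _ a8 aE _] := par k.
have rk := @dyadic_radius_itv R (e k); have /andP[r0 r1] := rk.
pose T := iprod (tail a k.+1) (tail n k.+1).
have Ta : analytic_disc T by apply: analytic_iprod; [move=> j; exact: a0|exact: bounded_tail].
pose hk z := T z * T z * h z.
have hka : analytic_disc hk := @analyticM _ (fun z => T z * T z) h (@analyticM _ T T Ta Ta) ha.
have hk0 : hk 0 = h 0.
  have T0 : T 0 = 1 by apply: iprod0; [move=> j; exact: a0|exact: bounded_tail|move=> j; exact: n0].
  by rewrite /hk T0 !mul1r.
have := annulus_mean_ge mv v0 hka q2 r0; rewrite hk0 (dyadic_massE v0 mass_pos) -/W -EFinM => mean.
have ak8 : 0 <= a k / 8 by rewrite divr_ge0.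
apply: (@le_trans _ _ (((a k / 8) `^ q)%:E * (normc (h 0) `^ (q / 2) * W (e k))%:E)%E).
  rewrite -EFinM lee_fin.
  have -> : a k / 8 = k.+1%:R * W (e k) `^ (- q^-1).
    by rewrite aE mulrAC [8 * _]mulrC mulfK.
  rewrite powRM ?powR_ge0// -powRrM mulNr mulVf ?gt_eqF// powRN (powRr1 (ltW (W0 _))).
  by rewrite mulrACA mulVf ?gt_eqF// mulr1.
apply: (le_trans (lee_wpmul2l _ mean)); first by rewrite lee_fin powR_ge0.
set A := annulus _.
have mA : measurable A by exact: measurable_annulus.
have AD : A `<=` plane_disc R by move=> z /andP[].
have mh : measurable_fun A
    (fun z => (normc (hk (of_plane z)) `^ (q / 2) * v (normc (of_plane z)))%:E).
  by apply: measurable_funS AD (measurable_moment _ hka); exact: measurable_plane_disc.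
have nonneg f z : A z -> (0 <= (normc (f (of_plane z)) `^ (q / 2) * v (normc (of_plane z)))%:E)%E.
  by move=> _; rewrite lee_fin mulr_ge0 ?powR_ge0.
have c0 : (0 <= ((a k / 8) `^ q)%:E)%E by rewrite lee_fin powR_ge0.
rewrite -(ge0_integralZl (area R) mA mh (nonneg hk) c0).
have fa := analytic_iprod a0 bounded.
have fha : analytic_disc (fun z => iprod a n z * iprod a n z * h z) :=
  @analyticM _ (fun z => iprod a n z * iprod a n z) h (@analyticM _ (iprod a n) (iprod a n) fa fa) ha.
apply: (@le_trans _ _ (\int[area R]_(z in A)
    (normc (iprod a n (of_plane z) * iprod a n (of_plane z) * h (of_plane z)) `^ (q / 2)
     * v (normc (of_plane z)))%:E)%E); last first.
  have nn (z : plane) : plane_disc R z ->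
      (0 <= (normc (iprod a n (of_plane z) * iprod a n (of_plane z) * h (of_plane z)) `^ (q / 2)
             * v (normc (of_plane z)))%:E)%E.
    by move=> _; rewrite lee_fin mulr_ge0 ?powR_ge0.
  exact: (ge0_subset_integral (area R) mA (@measurable_plane_disc R) (measurable_moment (q / 2) fha) nn AD).
apply: ge0_le_integral_any => z zr; first by rewrite -EFinM lee_fin !mulr_ge0 ?powR_ge0.
have z1 : unit_disc R (of_plane z) by case/andP: zr.
rewrite -EFinM lee_fin mulrA ler_wpM2r//.
rewrite (iprod_split a0 bounded k.+1 z1) -/T.
set P := pprodC _ _ _ _; set t := T _.
have PP : a k / 8 <= normc P.
  apply: normc_pprodC_ge zr; move=> j; by have [] := par j.
have -> : P * t * (P * t) * h (of_plane z) = (P * P) * hk (of_plane z).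
  by rewrite /hk -/t mulrACA !mulrA.
rewrite (normcM (P * P)) [leRHS]powRM ?normc_ge0// ler_wpM2r ?powR_ge0//.
rewrite normcM [leRHS]powRM ?normc_ge0// -powRD -splitr ?(gt_eqF q0)//.
by rewrite ge0_ler_powR ?nnegrE ?normc_ge0// ltW.
Qed.

(** A function with the doubled zeros is f^2 h with h(0) != 0, where f is the
    product; the lower bounds of [multiple_moment_ge] for all k contradict the
    finiteness of its moment. *)
Lemma zero_set_iprod_twice (I : countType) (z : I -> R[i]) : zero_set [set iprod a n] z ->
  ~ zero_set (bergman w (q / 2)) (seq_union z z).
Proof.
move=> [z1 [_ -> fz]] [_ [g /bergmanE[ga gi] gz]]; set f := iprod a n in fz.
have fa : analytic_disc f by exact: analytic_iprod.
have order u : unit_disc R u -> exists2 m, zero_order f u m & zero_order g u (m + m)%N.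
  move=> u1; have [m fm cm] := fz u u1; have [m' gm cm'] := gz u u1; exists m => //.
  have := card_eq_trans (card_esym cm') (card_seq_union cm cm).
  by move=> /card_eq_II <-.
have [h ha gE] : exists2 h, analytic_disc h &
    forall u, unit_disc R u -> g u = f u * f u * h u.
  have ffa : analytic_disc (fun u => f u * f u) := @analyticM _ f f fa fa.
  apply: (analytic_quotient ffa ga) => u /order[m fm gm]; exists (m + m)%N, (m + m)%N; split => //.
  exact: zero_orderM.
have u0 : unit_disc R 0 by change (normc (0 : R[i]) < 1); rewrite normc0 ltr01.
have f0 : f 0 = 1 by apply: iprod0.
have h0 : h 0 != 0.
  have [m [f1 [_ _ fE]] [g1 [_ g10 g1E]]] := order 0 u0.
  have m0 : m = 0%N.
    case: m fE {g1E} => // m /(_ 0 u0); rewrite f0 subrr exprS !mul0r => /eqP.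
    by rewrite oner_eq0.
  by have := gE 0 u0; rewrite g1E// m0 f0 !mul1r => <-.
have c0 : 0 < normc (h 0) `^ (q / 2) by rewrite powR_gt0// normc_gt0.
set c := _ `^ _ in c0.
have gm : moment g (q / 2) = moment (fun u => f u * f u * h u) (q / 2).
  by apply: eq_integral => p; rewrite inE => p1; rewrite gE.
have mn : moment g (q / 2) \is a fin_num.
  by rewrite ge0_fin_numE ?moment_ge0.
move=> {fz gz order gE fa ga gi z1}; pose M := (fine (moment g (q / 2)) / c) `^ q^-1.
have fm0 : 0 <= fine (moment g (q / 2)) / c.
  by rewrite divr_ge0 ?(ltW c0)// fine_ge0 ?moment_ge0.
have M0 : 0 <= M by exact: powR_ge0.
have := multiple_moment_ge (Num.bound M) ha; rewrite -gm -(fineK mn) lee_fin -/c.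
rewrite -(ler_pdivlMr _ _ c0) -(powR_le_root (ler0n _ _) fm0 q0) -/M.
by apply/negP; rewrite -ltNge (lt_trans (archi_boundP M0))// ltr_nat.
Qed.

End ZeroSetsOfUnions.

Theorem corollary5p5 (R : realType) (w : R[i] -> R) (hw : Dhat w) :
  (forall p : R, 0 < p ->
     forall (I J : countType) (z : I -> R[i]) (z' : J -> R[i]),
       zero_set (bergman w p) z -> zero_set (bergman w p) z' ->
       zero_set (bergman w (p / 2)) (seq_union z z')) /\
  (forall q : R, 0 < q ->
     exists (I J : countType) (z : I -> R[i]) (z' : J -> R[i]),
       [/\ zero_set (\bigcap_(p in [set p : R | 0 < p < q]) bergman w p) z,
           zero_set (\bigcap_(p in [set p : R | 0 < p < q]) bergman w p) z' &
           ~ zero_set (bergman w (q / 2)) (seq_union z z')]).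
Proof.
have [v [[mv v0] [B [mB B0] wv] mass_pos [C C0 doubling]]] := Dhat_profile hw.
split=> [p p0 I J z z'|q q0]; first exact: (zero_set_union hw mv v0 mB B0 wv p0).
have [e [a par]] := exists_parameters (dyadic_mass_gt0 v0 mass_pos C0 doubling)
  (fun m k => @le_dyadic_mass _ _ v0 mass_pos m k) (@dyadic_mass_cvg0 _ _ mv v0 mass_pos) q0.
pose n k := (2 ^ e k)%N.
have a1 k : 1 < a k by have [_ _ a8 _ _] := par k; lra.
have n0 k : (0 < n k)%N by rewrite expn_gt0.
have a0 k : 0 <= a k by rewrite ltW// (lt_trans ltr01).
have q2 := half_itv q0; have /andP[q20 _] := q2.
have st := summable_terms_parameters v0 mass_pos C0 doubling q0 par q2.
have bounded : bounded_pprod a n :=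
  summable_terms_bounded a0 mv v0 mass_pos C0 doubling q20 st.
pose z := product_zeros (a := a) (n := n) (a1 := a1) (n0 := n0).
have zP X : X (iprod a n) -> zero_set X z by move=> Xf; exact: zero_set_iprod.
have zcap : zero_set (\bigcap_(p in [set p : R | 0 < p < q]) bergman w p) z.
  by apply: zP => p /= pq; exact: (iprod_bergman hw mv v0 mB B0 wv mass_pos C0 doubling q0 par).
exists _, _, z, z; split => //.
exact: (zero_set_iprod_twice hw mv v0 mB B0 wv mass_pos C0 doubling q0 par (zP _ erefl)).
Qed.
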